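(* For $G=\mathbb R^2$ and $P=\mathbb R_+^2=[0,\infty)\times[0,\infty)$, an irreducible weak Weyl pair $(U,V)$ (not assumed to have commuting range projections) is not determined up to unitary equivalence by $\mathrm{Spec}(U)$: there exist irreducible weak Weyl pairs $(U,V)$ on $H$ and $(\widetilde U,\widetilde V)$ on $\widetilde H$ with $\mathrm{Spec}(U)=\mathrm{Spec}(\widetilde U)$ for which there is no unitary $X:H\to\widetilde H$ satisfying $XU_\chi X^*=\widetilde U_\chi$ and $XV_aX^*=\widetilde V_a$ for all $\chi\in\widehat G$, $a\in P$.
   Context: All Hilbert spaces are separable. $\widehat G$ is the Pontryagin dual of $G=\mathbb R^2$, identified with $\mathbb R^2$ in the usual way. A weak Weyl pair $(U,V)$ on a Hilbert space $H$ consists of a strongly continuous group of unitaries $U=\{U_\chi\}_{\chi\in\widehat G}$ on $H$ and a strongly continuous semigroup of isometries $V=\{V_a\}_{a\in P}$ on $H$ such that $U_\chi V_a=\chi(a)V_aU_\chi$ for all $\chi\in\widehat G$, $a\in P$. It has commuting range projections if $\{V_aV_a^*:a\in P\}$ is a commuting family. It is irreducible if the commutant of the von Neumann algebra generated by $\{U_\chi,V_a:\chi\in\widehat G,a\in P\}$ is $\mathbb C$. A strongly continuous unitary group $U=\{U_\chi\}_{\chi\in\widehat G}$ determines a representation $\pi_U$ of $C_0(G)\cong C^*(\widehat G)$ (integrated form, with $C^*(\widehat G)$ identified with $C_0(G)$ via the Gelfand transform and Pontryagin duality). $\mathrm{Spec}(U)$ is the unique closed subset $F\subset G$ with $\ker(\pi_U)=\{f\in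 C_0(G):f|_F=0\}$. *)

(* Defs.v *)
From HB Require Import structures.
From mathcomp Require Import all_boot all_order all_algebra.
From mathcomp Require Import complex.
From mathcomp Require Import all_classical all_reals all_analysis.

Set Implicit Arguments.
Unset Strict Implicit.
Unset Printing Implicit Defensive.

Import Order.TTheory GRing.Theory Num.Theory.
Import numFieldNormedType.Exports.

Local Open Scope classical_set_scope.
Local Open Scope complex_scope.
Local Open Scope ring_scope.

(* Norms of a normed module over R[i] take values in R[i]; the inner product
   is linear in its first argument and conjugate-linear in the second.
   Wherever a topology on R[i] is needed, the codomain is written R[i]^o. *)
Record hilbertType (R : realType) := HilbertType {
  hilbert_sort :> completeNormedModType R[i];
  inner : {dot hilbert_sort for Num.conj};
  sqr_norm_inner : forall x : hilbert_sort, `|x| ^+ 2 = inner x x;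
  hilbert_separable : exists2 D : set hilbert_sort, countable D & dense D
}.

Section Operators.
Context {R : realType}.
Implicit Types H K : hilbertType R.

Definition bounded_operator H K (T : H -> K) : Prop :=
  linear T /\ continuous T.

Definition adjoint_operator H K (T : H -> K) (T' : K -> H) : Prop :=
  forall (x : H) (y : K), inner K (T x) y = inner H x (T' y).

(* T is a unitary and T' is its adjoint *)
Definition unitary_with H K (T : H -> K) (T' : K -> H) : Prop :=
  [/\ bounded_operator T, bounded_operator T', adjoint_operator T T',
      T' \o T = id & T \o T' = id].

Definition unitary H K (T : H -> K) : Prop :=
  exists T' : K -> H, unitary_with T T'.

Definition isometric H K (T : H -> K) : Prop :=
  bounded_operator T /\ forall x, `|T x| = `|x|.

(* A unital *-subalgebra of B(H), closed in the weak operator topology; a set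
   is closed when it contains the limits of the proper filters living on it. *)
Record von_neumann_algebra H (M : set (H -> H)) : Prop := {
  vN_bounded : forall S, M S -> bounded_operator S;
  vN_one : M id;
  vN_add : forall S T, M S -> M T -> M (S \+ T);
  vN_scale : forall (c : R[i]) S, M S -> M (fun x => c *: S x);
  vN_comp : forall S T, M S -> M T -> M (S \o T);
  vN_adjoint : forall S S', M S -> adjoint_operator S S' -> M S';
  vN_wot_closed : forall (F : set_system (H -> H)) (T : H -> H),
    ProperFilter F -> F M -> bounded_operator T ->
    (forall x y : H,
       (fun S : H -> H => inner H (S x) y : R[i]^o) @ F
         --> (inner H (T x) y : R[i]^o)) ->
    M T
}.

Definition von_neumann_generated H (S : set (H -> H)) : set (H -> H) :=
  smallest (@von_neumann_algebra H) S.

Definition commutant H (M : set (H -> H)) : set (H -> H) :=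
  [set T | bounded_operator T /\ forall S, M S -> T \o S = S \o T].

Definition scalar_operators H : set (H -> H) :=
  [set T | exists c : R[i], T = fun x => c *: x].

End Operators.

Arguments scalar_operators {R} H.

Section Weyl.
Context {R : realType}.
Implicit Types H : hilbertType R.

Definition quadrant : set (R * R) := [set a | 0 <= a.1 /\ 0 <= a.2].

(* The value at a of the character of R^2 labelled by chi: exp(i <chi, a>) *)
Definition character (chi a : R * R) : R[i] :=
  let t := chi.1 * a.1 + chi.2 * a.2 in cos t +i* sin t.

Definition unitary_group H (U : R * R -> H -> H) : Prop :=
  [/\ forall chi, unitary (U chi),
      U 0 = id,
      forall chi psi, U (chi + psi) = U chi \o U psi &
      forall x, continuous (fun chi => U chi x)].

(* The values of V outside the quadrant are irrelevant. *)
Definition isometry_semigroup H (V : R * R -> H -> H) : Prop :=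
  [/\ forall a, quadrant a -> isometric (V a),
      V 0 = id,
      forall a b, quadrant a -> quadrant b -> V (a + b) = V a \o V b &
      forall x, {within quadrant, continuous (fun a => V a x)}].

Definition weak_weyl_pair H (U V : R * R -> H -> H) : Prop :=
  [/\ unitary_group U,
      isometry_semigroup V &
      forall chi a x, quadrant a ->
        U chi (V a x) = character chi a *: V a (U chi x)].

(* On the zero space the scalar operators are not a copy of R[i], hence the
   first clause. *)
Definition irreducible H (U V : R * R -> H -> H) : Prop :=
  (exists x : H, x != 0) /\
  commutant (von_neumann_generated (range U `|` V @` quadrant))
    = scalar_operators H.

End Weyl.

Section Spectrum.
Context {R : realType}.
Implicit Types H : hilbertType R.

Local Notation T2 := (measurableTypeR R * measurableTypeR R)%type.

Definition lebesgue2 : {measure set T2 -> \bar R} :=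
  (@lebesgue_measure R \x @lebesgue_measure R)%E.

Definition complex_integrable (f : R * R -> R[i]) : Prop :=
  lebesgue2.-integrable setT (fun t : T2 => (complex.Re (f t))%:E) /\
  lebesgue2.-integrable setT (fun t : T2 => (complex.Im (f t))%:E).

Definition complex_integral (f : R * R -> R[i]) : R[i] :=
  (\int[lebesgue2]_(t in setT) complex.Re (f t))
    +i* (\int[lebesgue2]_(t in setT) complex.Im (f t)).

(* The Gelfand transform on L^1 of the dual group, a point a of R^2 being
   identified with the evaluation chi |-> chi(a) *)
Definition gelfand_transform (phi : R * R -> R[i]) (a : R * R) : R[i] :=
  complex_integral (fun chi => phi chi * character chi a).

Definition C0 : set (R * R -> R[i]) :=
  [set f | continuous (f : R * R -> R[i]^o) /\
           forall e : R[i], 0 < e -> compact [set a | e <= `|f a|]].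

Record C0_representation H (pi : (R * R -> R[i]) -> H -> H) : Prop := {
  C0_rep_bounded : forall f, C0 f -> bounded_operator (pi f);
  C0_rep_add : forall f g, C0 f -> C0 g ->
    pi (fun a => f a + g a) = pi f \+ pi g;
  C0_rep_scale : forall (c : R[i]) f, C0 f ->
    pi (fun a => c * f a) = fun x => c *: pi f x;
  C0_rep_mul : forall f g, C0 f -> C0 g ->
    pi (fun a => f a * g a) = pi f \o pi g;
  C0_rep_adjoint : forall f, C0 f ->
    adjoint_operator (pi f) (pi (fun a => Num.conj (f a)))
}.

(* pi is the representation of C_0(R^2) determined by U: it maps the Gelfand
   transform of phi to the weak integral of phi(chi) U_chi.  Gelfand transforms
   of L^1 functions being dense in C_0(R^2), it is unique on C_0(R^2). *)
Definition integrated_form H (U : R * R -> H -> H)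
    (pi : (R * R -> R[i]) -> H -> H) : Prop :=
  C0_representation pi /\
  forall phi, complex_integrable phi -> forall x y : H,
    inner H (pi (gelfand_transform phi) x) y =
    complex_integral (fun chi => phi chi * inner H (U chi x) y).

(* F = Spec(U): the kernel of pi_U is the ideal of functions vanishing on F *)
Definition is_spectrum H (U : R * R -> H -> H) (F : set (R * R)) : Prop :=
  closed F /\
  exists2 pi, integrated_form U pi &
    [set f | C0 f /\ pi f = (fun=> 0)] =
    [set f | C0 f /\ forall a, F a -> f a = 0].

End Spectrum.

(* X U_chi X^* = U~_chi and X V_a X^* = V~_a, for some unitary X with
   adjoint X' *)
Definition unitarily_equivalent (R : realType) (H K : hilbertType R)
    (U V : R * R -> H -> H) (U' V' : R * R -> K -> K) : Prop :=
  exists (X : H -> K) (X' : K -> H),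
    [/\ unitary_with X X',
        forall chi, X \o U chi \o X' = U' chi &
        forall a, quadrant a -> X \o V a \o X' = V' a].

(* Main.v *)
(** Glue two canonical Weyl pairs, living on the half planes [0 <= x1] and
    [0 <= x2]: on pairs (f, g) of L^2 functions supported in these half planes,
    take as squared norm the integral of |f|^2 + |g|^2 + 2 c Re (f conj g), for
    a constant 0 < c < 1.  Multiplication by characters and translation by
    vectors of the quadrant form a weak Weyl pair whose spectrum is the union of
    the two half planes, whatever the angle c.

    A bounded intertwiner commutes with multiplication by indicators of dyadic
    squares, which are limits of trigonometric polynomials.  A square of a half
    plane is a translate of a square that misses the other half plane, so the
    intertwiner maps its vector into one component; translation invariance and
    additivity then make the intertwiner a scalar on each component.  The adjoint
    of a translation mixes the components through c, which gives irreducibility;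
    and the scalars of a unitary intertwiner have modulus one, so that it
    preserves c.  The angles 1/2 and 1/3 are therefore inequivalent. *)

From HB Require Import structures.
Require Import Defs.
From mathcomp Require Import all_boot all_order all_algebra.
From mathcomp Require Import complex sesquilinear.
From mathcomp Require Import all_classical all_reals all_analysis.
From mathcomp Require Import measurable_realfun.
From mathcomp Require Import ring lra zify.

Set Implicit Arguments.
Unset Strict Implicit.
Unset Printing Implicit Defensive.

Import Order.TTheory GRing.Theory Num.Theory.
Import numFieldNormedType.Exports.

Local Open Scope classical_set_scope.
Local Open Scope complex_scope.
Local Open Scope ring_scope.

(** Fix two unit vectors of C^2 with inner product [c], one for each half plane. The fibre of the
    glued space at [x] is the span of those whose half plane contains [x]; it can only grow along
    the quadrant, which lets translations preserve the space. Over the quadrant, [V_a V_a^*] for [a]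
    on one axis or the other projects onto one line or the other. For [0 < c < 1] these projections
    do not commute, which leaves room for a continuous invariant. At [c = 0] the pair is a direct
    sum, at [c = 1] the form degenerates; any two distinct values strictly between would do.

    The obstacle is that over the quadrant the fibre is all of C^2, so commuting with characters
    only confines an intertwiner to act fibrewise, by matrices that need not be diagonal.
    Diagonality comes from the points of a single half plane, where the fibre is a line, and is
    carried into the quadrant by [V]. One statement on bounded maps between the spaces of two angles
    serves twice: with equal angles for the commutant, with distinct ones for inequivalence. *)

Local Notation Re := complex.Re.
Local Notation Im := complex.Im.


(** * Hilbert spaces from semi-inner products *)

Section SemiInner.
Context {R : realType} {V : lmodType R[i]} (f : V -> V -> R[i]).
Hypothesis fDl : forall x y z, f (x + y) z = f x z + f y z.
Hypothesis fZl : forall c x z, f (c *: x) z = c * f x z.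
Hypothesis fC : forall x y, f y x = Num.conj (f x y).
Hypothesis f_ge0 : forall x, 0 <= f x x.

Let fZr c z x : f z (c *: x) = Num.conj c * f z x.
Proof. by rewrite fC fZl rmorphM /= -fC. Qed.

Let fNl x y : f (- x) y = - f x y.
Proof. by rewrite -scaleN1r fZl mulN1r. Qed.

Let fBl x y z : f (x - y) z = f x z - f y z.
Proof. by rewrite fDl fNl. Qed.

Let fBr z x y : f z (x - y) = f z x - f z y.
Proof. by rewrite fC fBl rmorphB /= -!fC. Qed.

Lemma semi_inner_CS x y : `|f x y| ^+ 2 <= f x x * f y y.
Proof.
rewrite normCK.
wlog suff main : x y / 0 < f y y -> f x y * (f x y)^* <= f x x * f y y.
  have := f_ge0 y; rewrite le_eqVlt => /orP[/eqP y0|]; last exact: main.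
  have := f_ge0 x; rewrite le_eqVlt => /orP[/eqP x0|]; last first.
    by move=> /(main y x); rewrite [f y x]fC conjCK mulrC [leRHS]mulrC.
  (* Both vectors are null here, and positivity reads [- 2 |f x y|^2 >= 0]. *)
  have := f_ge0 (x - f x y *: y).
  rewrite !(fBl, fBr, fZl, fZr) -x0 -y0 [f y x]fC.
  rewrite !mulr0 subr0 sub0r => h.
  have : 0 <= - (f x y * (f x y)^* *+ 2).
    by apply: le_trans h _; rewrite mulr2n opprD mulrC.
  by rewrite oppr_ge0 pmulrn_lle0.
move=> y0.
(* The residual of the projection of [x] on [y], multiplied by [f y y] to avoid a division. *)
have := f_ge0 (f y y *: x - f x y *: y).
rewrite !(fBl, fBr, fZl, fZr) [f y x]fC.
have -> : (f y y)^* = f y y by rewrite -fC.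
set s := f x y; set t := s^*; set A := f x x; set B := f y y.
have -> : B * (B * A) - B * (t * s) - (s * (B * t) - s * (t * B))
          = B * (A * B - s * t) by ring.
by rewrite pmulr_rge0// subr_ge0.
Qed.

End SemiInner.

(** Null vectors are allowed, so functions need not be taken modulo null sets at this stage.
    Completeness and separability are stated for the squared seminorm, as a real number. *)
Record preHilbert (R : realType) := PreHilbert {
  pre_sort :> lmodType R[i];
  pip : pre_sort -> pre_sort -> R[i];
  pipDl : forall x y z, pip (x + y) z = pip x z + pip y z;
  pipZl : forall c x z, pip (c *: x) z = c * pip x z;
  pipC : forall x y, pip y x = Num.conj (pip x y);
  pip_ge0 : forall x, 0 <= pip x x;
  pip_complete : forall u : nat -> pre_sort,
    (forall e : R, 0 < e -> exists N, forall m n, (N <= m)%N -> (N <= n)%N ->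
      complex.Re (pip (u m - u n) (u m - u n)) <= e) ->
    exists l, forall e : R, 0 < e -> exists N, forall n, (N <= n)%N ->
      complex.Re (pip (u n - l) (u n - l)) <= e;
  pip_separable : exists2 D : set pre_sort, countable D &
    forall x (e : R), 0 < e -> exists2 d, D d & complex.Re (pip (x - d) (x - d)) < e
}.
Arguments pip {R p}.

Section PreHilbertTheory.
Context {R : realType} (p : preHilbert R).
Implicit Types x y z : p.

Definition nsq x : R := complex.Re (pip x x).

Lemma pip_nsq x : pip x x = (nsq x)%:C.
Proof. by rewrite /nsq RRe_real// ger0_real// pip_ge0. Qed.

Lemma nsq_ge0 x : 0 <= nsq x.
Proof. by rewrite -ler0c -pip_nsq pip_ge0. Qed.

Lemma pipDr z x y : pip z (x + y) = pip z x + pip z y.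
Proof. by rewrite pipC pipDl rmorphD /= -!pipC. Qed.

Lemma pipZr c z x : pip z (c *: x) = Num.conj c * pip z x.
Proof. by rewrite pipC pipZl rmorphM /= -pipC. Qed.

Lemma pipNl x y : pip (- x) y = - pip x y.
Proof. by rewrite -scaleN1r pipZl mulN1r. Qed.

Lemma pipNr x y : pip x (- y) = - pip x y.
Proof. by rewrite pipC pipNl rmorphN /= -pipC. Qed.

Lemma pipBl x y z : pip (x - y) z = pip x z - pip y z.
Proof. by rewrite pipDl pipNl. Qed.

Lemma pipBr x y z : pip x (y - z) = pip x y - pip x z.
Proof. by rewrite pipDr pipNr. Qed.

Lemma pip_CS x y : `|pip x y| ^+ 2 <= pip x x * pip y y.
Proof. exact: (semi_inner_CS (@pipDl _ p) (@pipZl _ p) (@pipC _ p) (@pip_ge0 _ p)). Qed.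

Lemma pip_null x y : pip x x = 0 -> pip x y = 0.
Proof.
move=> x0; have := pip_CS x y; rewrite x0 mul0r => h.
by apply/eqP; rewrite -normr_eq0 -sqrf_eq0 eq_le h exprn_ge0.
Qed.

(** The Hausdorff quotient is realised inside a function space: [e] is sent to [pip e], and two
    vectors give the same functional exactly when their difference is null. The module structure is
    then inherited from functions. *)
Definition functional : {pred p -> R[i]^o} := fun F => `[< exists e, F = pip e >].

Lemma functionalP (F : p -> R[i]^o) : F \in functional <-> exists e, F = pip e.
Proof. by split => /asboolP. Qed.

Lemma functional_submod : submod_closed functional.
Proof.
split=> [|c F G].
  apply/functionalP; exists 0; apply/funext => y.
  by rewrite -[X in pip X](scale0r 0) pipZl mul0r.
move=> /functionalP[e ->] /functionalP[f ->]; apply/functionalP.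
by exists (c *: e + f); apply/funext => y; rewrite pipDl pipZl.
Qed.

HB.instance Definition _ :=
  GRing.isSubmodClosed.Build _ _ functional functional_submod.

Definition hilb := {F : p -> R[i]^o | F \in functional}.

HB.instance Definition _ := [isSub of hilb for @sval _ _].
HB.instance Definition _ := [Choice of hilb by <:].
HB.instance Definition _ := [SubChoice_isSubLmodule of hilb by <:].

Implicit Types F G : hilb.

Lemma hilb_rep_ex F : exists e, val F = pip e.
Proof. exact/functionalP/(valP F). Qed.

Definition rep F : p := projT1 (cid (hilb_rep_ex F)).

Lemma repP F : val F = pip (rep F).
Proof. by rewrite /rep; case: cid. Qed.

Lemma cls_proof (e : p) : (pip e : p -> R[i]^o) \in functional.
Proof. by apply/functionalP; exists e. Qed.

Definition cls (e : p) : hilb := exist (fun F : p -> R[i]^o => F \in functional) _ (cls_proof e).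

Lemma repK F : cls (rep F) = F.
Proof. by apply: val_inj; rewrite /= -repP. Qed.

Lemma clsP (P : hilb -> Prop) : (forall e, P (cls e)) -> forall F, P F.
Proof. by move=> h F; rewrite -(repK F). Qed.

Lemma cls_linear : linear cls.
Proof. by move=> c e f; apply: val_inj; apply/funext => y; rewrite /= pipDl pipZl. Qed.

HB.instance Definition _ := GRing.isLinear.Build _ _ _ _ cls cls_linear.

Definition hip F G : R[i] := pip (rep F) (rep G).

(** [hip] is computed on chosen representatives; this is its independence of the choice. *)
Lemma hip_cls e f : hip (cls e) (cls f) = pip e f.
Proof.
have h a b : pip (rep (cls a)) b = pip a b.
  exact: (esym (congr1 (fun F : p -> R[i]^o => F b) (repP (cls a)))).
by rewrite /hip h pipC h -pipC.
Qed.

Lemma hipC F G : hip F G = (-1) ^+ false * Num.conj (hip G F).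
Proof.
elim/clsP: F => e; elim/clsP: G => f; by rewrite !hip_cls mul1r pipC.
Qed.

Let hipDl G : zmod_morphism (hip^~ G).
Proof.
elim/clsP: G => g; elim/clsP => e; elim/clsP => f.
by rewrite -raddfB !hip_cls pipBl.
Qed.

Let hipDr F : zmod_morphism (hip F).
Proof.
elim/clsP: F => g; elim/clsP => e; elim/clsP => f.
by rewrite -raddfB !hip_cls pipBr.
Qed.

Let hipZl G : scalable_for *%R (hip^~ G).
Proof.
by elim/clsP: G => g c; elim/clsP => e; rewrite -linearZ !hip_cls pipZl.
Qed.

Let hipZr F : scalable_for (Num.conj \; *%R) (hip F).
Proof.
by elim/clsP: F => g c; elim/clsP => e; rewrite -linearZ !hip_cls pipZr.
Qed.

HB.instance Definition _ := isBilinear.Build _ _ _ _ _ _ hip hipDl hipDr hipZl hipZr.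

HB.instance Definition _ := isHermitianSesquilinear.Build _ _ _ _ hip hipC.

Lemma hip_gt0 F : F != 0 -> 0 < hip F F.
Proof.
elim/clsP: F => e; rewrite hip_cls lt_def pip_ge0 andbT; apply: contraNN => /eqP e0.
by apply/eqP/val_inj/funext => y; rewrite /= pip_null.
Qed.

HB.instance Definition _ := isDotProduct.Build _ _ hip hip_gt0.

Definition hnrm F : R[i] := sqrtC (hip F F).

Lemma hnrm_cls e : hnrm (cls e) = sqrtC (pip e e).
Proof. by rewrite /hnrm hip_cls. Qed.

Lemma hnrm_eq0 F : hnrm F = 0 -> F = 0.
Proof.
move=> /eqP; rewrite /hnrm sqrtC_eq0 => h; apply: contraTeq h => /hip_gt0.
by rewrite lt_def => /andP[].
Qed.

Lemma hnrmZ c F : hnrm (c *: F) = `|c| * hnrm F.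
Proof.
elim/clsP: F => e; rewrite -linearZ !hnrm_cls pipZl pipZr mulrA -normCK.
by rewrite sqrtCM ?nnegrE ?pip_ge0 ?exprn_ge0// sqrCK.
Qed.

Lemma hnrmD F G : hnrm (F + G) <= hnrm F + hnrm G.
Proof.
elim/clsP: F => e; elim/clsP: G => f; rewrite -raddfD !hnrm_cls.
have ne := pip_ge0 e; have nf := pip_ge0 f; have nef := pip_ge0 (e + f).
rewrite -(@ler_pXn2r _ 2)// ?nnegrE ?addr_ge0 ?sqrtC_ge0// sqrrD !sqrtCK.
rewrite pipDl !pipDr addrA lerD2r -addrA lerD2l -sqrtCM//.
have cs := pip_CS e f.
have {cs} : `|pip e f| <= sqrtC (pip e e * pip f f).
  by rewrite -(@ler_pXn2r _ 2)// ?nnegrE ?sqrtC_ge0 ?mulr_ge0// sqrtCK.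
set s := sqrtC _ => cs.
rewrite (_ : pip f e = (pip e f)^*); last exact: pipC.
have sr : s \is Num.real by apply: ger0_real; apply: le_trans cs.
apply: le_trans (_ : `|pip e f| *+ 2 <= _); last by rewrite lerMn2r.
apply: le_trans (_ : `|pip e f + (pip e f)^*| <= _).
  apply: real_ler_norm.
  by rewrite CrealE rmorphD/= conjCK addrC.
by apply: le_trans (ler_normD _ _) _; rewrite norm_conjC mulr2n.
Qed.

HB.instance Definition _ :=
  Lmodule_isNormed.Build R[i] hilb hnrmD hnrmZ hnrm_eq0.

Lemma hilb_normE F : `|F| = hnrm F. Proof. by []. Qed.

Lemma hilb_sqr_norm F : `|F| ^+ 2 = hip F F.
Proof. by rewrite hilb_normE sqrtCK. Qed.

Lemma hilb_norm_cls e : `|cls e| = (Num.sqrt (nsq e))%:C.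
Proof.
rewrite hilb_normE hnrm_cls pip_nsq; apply: (@pexpIrn _ 2) => //.
- by rewrite nnegrE sqrtC_ge0 ler0c nsq_ge0.
- by rewrite nnegrE ler0c sqrtr_ge0.
- by rewrite sqrtCK -rmorphXn /= sqr_sqrtr// nsq_ge0.
Qed.

Lemma hilb_normBE e f : `|cls e - cls f| = (Num.sqrt (nsq (e - f)))%:C.
Proof. by rewrite -raddfB hilb_norm_cls. Qed.

Lemma gt0_complexE (e : R[i]) : 0 < e -> exists2 r : R, 0 < r & e = r%:C.
Proof.
move=> e0; exists (complex.Re e); last by rewrite RRe_real// gtr0_real.
by rewrite -ltcR RRe_real// gtr0_real.
Qed.

(** A Cauchy filter contains balls of radius [1 / (n + 1)]. Any two of them meet, so their centres
    form a Cauchy sequence, to which sequential completeness applies. *)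
Lemma hilb_complete (F : set_system hilb) : ProperFilter F -> cauchy F -> cvg F.
Proof.
move=> FF /cauchyP Fc.
have e0 n : (0 : R[i]) < n.+1%:R^-1 by rewrite invr_gt0.
have eC n : (n.+1%:R^-1 : R[i]) = (n.+1%:R^-1 : R)%:C.
  by rewrite fmorphV rmorph_nat.
pose x n := projT1 (cid (Fc _ (e0 n))).
have Fx n : F (ball (x n) n.+1%:R^-1) by rewrite /x; case: cid.
have xB m n : `|x m - x n| <= m.+1%:R^-1 + n.+1%:R^-1.
  near F => z.
  have : ball (x m) m.+1%:R^-1 z by near: z; exact: Fx.
  have : ball (x n) n.+1%:R^-1 z by near: z; exact: Fx.
  rewrite -!ball_normE /= => hn hm.
  rewrite -(subrK z (x m)) -addrA.
  by rewrite (le_trans (ler_normD _ _))// (distrC z) lerD// ltW.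
have [l lP] : exists l, forall e : R, 0 < e -> exists N, forall n, (N <= n)%N ->
    nsq (rep (x n) - l) <= e.
  apply: pip_complete => e e_gt0.
  have se_gt0 : 0 < Num.sqrt e / 2 by rewrite divr_gt0 ?sqrtr_gt0.
  have [N _ hN] := near_infty_natSinv_lt (PosNum se_gt0).
  exists N => m n Nm Nn.
  have := xB m n; rewrite -(repK (x m)) -(repK (x n)) hilb_normBE !repK.
  rewrite !eC -rmorphD lecR => h.
  rewrite -[leLHS]/(nsq _) -ler_sqrt ?(ltW e_gt0)//; apply: le_trans h _.
  by rewrite [leRHS]splitr lerD// ltW//; exact: hN.
apply/cvg_ex; exists (cls l).
apply/cvgrPdist_lt => _ /gt0_complexE[e e_gt0 ->].
have se_gt0 : 0 < (e / 2) ^+ 2 by rewrite exprn_gt0// divr_gt0.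
have [N1 hN1] := lP _ se_gt0.
have e2_gt0 : 0 < e / 2 by rewrite divr_gt0.
have [N2 _ hN2] := near_infty_natSinv_lt (PosNum e2_gt0).
pose N := maxn N1 N2.
have h1 : `|cls l - x N| <= (e / 2)%:C.
  rewrite distrC -(repK (x N)) hilb_normBE lecR.
  by rewrite -[leRHS](ger0_norm (ltW e2_gt0)) -sqrtr_sqr ler_wsqrtr// hN1// leq_maxl.
near=> z.
rewrite -(subrK (x N) (cls l)) -addrA (le_lt_trans (ler_normD _ _))//.
rewrite [e]splitr rmorphD ler_ltD//.
have : ball (x N) N.+1%:R^-1 z by near: z; exact: Fx.
rewrite -ball_normE /= => /lt_trans; apply.
by rewrite eC ltcR; apply: hN2; rewrite /= leq_maxr.
Unshelve. all: by end_near. Qed.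

HB.instance Definition _ := Uniform_isComplete.Build hilb hilb_complete.

Lemma hilb_sep : exists2 D : set hilb, countable D & dense D.
Proof.
have [D cD hD] := @pip_separable _ p.
exists (cls @` D); first exact: sub_countable (card_image_le _ _) cD.
move=> O [F OF] Oo; have /nbhs_ballP[e /= e0 eO] : nbhs F O.
  exact: open_nbhs_nbhs.
have [r r_gt0 er] := gt0_complexE e0.
have [d Dd ed] := hD (rep F) _ (exprn_gt0 2 r_gt0).
exists (cls d); split; last by exists d.
apply: eO; rewrite -ball_normE /= -(repK F) hilb_normBE er ltcR.
by rewrite -[ltRHS](ger0_norm (ltW r_gt0)) -sqrtr_sqr ltr_sqrt ?exprn_gt0.
Qed.

Definition hilbert_of : hilbertType R :=
  @HilbertType R hilb hip hilb_sqr_norm hilb_sep.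

End PreHilbertTheory.

(** * Bounded operators, commutants and closed subspaces *)

Section HilbertOperators.
Context {R : realType}.
Implicit Types H K : hilbertType R.

Lemma inner_CS H (x y : H) : `|inner H x y| <= `|x| * `|y|.
Proof.
rewrite -(@ler_pXn2r _ 2)// ?nnegrE ?mulr_ge0// exprMn !sqr_norm_inner.
apply: semi_inner_CS => [a b c|c a b|a b|a].
- exact: linearDl.
- exact: linearZl_LR.
- by rewrite hermC mul1r.
- exact: dnorm_ge0.
Qed.

Lemma inner_eq0 H (x : H) : inner H x x = 0 -> x = 0.
Proof. by move/eqP; rewrite dnorm_eq0 => /eqP. Qed.

Lemma inner_inj H (x y : H) : (forall z, inner H z x = inner H z y) -> x = y.
Proof.
move=> h; apply/eqP; rewrite -subr_eq0; apply/eqP/inner_eq0.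
by rewrite linearBr /= h subrr.
Qed.

Lemma bounded_operatorP H K (T : H -> K) : bounded_operator T <->
  linear T /\ exists2 M : R, 0 <= M & forall x, `|T x| <= M%:C * `|x|.
Proof.
split=> [[lT cT]|[lT [M _ TM]]]; split => //.
- pose L : {linear H -> K} := HB.pack T (GRing.isLinear.Build _ _ _ _ T lT).
  have /linear_boundedP : bounded_near L (nbhs 0).
    by apply/linear_bounded_continuous.
  move=> /pinfty_ex_gt0[r r0 h]; have [s s0 rs] := gt0_complexE r0.
  by exists s => [|x]; [exact: ltW|rewrite -rs; exact: h].
- pose L : {linear H -> K} := HB.pack T (GRing.isLinear.Build _ _ _ _ T lT).
  apply: (@bounded_linear_continuous _ _ _ L); apply/linear_boundedP.
  near=> r => x; apply: le_trans (TM x) _; apply: ler_wpM2r => //.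
  near: r; apply: nbhs_pinfty_ge; apply/complex_realP; by exists M.
Unshelve. all: by end_near. Qed.

Lemma bounded_op0 H K (T : H -> K) : bounded_operator T -> T 0 = 0.
Proof.
by move=> [lT _]; have := lT (- 1) 0 0; rewrite scaler0 addr0 scaleN1r addNr.
Qed.

Lemma bounded_opD H K (T : H -> K) x y : bounded_operator T -> T (x + y) = T x + T y.
Proof. by move=> [lT _]; have := lT 1 x y; rewrite !scale1r. Qed.

Lemma bounded_opZ H K (T : H -> K) c x : bounded_operator T -> T (c *: x) = c *: T x.
Proof. by move=> bT; have := bT.1 c x 0; rewrite !addr0 (bounded_op0 bT) addr0. Qed.

Lemma bounded_opB H K (T : H -> K) x y : bounded_operator T -> T (x - y) = T x - T y.
Proof. by move=> bT; rewrite bounded_opD// -scaleN1r bounded_opZ// scaleN1r. Qed.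

Lemma bounded_op_comp H K (L : hilbertType R) (S : K -> L) (T : H -> K) :
  bounded_operator S -> bounded_operator T -> bounded_operator (S \o T).
Proof.
move=> [lS cS] [lT cT]; split; first by move=> c x y /=; rewrite lT lS.
by move=> x; apply: continuous_comp; [exact: cT|exact: cS].
Qed.

(** Non-degeneracy of the inner product gives linearity, and
    [|T' y|^2 = <T (T' y), y> <= M |T' y| |y|] gives the bound. *)
Lemma adjoint_bounded H K (T : H -> K) (T' : K -> H) :
  bounded_operator T -> adjoint_operator T T' -> bounded_operator T'.
Proof.
move=> /bounded_operatorP[lT [M M0 TM]] TT'; apply/bounded_operatorP; split.
  move=> c x y; apply: inner_inj => z.
  by rewrite -TT' !linearDr !linearZr_LR /= -!TT'.
exists M => // y; have [->|y0] := eqVneq (T' y) 0.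
  by rewrite normr0 mulr_ge0// ler0c.
rewrite -(@ler_pM2r _ `|T' y|) ?normr_gt0// -expr2 sqr_norm_inner -TT'.
have ip : inner K (T (T' y)) y = `|inner K (T (T' y)) y|.
  by rewrite TT' ger0_norm.
by rewrite ip (le_trans (inner_CS _ _))// mulrAC ler_wpM2r.
Qed.

Definition all_bounded H : set (H -> H) := [set T | bounded_operator T].

(** The generated algebra is an intersection of von Neumann algebras; having this one among them
    shows that its elements are bounded. *)
Lemma vN_all_bounded H : von_neumann_algebra (@all_bounded H).
Proof.
split => //.
- by split => //; move=> x; exact: cvg_id.
- move=> S T [lS cS] [lT cT]; split.
    by move=> c x y /=; rewrite lS lT scalerDr addrACA.
  by move=> x; apply: cvgD; [exact: cS|exact: cT].
- move=> c S [lS cS]; split.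
    by move=> d x y /=; rewrite lS scalerDr !scalerA mulrC.
  by move=> x; apply: cvgZr; exact: cS.
- by move=> S T bS bT; exact: bounded_op_comp.
- by move=> S S' bS SS'; exact: adjoint_bounded SS'.
Qed.

Lemma generated_bounded H (G : set (H -> H)) : G `<=` @all_bounded H ->
  von_neumann_generated G `<=` @all_bounded H.
Proof. by move=> GB T /(_ _ (conj (vN_all_bounded H) GB)). Qed.

(** The generators and their adjoints belong to every algebra of the intersection; commuting with
    them is all that irreducibility will draw from the commutant. *)
Lemma commutant_generated H (G : set (H -> H)) T : commutant (von_neumann_generated G) T ->
  (forall S, G S -> T \o S = S \o T) /\
  (forall S S', G S -> adjoint_operator S S' -> T \o S' = S' \o T).
Proof.
move=> [_ h]; split=> [S GS|S S' GS SS']; apply: h => M [vM GM].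
  exact: GM.
by apply: (vN_adjoint vM) SS'; exact: GM.
Qed.

Lemma scalar_commutant H (G : set (H -> H)) : G `<=` @all_bounded H ->
  scalar_operators H `<=` commutant (von_neumann_generated G).
Proof.
move=> GB _ [c ->]; split.
  apply: (vN_scale (vN_all_bounded H)); exact: vN_one (vN_all_bounded H).
move=> S /(generated_bounded GB) bS; apply/funext => x /=.
by rewrite bounded_opZ.
Qed.

(** Closedness is phrased by approximation, so that a property of vectors can be carried directly
    from a total set to the whole space. *)
Definition closed_subspace H (P : H -> Prop) : Prop :=
  [/\ forall x y, P x -> P y -> P (x + y),
      forall c x, P x -> P (c *: x) &
      forall x, (forall e : R, 0 < e -> exists2 y, P y & `|x - y| < e%:C) -> P x].

Lemma approx0 H (x : H) : (forall e : R, 0 < e -> `|x| <= e%:C) -> x = 0.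
Proof.
move=> h; apply/eqP; rewrite -normr_eq0; have := normr_ge0 x.
rewrite le_eqVlt => /orP[/eqP<-//|x0].
have [r r0 rx] := gt0_complexE x0.
have /h : 0 < r / 2 by rewrite divr_gt0.
by rewrite rx lecR; lra.
Qed.

Lemma closed_subspace_eq H K (S T : H -> K) : bounded_operator S -> bounded_operator T ->
  closed_subspace (fun x => S x = T x).
Proof.
move=> bS bT; split=> [x y xE yE|c x xE|x h].
- by rewrite !bounded_opD// xE yE.
- by rewrite !bounded_opZ// xE.
have [_ [M M0 SM]] := (bounded_operatorP _).1 bS.
have [_ [N N0 TN]] := (bounded_operatorP _).1 bT.
apply/eqP; rewrite -subr_eq0; apply/eqP/approx0 => e e0.
have d0 : 0 < e / (M + N + 1) by rewrite divr_gt0// ltr_wpDl// addr_ge0.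
have [y yE xy] := h _ d0.
rewrite -(subrK (S y) (S x)) -addrA {2}yE -!bounded_opB//.
apply: le_trans (ler_normD _ _) _.
apply: le_trans (lerD (SM _) (TN _)) _.
rewrite (distrC y) -mulrDl -rmorphD.
apply: le_trans (_ : (M + N + 1)%:C * (e / (M + N + 1))%:C <= _).
  by rewrite ler_pM ?ler0c ?addr_ge0//; [rewrite lecR lerDl|exact: ltW].
by rewrite -rmorphM /= mulrC divfK// gt_eqF// ltr_wpDl// addr_ge0.
Qed.

Lemma closed_subspace_orth H (y : H) : closed_subspace (fun x => inner H y x = 0).
Proof.
split=> [x z xE zE|c x xE|x h].
- by rewrite linearDr /= xE zE addr0.
- by rewrite linearZr_LR /= xE mulr0.
apply/eqP; rewrite -normr_eq0; apply/negPn/negP => n0.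
have : 0 < `|inner H y x| by rewrite lt_def n0 normr_ge0.
have [->|y0] := eqVneq y 0; first by rewrite linear0l normr0 ltxx.
have {}y0 : 0 < `|y| by rewrite normr_gt0.
have [a a0 aE] := gt0_complexE y0.
move=> /gt0_complexE[r r0 rE].
have [z zE xz] := h (r / a) (divr_gt0 r0 a0).
have := inner_CS y (x - z); rewrite linearBr /= zE subr0 rE aE => hh.
have : r%:C < a%:C * (r / a)%:C by apply: le_lt_trans hh _; rewrite ltr_pM2l// -aE.
by rewrite -rmorphM /= mulrC divfK ?gt_eqF// ltxx.
Qed.

(** The usual three-term estimate: for contractions, strong continuity passes to limits of
    vectors. *)
Lemma closed_subspace_cvg H (D : set (R * R)) (T : R * R -> H -> H) :
  (forall a, D a -> bounded_operator (T a)) ->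
  (forall a, D a -> forall x, `|T a x| <= `|x|) ->
  closed_subspace (fun x => {within D, continuous (fun a => T a x)}).
Proof.
move=> bT T1; split=> [x y xE yE|c x xE|x h].
- apply/subspace_continuousP => a Da.
  have /subspace_continuousP/(_ a Da) hx := xE.
  have /subspace_continuousP/(_ a Da) hy := yE.
  rewrite /from_subspace /= bounded_opD; last exact: bT.
  apply: cvg_trans (cvgD hx hy); apply: near_eq_cvg.
  near=> b; rewrite bounded_opD//; apply: bT.
  by near: b; exact: withinT.
- apply/subspace_continuousP => a Da.
  have /subspace_continuousP/(_ a Da) hx := xE.
  rewrite /from_subspace /= bounded_opZ; last exact: bT.
  apply: cvg_trans (cvgZl_tmp (k := c) hx); apply: near_eq_cvg.
  near=> b; rewrite bounded_opZ//; apply: bT.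
  by near: b; exact: withinT.
apply/subspace_continuousP => a Da.
apply/cvgrPdist_lt => _ /gt0_complexE[e e0 ->].
have [y yE xy] := h (e / 3) (divr_gt0 e0 (ltr0Sn _ 2)).
have /subspace_continuousP/(_ a Da)/cvgrPdist_lt hy := yE.
have e3 : 0 < (e / 3)%:C by rewrite ltcR divr_gt0.
near=> b.
have Db : D b by near: b; exact: withinT.
have ab : `|T a y - T b y| < (e / 3)%:C by near: b; exact: hy.
have -> : T a x - T b x = T a (x - y) + (T a y - T b y) - T b (x - y).
  rewrite !(bounded_opB _ _ (bT _ Da)) !(bounded_opB _ _ (bT _ Db)).
  by rewrite addrA subrK opprB addrA subrK.
apply: le_lt_trans (ler_normB _ _) _.
apply: le_lt_trans (lerD (ler_normD _ _) (T1 _ Db _)) _.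
apply: le_lt_trans (lerD (lerD (T1 _ Da _) (lexx _)) (lexx _)) _.
have -> : e%:C = (e / 3)%:C + (e / 3)%:C + (e / 3)%:C.
  by rewrite -!rmorphD /=; congr (_%:C); field.
by rewrite ltrD// ltrD.
Unshelve. all: by end_near. Qed.

End HilbertOperators.

(** * Lifting operators to the Hausdorff quotient *)

Section Lift.
Context {R : realType}.
Implicit Types p q : preHilbert R.

Definition bounded_with p q (C : R) (T : p -> q) : Prop :=
  [/\ linear T, 0 <= C & forall e, nsq (T e) <= C * nsq e].

Definition lift p q (T : p -> q) : hilbert_of p -> hilbert_of q :=
  fun F => cls (T (rep F)).

Lemma innerE p (e f : p) : inner (hilbert_of p) (cls e) (cls f) = pip e f.
Proof. exact: hip_cls. Qed.

Lemma nsq_eq0 p (e : p) : nsq e = 0 -> cls e = 0.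
Proof.
move=> e0; apply: (@inner_eq0 _ (hilbert_of p)).
by rewrite innerE pip_nsq e0.
Qed.

Lemma cls_ind p (P : hilbert_of p -> Prop) : (forall e, P (cls e)) -> forall F, P F.
Proof. exact: clsP. Qed.

Lemma hilbert_norm_cls p (e : p) : `|cls e : hilbert_of p| = (Num.sqrt (nsq e))%:C.
Proof. exact: hilb_norm_cls. Qed.

(** The representative chosen for [cls e] differs from [e] by a null vector, and a bounded operator
    sends null vectors to null vectors. *)
Lemma lift_cls p q C (T : p -> q) e : bounded_with C T -> lift T (cls e) = cls (T e).
Proof.
move=> [lT C0 TC]; rewrite /lift.
apply/eqP; rewrite -subr_eq0 -raddfB; apply/eqP/nsq_eq0.
have TB a b : T (a - b) = T a - T b.
  by have := lT (- 1) b a; rewrite !scaleN1r ![- _ + _]addrC.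
rewrite -TB; apply/eqP; rewrite eq_le nsq_ge0 andbT.
apply: le_trans (TC _) _.
suff -> : nsq (rep (cls e) - e) = 0 by rewrite mulr0.
apply/complexI; rewrite -pip_nsq -[pip _ _]innerE raddfB.
by rewrite [X in inner _ X](_ : _ = 0) ?linear0l//; apply/eqP; rewrite subr_eq0; apply/eqP/repK.
Qed.

Lemma lift_norm p q C (T : p -> q) F : bounded_with C T ->
  `|lift T F| <= (Num.sqrt C)%:C * `|F|.
Proof.
move=> bT; elim/cls_ind: F => e; rewrite (lift_cls _ bT) !hilbert_norm_cls.
have [_ C0 TC] := bT.
by rewrite -rmorphM /= lecR -sqrtrM// ler_wsqrtr.
Qed.

Lemma lift_bounded p q C (T : p -> q) : bounded_with C T -> bounded_operator (lift T).
Proof.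
move=> bT; apply/bounded_operatorP; split.
  move=> c; elim/cls_ind => e; elim/cls_ind => f.
  rewrite -linearZ -raddfD !(lift_cls _ bT).
  by have [-> _ _] := bT; rewrite linearP.
by exists (Num.sqrt C) => [|x]; [exact: sqrtr_ge0|exact: lift_norm].
Qed.

(* Cauchy-Schwarz for <T (S f), f> = |S f|^2, so no explicit bound on S is needed *)
Lemma isometry_adjoint_bounded p (T S : p -> p) :
  (forall e, nsq (T e) = nsq e) -> linear S ->
  (forall e f, pip (T e) f = pip e (S f)) -> bounded_with 1 S.
Proof.
move=> isoT lS TS; split => // f; rewrite mul1r.
have [->|s0] := eqVneq (nsq (S f)) 0; first exact: nsq_ge0.
have {}s0 : 0 < nsq (S f) by rewrite lt_def s0 nsq_ge0.
have := pip_CS (T (S f)) f; rewrite TS !pip_nsq isoT.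
rewrite ger0_norm ?ler0c ?nsq_ge0// -!rmorphM -rmorphXn /= lecR expr2.
by rewrite ler_pM2l.
Qed.

End Lift.

(** * Complex-valued integration *)

Section ComplexParts.
Context {R : realType}.
Implicit Types z w : R[i].

Definition absq z : R := Re z ^+ 2 + Im z ^+ 2.

Lemma ReD z w : Re (z + w) = Re z + Re w. Proof. by case: z w => ? ? []. Qed.
Lemma ImD z w : Im (z + w) = Im z + Im w. Proof. by case: z w => ? ? []. Qed.
Lemma ReN z : Re (- z) = - Re z. Proof. by case: z. Qed.
Lemma ImN z : Im (- z) = - Im z. Proof. by case: z. Qed.
Lemma ReM z w : Re (z * w) = Re z * Re w - Im z * Im w.
Proof. by case: z w => ? ? []. Qed.
Lemma ImM z w : Im (z * w) = Re z * Im w + Im z * Re w.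
Proof. by case: z w => ? ? []. Qed.
Lemma Reconj z : Re (Num.conj z) = Re z. Proof. by case: z. Qed.
Lemma Imconj z : Im (Num.conj z) = - Im z. Proof. by case: z. Qed.
Lemma Re_real (r : R) : Re r%:C = r. Proof. by []. Qed.
Lemma Im_real (r : R) : Im r%:C = 0. Proof. by []. Qed.
Definition ReImE := (ReD, ImD, ReN, ImN, ReM, ImM, Reconj, Imconj, Re_real, Im_real).

Lemma complex_ext z w : Re z = Re w -> Im z = Im w -> z = w.
Proof. by case: z w => a b [c d] /= -> ->. Qed.

Lemma absq_ge0 z : 0 <= absq z. Proof. by rewrite addr_ge0 ?sqr_ge0. Qed.

Lemma absq0 : absq 0 = 0. Proof. by rewrite /absq /= expr0n addr0. Qed.

Lemma absq_eq0 z : absq z = 0 -> z = 0.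
Proof.
move=> /eqP; rewrite paddr_eq0 ?sqr_ge0// !sqrf_eq0 => /andP[/eqP a /eqP b].
exact: complex_ext.
Qed.

Lemma absqM z w : absq (z * w) = absq z * absq w.
Proof. by rewrite /absq !ReImE; ring. Qed.

Lemma absqN z : absq (- z) = absq z.
Proof. by rewrite /absq !ReImE !sqrrN. Qed.

Lemma absq_conj z : absq (Num.conj z) = absq z.
Proof. by rewrite /absq !ReImE sqrrN. Qed.

Lemma absqB z w : absq (z - w) = absq (w - z).
Proof. by rewrite -opprB absqN. Qed.

Lemma absqD_le z w : absq (z + w) <= 2 * absq z + 2 * absq w.
Proof.
rewrite /absq !ReImE.
have := sqr_ge0 (Re z - Re w); have := sqr_ge0 (Im z - Im w); nra.
Qed.

Lemma absq_real (r : R) : absq r%:C = r ^+ 2.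
Proof. by rewrite /absq /= expr0n addr0. Qed.

Lemma mulconjE z : z * Num.conj z = (absq z)%:C.
Proof. by apply: complex_ext; rewrite !ReImE /absq; ring. Qed.

End ComplexParts.

Section ComplexMeasurable.
Context {R : realType} d {T : measurableType d}.
Implicit Types f g : T -> R[i].

Definition cmeasurable f : Prop :=
  measurable_fun setT (fun x => Re (f x)) /\ measurable_fun setT (fun x => Im (f x)).

Lemma cmeasurable_cst z : cmeasurable (fun=> z).
Proof. by split; exact: measurable_cst. Qed.

Lemma cmeasurableD f g : cmeasurable f -> cmeasurable g -> cmeasurable (fun x => f x + g x).
Proof.
move=> [fr fi] [gr gi]; split.
  by under eq_fun do rewrite ReD; exact: measurable_funD.
by under eq_fun do rewrite ImD; exact: measurable_funD.
Qed.

Lemma cmeasurableM f g : cmeasurable f -> cmeasurable g -> cmeasurable (fun x => f x * g x).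
Proof.
move=> [fr fi] [gr gi]; split.
  by under eq_fun do rewrite ReM; apply: measurable_funB; exact: measurable_funM.
by under eq_fun do rewrite ImM; apply: measurable_funD; exact: measurable_funM.
Qed.

Lemma cmeasurable_conj f : cmeasurable f -> cmeasurable (fun x => Num.conj (f x)).
Proof.
move=> [fr fi]; split; first by under eq_fun do rewrite Reconj.
by under eq_fun do rewrite Imconj; exact: measurable_funN.
Qed.

Lemma cmeasurable_real (h : T -> R) : measurable_fun setT h -> cmeasurable (fun x => (h x)%:C).
Proof. by move=> mh; split => //=; exact: measurable_cst. Qed.

Lemma cmeasurableB f g : cmeasurable f -> cmeasurable g -> cmeasurable (fun x => f x - g x).
Proof.
move=> mf mg; apply: cmeasurableD => //.
under eq_fun do rewrite -mulN1r; apply: cmeasurableM => //; exact: cmeasurable_cst.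
Qed.

Lemma measurable_absq f : cmeasurable f -> measurable_fun setT (fun x => absq (f x)).
Proof. by move=> [fr fi]; apply: measurable_funD; exact: measurable_funX. Qed.

Lemma cmeasurable_indic (A : set T) : measurable A ->
  cmeasurable (fun x => (\1_A x : R)%:C).
Proof. by move=> mA; apply: cmeasurable_real; exact: measurable_indic. Qed.

End ComplexMeasurable.

Lemma cmeasurable_comp (R : realType) d d' (S : measurableType d') (T : measurableType d)
    (h : S -> T) (f : T -> R[i]) :
  measurable_fun setT h -> cmeasurable f -> cmeasurable (f \o h).
Proof. by move=> mh [fr fi]; split; [exact: (measurableT_comp fr)|exact: (measurableT_comp fi)]. Qed.

Section ComplexIntegral.
Context {R : realType} d {T : measurableType d} (mu : {measure set T -> \bar R}).
Implicit Types f g : T -> R[i].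

Definition cintegrable f : Prop :=
  mu.-integrable setT (fun x => (Re (f x))%:E) /\
  mu.-integrable setT (fun x => (Im (f x))%:E).

Definition cint f : R[i] :=
  (\int[mu]_(x in setT) Re (f x)) +i* (\int[mu]_(x in setT) Im (f x)).

Lemma cint_Re f : Re (cint f) = \int[mu]_(x in setT) Re (f x). Proof. by []. Qed.
Lemma cint_Im f : Im (cint f) = \int[mu]_(x in setT) Im (f x). Proof. by []. Qed.

Lemma cintegrable_measurable f : cintegrable f -> cmeasurable f.
Proof. by move=> [/measurable_int/measurable_EFinP ? /measurable_int/measurable_EFinP]. Qed.

Lemma integrableDr (u v : T -> R) : mu.-integrable setT (fun x => (u x)%:E) ->
  mu.-integrable setT (fun x => (v x)%:E) ->
  mu.-integrable setT (fun x => (u x + v x)%:E).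
Proof. by move=> iu iv; under eq_fun do rewrite EFinD; exact: integrableD. Qed.

Lemma integrableZr (k : R) (u : T -> R) : mu.-integrable setT (fun x => (u x)%:E) ->
  mu.-integrable setT (fun x => (k * u x)%:E).
Proof. by move=> iu; under eq_fun do rewrite EFinM; exact: integrableZl. Qed.

Lemma integrableBr (u v : T -> R) : mu.-integrable setT (fun x => (u x)%:E) ->
  mu.-integrable setT (fun x => (v x)%:E) ->
  mu.-integrable setT (fun x => (u x - v x)%:E).
Proof.
move=> iu iv; apply: integrableDr => //.
by under eq_fun do rewrite -mulN1r; exact: integrableZr.
Qed.

Lemma le_integrabler (u v : T -> R) : measurable_fun setT u ->
  (forall x, `|u x| <= v x) ->
  mu.-integrable setT (fun x => (v x)%:E) -> mu.-integrable setT (fun x => (u x)%:E).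
Proof.
move=> mu_ uv; apply: le_integrable => //; first exact/measurable_EFinP.
by move=> x _; rewrite !abse_EFin lee_fin (le_trans (uv x))// ler_norm.
Qed.

Lemma cintegrableD f g : cintegrable f -> cintegrable g -> cintegrable (fun x => f x + g x).
Proof.
move=> [fr fi] [gr gi]; split.
  by under eq_fun do rewrite ReD; exact: integrableDr.
by under eq_fun do rewrite ImD; exact: integrableDr.
Qed.

Lemma cintegrableZ c f : cintegrable f -> cintegrable (fun x => c * f x).
Proof.
move=> [fr fi]; split.
  by under eq_fun do rewrite ReM; apply: integrableBr; exact: integrableZr.
by under eq_fun do rewrite ImM; apply: integrableDr; exact: integrableZr.
Qed.

Lemma cintD f g : cintegrable f -> cintegrable g ->
  cint (fun x => f x + g x) = cint f + cint g.
Proof.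
move=> [fr fi] [gr gi]; apply: complex_ext; rewrite ?ReD ?ImD !(cint_Re, cint_Im).
  by under eq_Rintegral do rewrite ReD; rewrite RintegralD.
by under eq_Rintegral do rewrite ImD; rewrite RintegralD.
Qed.

Lemma cintZ c f : cintegrable f -> cint (fun x => c * f x) = c * cint f.
Proof.
move=> [fr fi]; apply: complex_ext; rewrite ?ReM ?ImM !(cint_Re, cint_Im).
  under eq_Rintegral do rewrite ReM; rewrite RintegralB//; try exact: integrableZr.
  by rewrite !RintegralZl.
under eq_Rintegral do rewrite ImM; rewrite RintegralD//; try exact: integrableZr.
by rewrite !RintegralZl.
Qed.

Lemma cint_conj f : cintegrable f -> cint (fun x => Num.conj (f x)) = Num.conj (cint f).
Proof.
move=> [fr fi]; apply: complex_ext; rewrite ?Reconj ?Imconj !(cint_Re, cint_Im).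
  by under eq_Rintegral do rewrite Reconj.
under eq_Rintegral do rewrite Imconj -mulN1r.
by rewrite RintegralZl// mulN1r.
Qed.

Lemma eq_cint f g : f =1 g -> cint f = cint g.
Proof. by move=> /funext ->. Qed.

Lemma cint_real (h : T -> R) : cint (fun x => (h x)%:C) = (\int[mu]_(x in setT) h x)%:C.
Proof.
by apply: complex_ext; rewrite !(cint_Re, cint_Im)//= Rintegral_cst// mul0r.
Qed.

Definition L2 f : Prop :=
  cmeasurable f /\ mu.-integrable setT (fun x => (absq (f x))%:E).

Definition norm2 f : R := \int[mu]_(x in setT) absq (f x).

Lemma norm2_ge0 f : 0 <= norm2 f.
Proof. by apply: Rintegral_ge0 => x _; exact: absq_ge0. Qed.

Lemma L2_bound f (h : T -> R) : cmeasurable f -> (forall x, absq (f x) <= h x) ->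
  mu.-integrable setT (fun x => (h x)%:E) -> L2 f.
Proof.
move=> mf fh ih; split => //; apply: le_integrabler ih.
  exact: measurable_absq.
by move=> x; rewrite ger0_norm ?absq_ge0.
Qed.

Lemma L2D f g : L2 f -> L2 g -> L2 (fun x => f x + g x).
Proof.
move=> [mf fi] [mg gi]; apply: (@L2_bound _ (fun x => 2 * absq (f x) + 2 * absq (g x))).
- exact: cmeasurableD.
- by move=> x; exact: absqD_le.
- by apply: integrableDr; exact: integrableZr.
Qed.

Lemma L2Mb (m : T -> R[i]) C f : cmeasurable m -> (forall x, absq (m x) <= C) ->
  L2 f -> L2 (fun x => m x * f x).
Proof.
move=> mm mC [mf fi]; apply: (@L2_bound _ (fun x => C * absq (f x))).
- exact: cmeasurableM.
- by move=> x; rewrite absqM ler_wpM2r ?absq_ge0.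
- exact: integrableZr.
Qed.

Lemma L2Z c f : L2 f -> L2 (fun x => c * f x).
Proof. by apply: L2Mb; [exact: cmeasurable_cst|move=> x; exact: lexx]. Qed.

Lemma L2B f g : L2 f -> L2 g -> L2 (fun x => f x - g x).
Proof.
by move=> lf lg; apply: L2D => //; under eq_fun do rewrite -mulN1r; exact: L2Z.
Qed.

Lemma L2_0 : L2 (fun=> 0).
Proof.
split; first exact: cmeasurable_cst.
by under eq_fun do rewrite absq0; exact: integrable0.
Qed.

(** Expanding squares of sums and differences of real and imaginary parts bounds both parts of the
    product by [|f|^2 + |g|^2]. *)
Lemma L2_prod f g : L2 f -> L2 g -> cintegrable (fun x => f x * Num.conj (g x)).
Proof.
move=> [mf fi] [mg gi]; have [mr mi] := cmeasurableM mf (cmeasurable_conj mg).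
have ii := integrableDr fi gi.
split; (apply: le_integrabler ii => // x; rewrite !ReImE /absq ler_norml).
  apply/andP; split.
    have := sqr_ge0 (Re (f x) + Re (g x)); have := sqr_ge0 (Im (f x) + Im (g x)); nra.
  have := sqr_ge0 (Re (f x) - Re (g x)); have := sqr_ge0 (Im (f x) - Im (g x)); nra.
apply/andP; split.
  have := sqr_ge0 (Re (f x) - Im (g x)); have := sqr_ge0 (Im (f x) + Re (g x)); nra.
have := sqr_ge0 (Re (f x) + Im (g x)); have := sqr_ge0 (Im (f x) - Re (g x)); nra.
Qed.

Lemma L2_indic (A : set T) : measurable A -> (mu A < +oo)%E ->
  L2 (fun x => (\1_A x : R)%:C).
Proof.
move=> mA Afin; split; first exact: cmeasurable_indic.
rewrite (_ : (fun x => _) = EFin \o (\1_A : T -> R)).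
  apply/integrableP; split; first exact/measurable_EFinP/measurable_indic.
  rewrite (eq_integral (fun x => (\1_A x)%:E)); last first.
    by move=> t _; rewrite gee0_abs// lee_fin.
  by rewrite integral_indic// setIT.
apply/funext => x; rewrite absq_real /= indicE.
by case: (x \in A); rewrite ?expr1n ?expr0n.
Qed.

Lemma norm2_dominated (g : nat -> T -> R[i]) f (h : T -> R) :
  (forall n, L2 (g n)) -> L2 f ->
  (forall x, (fun n => absq (g n x - f x)) @ \oo --> 0) ->
  (forall n x, absq (g n x - f x) <= h x) ->
  mu.-integrable setT (fun x => (h x)%:E) ->
  (fun n => norm2 (fun x => g n x - f x)) @ \oo --> 0.
Proof.
move=> lg lf gf gh ih.
have ml n : measurable_fun setT (fun x => absq (g n x - f x)).
  by apply: measurable_absq; apply: cmeasurableB; [case: (lg n)|case: lf].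
have [||||| _ _ /= h1] := @dominated_convergence _ _ _ mu setT measurableT
  (fun n x => (absq (g n x - f x))%:E) (fun=> 0%E) (fun x => (h x)%:E).
- by move=> n; apply/measurable_EFinP.
- exact: measurable_cst.
- by apply: aeW => x _; apply/fine_cvgP; split; [exact: nearW|exact: gf].
- exact: ih.
- by apply: aeW => x n _ /=; rewrite lee_fin ger0_norm ?absq_ge0.
rewrite integral0 in h1.
exact: (fine_cvg h1).
Qed.

End ComplexIntegral.

(** The summable part [a] will be a weighted squared increment: this is how L^2 estimates yield
    pointwise convergence. *)
Lemma cvg_summable_increments (R : realType) (w a : nat -> R) (M : R) :
  (forall k, 0 <= a k) -> (forall n, series a n <= M) ->
  (forall k, `|w k.+1 - w k| <= 2^-1 ^+ k + a k) -> cvgn w.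
Proof.
move=> a0 aM wa.
have ca : cvgn (series a).
  apply: nondecreasing_is_cvgn.
    by apply/nondecreasing_series => k _.
  by exists M => _ [n _ <-].
have cg : cvgn (series (geometric 1 (2^-1 : R))).
  by apply: is_cvg_geometric_series; rewrite ger0_norm// invf_lt1// ltr1n.
have cw : cvgn (series (telescope w)).
  apply: normed_cvg.
  apply: (@series_le_cvg _ _ (fun k => geometric 1 2^-1 k + a k)).
  - by move=> k; exact: normr_ge0.
  - by move=> k; rewrite addr_ge0//= mul1r exprn_ge0.
  - by move=> k; rewrite /= mul1r; exact: wa.
  have -> : series (fun k => geometric 1 2^-1 k + a k) =
      series (geometric 1 (2^-1)) \+ series a :> (nat -> R).
    by apply/funext => n; rewrite /series /= big_split.
  exact: is_cvgD.
have -> : w = (fun n => w 0%N + series (telescope w) n).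
  by apply/funext => n; exact: eq_sum_telescope.
by apply: is_cvgD => //; exact: is_cvg_cst.
Qed.

Lemma ge0_le_Rintegral_lim d (T : measurableType d) (R : realType)
    (mu : {measure set T -> \bar R}) (g : nat -> T -> R) (f : T -> R) (e : R) :
  (forall n, measurable_fun setT (g n)) -> measurable_fun setT f ->
  (forall n x, 0 <= g n x) ->
  (forall x, (fun n => g n x) @ \oo --> f x) ->
  (exists N, forall n, (N <= n)%N -> (\int[mu]_x (g n x)%:E <= e%:E)%E) ->
  (\int[mu]_x (f x)%:E <= e%:E)%E.
Proof.
move=> mg mf g0 gf [N ge].
(* Fatou's lemma is applied to the sequence shifted by [N], all of whose integrals satisfy the
   bound. *)
have -> : (\int[mu]_x (f x)%:E = \int[mu]_x limn_einf (fun n => (g (n + N)%N x)%:E))%E.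
  apply: eq_integral => x _; apply/esym.
  have h : ((fun n => (g (n + N)%N x)%:E) @ \oo --> (f x)%:E)%E.
    apply/fine_cvgP; split; first exact: nearW.
    by have := gf x; rewrite -(cvg_shiftn N).
  by have [-> _] := cvg_limn_einf_sup h.
apply: le_trans (fatou _ _ _ _) _ => //.
- by move=> n; apply/measurable_EFinP; exact: mg.
- by move=> n x _; rewrite lee_fin.
rewrite limn_einf_lim; apply: lime_le; first exact: is_cvg_einfs.
apply: nearW => n; apply: le_trans (_ : (\int[mu]_x (g (n + N)%N x)%:E <= _)%E).
  by apply: ereal_inf_lbound; exists n => /=.
by apply: ge; exact: leq_addl.
Qed.

(** * Completeness of L^2 *)

Section RieszFischer.
Context {R : realType} d {T : measurableType d} (mu : {measure set T -> \bar R}).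

Lemma norm2E (f : T -> R[i]) : L2 mu f ->
  (\int[mu]_x (absq (f x))%:E = (norm2 mu f)%:E)%E.
Proof.
move=> [mf fi]; rewrite /norm2 /Rintegral fineK//.
exact: integrable_fin_num.
Qed.

(** Along a subsequence the increments have squared norm at most [8^-k]. Their squares weighted by
    [2^k] still sum to an integrable function, and where it is finite the inequality
    [|r| <= 2^-k + 2^k r^2] makes the increments summable. Fatou's lemma then shows that the
    pointwise limit is the L^2 limit. *)
Lemma Riesz_Fischer (u : nat -> T -> R[i]) : (forall n, L2 mu (u n)) ->
  (forall e : R, 0 < e -> exists N, forall m n, (N <= m)%N -> (N <= n)%N ->
    norm2 mu (fun x => u m x - u n x) <= e) ->
  exists2 l, L2 mu l & forall e : R, 0 < e -> exists N, forall n, (N <= n)%N ->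
    norm2 mu (fun x => u n x - l x) <= e.
Proof.
move=> Lu Cu.
have e0 k : (0 : R) < 8^-1 ^+ k by rewrite exprn_gt0.
pose N k := projT1 (cid (Cu _ (e0 k))).
have NP k m n : (N k <= m)%N -> (N k <= n)%N ->
    norm2 mu (fun x => u m x - u n x) <= 8^-1 ^+ k.
  by rewrite /N; case: cid => /= K; apply.
(* The sum dominates every [N i] with [i <= k]; the summand [k] ensures [phi k >= k], for the tail
   estimate at the end. *)
pose phi k := (\sum_(i < k.+1) N i + k)%N.
have Nphi k j : (k <= j)%N -> (N k <= phi j)%N.
  move=> kj; have kj' : (k < j.+1)%N by [].
  by rewrite /phi (bigD1 (Ordinal kj'))//= -addnA leq_addr.
pose v k := u (phi k).
have vB k j : (k <= j)%N -> norm2 mu (fun x => v j x - v k x) <= 8^-1 ^+ k.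
  by move=> kj; apply: NP; exact: Nphi.
pose a k x : R := 2 ^+ k * absq (v k.+1 x - v k x).
have Ld k : L2 mu (fun x => v k.+1 x - v k x) by apply: L2B; exact: Lu.
have ma k : measurable_fun setT (a k).
  by apply: measurable_funM => //; apply: measurable_absq; case: (Ld k).
have a0 k x : 0 <= a k x by rewrite mulr_ge0 ?absq_ge0 ?exprn_ge0.
pose S x := (\sum_(0 <= k <oo) (a k x)%:E)%E.
have mS : measurable_fun setT S.
  apply: (@ge0_emeasurable_sum _ _ _ setT (fun k x => (a k x)%:E) predT) => k.
    by move=> x _ _; rewrite lee_fin.
  by move=> _; exact/measurable_EFinP.
have iS : mu.-integrable setT S.
  apply/integrableP; split => //.
  rewrite (eq_integral S); last first.
    by move=> x _; rewrite gee0_abs// nneseries_ge0// => k _ _; rewrite lee_fin.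
  rewrite integral_nneseries//; first last.
  - by move=> n x _; rewrite lee_fin.
  - by move=> n; exact/measurable_EFinP.
  apply: (@le_lt_trans _ _ (\sum_(0 <= k <oo) (geometric 1 (4^-1) k)%:E)%E).
    apply: lee_nneseries => k _; first by move=> _; apply: integral_ge0 => x _; rewrite lee_fin.
    rewrite /a; under eq_integral do rewrite EFinM.
    rewrite integralZl//; last by case: (Ld k).
    rewrite norm2E// -EFinM lee_fin /= mul1r.
    apply: le_trans (_ : 2 ^+ k * 8^-1 ^+ k <= _).
      by rewrite ler_wpM2l ?exprn_ge0// vB.
    by rewrite -exprMn (_ : 2 * 8^-1 = 4^-1 :> R)//; field.
  have cg : cvgn (series (geometric 1 (4^-1 : R))).
    by apply: is_cvg_geometric_series; rewrite ger0_norm// invf_lt1// ltr1n.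
  have -> : (fun n => \sum_(0 <= k < n) (geometric 1 4^-1 k)%:E)%E =
            EFin \o series (geometric 1 (4^-1 : R)).
    by apply/funext => n; rewrite /= /series /= sumEFin.
  by rewrite EFin_lim// ltry.
pose G := [set x | S x \is a fin_num].
have mG : measurable G.
  rewrite -[G]setTI; exact: (emeasurable_fin_num measurableT mS).
have Gae : {ae mu, forall x, G x}.
  by have := integrable_ae measurableT iS; apply: filterS => x; apply.
have aS x : G x -> forall n, series (a ^~ x) n <= fine (S x).
  move=> Gx n; rewrite -lee_fin fineK// /series /= -sumEFin.
  by apply: nneseries_lim_ge => k _ _; rewrite lee_fin.
have sq_le (r : R) k s : r ^+ 2 <= s -> `|r| <= 2^-1 ^+ k + 2 ^+ k * s.
  move=> rs.
  have p0 : 0 < 2 ^+ k :> R by rewrite exprn_gt0.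
  have -> : 2^-1 ^+ k = (2 ^+ k)^-1 :> R by rewrite exprVn.
  have [r1|r1] := leP (`|r|) (2 ^+ k)^-1.
    by apply: ler_wpDr => //; rewrite mulr_ge0 ?(ltW p0)// (le_trans _ rs)// sqr_ge0.
  apply: ler_wpDl; first by rewrite invr_ge0 ltW.
  apply: le_trans (_ : 2 ^+ k * `|r| ^+ 2 <= _).
    rewrite expr2 mulrA ler_peMl//.
    by rewrite mulrC -ler_pdivrMr// div1r ltW.
  by rewrite ler_pM2l// real_normK ?num_real.
(* The indicator of [G] makes the sequences converge everywhere, to 0 off [G], so that [l] is
   measurable. *)
pose gr k x : R := Re (v k x) * \1_G x.
pose gi k x : R := Im (v k x) * \1_G x.
have cv_part (P : R[i] -> R) x : G x -> (forall z w, P (z - w) = P z - P w) ->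
    (forall z, P z ^+ 2 <= absq z) -> cvgn (fun k => P (v k x)).
  move=> Gx PB Ple; apply: (@cvg_summable_increments _ _ (a ^~ x) (fine (S x))).
  - by move=> k; exact: a0.
  - exact: aS.
  - by move=> k; rewrite -PB /a; apply: sq_le; exact: Ple.
have cvr x : cvgn (gr ^~ x).
  rewrite /gr indicE; case: (boolP (x \in G)) => [/set_mem Gx|_].
    under eq_fun do rewrite mulr1.
    apply: cv_part => // z; last by rewrite lerDl sqr_ge0.
    by move=> w; rewrite ReD ReN.
  by under eq_fun do rewrite mulr0; exact: is_cvg_cst.
have cvi x : cvgn (gi ^~ x).
  rewrite /gi indicE; case: (boolP (x \in G)) => [/set_mem Gx|_].
    under eq_fun do rewrite mulr1.
    apply: cv_part => // z; last by rewrite lerDr sqr_ge0.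
    by move=> w; rewrite ImD ImN.
  by under eq_fun do rewrite mulr0; exact: is_cvg_cst.
pose l x : R[i] := limn (gr ^~ x) +i* limn (gi ^~ x).
have m1G : measurable_fun setT (\1_G : T -> R) by exact: measurable_indic.
have ml : cmeasurable l.
  split; rewrite /l /=.
    apply: (@measurable_fun_cvg _ _ _ setT gr) => [k|x _]; last exact: cvr.
    by apply: measurable_funM => //; case: (Lu (phi k)) => -[].
  apply: (@measurable_fun_cvg _ _ _ setT gi) => [k|x _]; last exact: cvi.
  by apply: measurable_funM => //; case: (Lu (phi k)) => -[].
have lim_le n e : (exists K, forall k, (K <= k)%N ->
      norm2 mu (fun x => v k x - u n x) <= e) ->
    (\int[mu]_x (absq (u n x - l x))%:E <= e%:E)%E.
  move=> [K hK].
  have mun : cmeasurable (u n) by case: (Lu n).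
  have mul : cmeasurable (fun x => u n x - l x) by exact: cmeasurableB.
  have muG : cmeasurable (fun x => u n x * (\1_G x)%:C - l x).
    by apply: cmeasurableB => //; apply: cmeasurableM => //; exact: cmeasurable_real.
  rewrite (@ge0_ae_eq_integral _ _ _ _ _ _ (fun x => (absq (u n x * (\1_G x)%:C - l x))%:E)) //.
  - pose g k x : R := absq (v k x * (\1_G x)%:C - u n x * (\1_G x)%:C).
    apply: (@ge0_le_Rintegral_lim _ _ _ _ g).
    + move=> k; have mvk : cmeasurable (v k) by case: (Lu (phi k)).
      apply: measurable_absq; apply: cmeasurableB; apply: cmeasurableM => //;
        exact: (cmeasurable_real m1G).
    + exact: measurable_absq.
    + by move=> k x; exact: absq_ge0.
    + move=> x.
      have -> : (fun k => g k x) = (fun k => (gr k x - Re (u n x) * \1_G x) ^+ 2 +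
                                          (gi k x - Im (u n x) * \1_G x) ^+ 2).
        by apply/funext => k; rewrite /g /absq !ReImE /gr /gi; ring.
      have -> : absq (u n x * (\1_G x)%:C - l x) =
          (limn (gr ^~ x) - Re (u n x) * \1_G x) ^+ 2 +
          (limn (gi ^~ x) - Im (u n x) * \1_G x) ^+ 2.
        rewrite absqB -[limn (gr ^~ x)]/(Re (l x)) -[limn (gi ^~ x)]/(Im (l x)).
        by move: (l x) => z; rewrite /absq !ReImE; ring.
      have cvgX2 (f : nat -> R) (b : R) : f @ \oo --> b -> (fun k => f k ^+ 2) @ \oo --> b ^+ 2.
        by move=> h; apply: (cvgM h h).
      apply: cvgD; apply: cvgX2.
      * by apply: cvgB; [exact: cvr|exact: cvg_cst].
      * by apply: cvgB; [exact: cvi|exact: cvg_cst].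
    + exists K => k Kk.
      apply: (@le_trans _ _ (\int[mu]_x (absq (v k x - u n x))%:E)%E).
        apply: ge0_le_integral => //.
        * by move=> x _; rewrite lee_fin absq_ge0.
        * apply/measurable_EFinP; apply: measurable_absq; apply: cmeasurableB.
            apply: cmeasurableM; last exact: cmeasurable_real.
            by case: (Lu (phi k)).
          by apply: cmeasurableM => //; exact: cmeasurable_real.
        * apply/measurable_EFinP; apply: measurable_absq; apply: cmeasurableB => //.
          by case: (Lu (phi k)).
        * move=> x _; rewrite lee_fin /g -mulrBl absqM absq_real indicE.
          by case: (x \in G); rewrite ?expr1n ?mulr1// expr0n mulr0 absq_ge0.
      by rewrite norm2E ?lee_fin; [exact: hK|apply: L2B; exact: Lu].
  - by apply/measurable_EFinP; exact: measurable_absq.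
  - by apply/measurable_EFinP; exact: measurable_absq.
  - by move=> x _; rewrite lee_fin absq_ge0.
  - by move=> x _; rewrite lee_fin absq_ge0.
  - apply: filterS Gae => x Gx _ /=; rewrite indicE mem_set// mulr1.
    by [].
have Lul n e : (exists K, forall k, (K <= k)%N ->
      norm2 mu (fun x => v k x - u n x) <= e) -> L2 mu (fun x => u n x - l x).
  move=> /lim_le h; have m1 : cmeasurable (fun x => u n x - l x).
    by apply: cmeasurableB => //; case: (Lu n).
  split => //; apply/integrableP; split.
    by apply/measurable_EFinP; exact: measurable_absq.
  under eq_integral do rewrite gee0_abs ?lee_fin ?absq_ge0//.
  by apply: le_lt_trans h _; rewrite ltry.
(* [l] is [u (phi 0)] minus a function that Fatou's lemma puts in L^2. *)
have Ll : L2 mu l.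
  have h := Lul (phi 0%N) (8^-1 ^+ 0) (ex_intro _ 0%N (fun k k0 => vB 0%N k k0)).
  rewrite (_ : l = fun x => u (phi 0%N) x - (u (phi 0%N) x - l x)); first exact: L2B.
  by apply/funext => x; rewrite opprB addrC subrK.
exists l => // e e_gt0; have [M hM] := Cu _ e_gt0.
exists M => n Mn; rewrite -lee_fin -norm2E; last by apply: L2B.
apply: lim_le.
by exists M => k Mk; apply: hM => //; rewrite (leq_trans Mk)// leq_addl.
Qed.

End RieszFischer.

(** * Dyadic squares *)

Section Translation.
Context {R : realType}.
Local Notation T1 := (measurableTypeR R).
Local Notation T2 := (T1 * T1)%type.
Local Notation lam := (@lebesgue2 R).

Let mshift1 (a : R) : measurable_fun setT ((fun x => x + a) : T1 -> T1).
Proof. by apply: measurable_funD => //; exact: measurable_cst. Qed.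

Lemma lebesgue_measure_shift (a : R) (A : set T1) : measurable A ->
  pushforward lebesgue_measure ((fun x => x + a) : T1 -> T1) A = lebesgue_measure A.
Proof.
move=> mA; apply/esym/lebesgue_measure_unique => // _ [[u v] _ <-].
transitivity (lebesgue_measure (`]u - a, v - a]%classic : set T1)).
  rewrite !lebesgue_measure_itv /= !lte_fin ltrD2r; case: ifP => // _.
  by rewrite -!EFinD; congr (_%:E); ring.
congr lebesgue_measure; apply/seteqP.
by split=> x /=; rewrite !in_itv /= ltrBlDr lerBrDr.
Qed.

Definition shift2 (a : R * R) (x : T2) : T2 := (x.1 + a.1, x.2 + a.2).

Lemma measurable_shift2 a : measurable_fun setT (shift2 a).
Proof.
apply: measurable_fun_pair; apply: measurable_funD => //; exact: measurable_cst.
Qed.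

Lemma lebesgue2_shift (a : R * R) (A : set T2) : measurable A ->
  pushforward lam (shift2 a) A = lam A.
Proof.
move=> mA; have ms := measurable_shift2 a.
apply/esym.
apply: (product_measure_unique (m' := pushforward lam (shift2 a) : {measure set T2 -> \bar R})) => //.
move=> X Y mX mY; rewrite /pushforward /=.
pose sh (b : R) (x : T1) : T1 := x + b.
have mp (b : R) (Z : set T1) : measurable Z -> measurable (sh b @^-1` Z).
  by move=> mZ; rewrite -[X in measurable X]setTI; exact: mshift1.
transitivity (lam ((sh a.1 @^-1` X) `*` (sh a.2 @^-1` Y))) => //.
rewrite /lebesgue2 /= product_measure1E; [|exact: mp..].
by congr (_ * _)%E; exact: lebesgue_measure_shift.
Qed.

Lemma ge0_integral_shift a (f : T2 -> \bar R) : measurable_fun setT f ->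
  (forall x, 0 <= f x)%E -> (\int[lam]_x f (shift2 a x) = \int[lam]_x f x)%E.
Proof.
move=> mf f0; have ms := measurable_shift2 a.
transitivity (\int[pushforward lam (shift2 a)]_x f x)%E.
  have h := @ge0_integral_pushforward _ _ _ _ R _ ms lam setT f measurableT mf.
  by apply/esym; apply: h => y _; exact: f0.
by apply: eq_measure_integral => A mA _; exact: lebesgue2_shift.
Qed.

Lemma integral_shift a (f : T2 -> R) : measurable_fun setT f ->
  (\int[lam]_x (f (shift2 a x))%:E = \int[lam]_x (f x)%:E)%E.
Proof.
move=> mf; have mfE : measurable_fun setT (EFin \o f) by exact/measurable_EFinP.
rewrite integralE [RHS]integralE; congr (_ - _)%E.
  have g0 (x : T2) : (0 <= ((EFin \o f)^\+ x))%E by exact: funepos_ge0.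
  rewrite -(ge0_integral_shift a (measurable_funepos mfE) g0).
  by apply: eq_integral => x _; rewrite !funeposE.
have g0 (x : T2) : (0 <= ((EFin \o f)^\- x))%E by exact: funeneg_ge0.
rewrite -(ge0_integral_shift a (measurable_funeneg mfE) g0).
by apply: eq_integral => x _; rewrite !funenegE.
Qed.

Lemma integrable_shift a (f : T2 -> R) :
  lam.-integrable setT (fun x => (f x)%:E) ->
  lam.-integrable setT (fun x => (f (shift2 a x))%:E).
Proof.
move=> /integrableP[mf fi]; have mf' : measurable_fun setT f by exact/measurable_EFinP.
apply/integrableP; split.
  apply/measurable_EFinP; exact: (measurableT_comp mf' (measurable_shift2 a)).
rewrite (ge0_integral_shift a (f := fun x => `|(f x)%:E|%E))//.
exact: measurableT_comp.
Qed.

Lemma cint_shift a (f : T2 -> R[i]) : cmeasurable f ->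
  cint lam (fun x => f (shift2 a x)) = cint lam f.
Proof.
move=> [mr mi]; apply: complex_ext; rewrite !(cint_Re, cint_Im) /Rintegral.
  by rewrite (integral_shift a mr).
by rewrite (integral_shift a mi).
Qed.

Lemma L2_shift a (f : T2 -> R[i]) : L2 lam f -> L2 lam (fun x => f (shift2 a x)).
Proof.
move=> [mf fi]; split; first exact: (cmeasurable_comp (measurable_shift2 a) mf).
exact: (integrable_shift a fi).
Qed.

End Translation.

Section Squares.
Context {R : realType}.
Local Notation T1 := (measurableTypeR R).
Local Notation T2 := (T1 * T1)%type.
Local Notation lam := (@lebesgue2 R).

(** Scaling [x] rather than the endpoints avoids divisions and makes membership a statement about a
    floor. *)
Definition dint (n : nat) (k : int) : set R :=
  [set x | k%:~R <= x * 2 ^+ n < (k + 1)%:~R].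

(* [(n, k, l)] encodes the square with lower left corner 2^-n (k, l), side 2^-n *)
Definition dsq (q : nat * int * int) : set (R * R) :=
  dint q.1.1 q.1.2 `*` dint q.1.1 q.2.

Lemma dint_itv n k : dint n k = `[k%:~R / 2 ^+ n, (k + 1)%:~R / 2 ^+ n[%classic.
Proof.
have p0 : 0 < 2 ^+ n :> R by rewrite exprn_gt0.
by apply/seteqP; split=> x /=; rewrite in_itv /= ler_pdivrMr// ltr_pdivlMr.
Qed.

Lemma dintP n x k : reflect (dint n k x) (Num.floor (x * 2 ^+ n) == k).
Proof.
apply: (iffP eqP) => [<-|h].
  by rewrite /dint /= floor_le_tmp floorD1_gt.
exact: floor_def.
Qed.

Lemma measurable_dint n k : measurable (dint n k : set T1).
Proof. by rewrite dint_itv; exact: measurable_itv. Qed.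

Lemma measurable_dsq q : measurable (dsq q : set T2).
Proof. by apply: measurableX; exact: measurable_dint. Qed.

Lemma lebesgue_dint n k : lebesgue_measure (dint n k) = ((2 ^- n)%:E : \bar R).
Proof.
rewrite dint_itv lebesgue_measure_itv /= lte_fin ltr_pM2r ?invr_gt0 ?exprn_gt0//.
rewrite ltr_int ltzD1 lexx -EFinD; congr (_%:E).
by rewrite -mulrBl intrD addrAC subrr add0r mul1r.
Qed.

Lemma lebesgue2_dsq q : lam (dsq q) = ((4 ^- q.1.1)%:E : \bar R).
Proof.
transitivity (lebesgue_measure (dint q.1.1 q.1.2) * lebesgue_measure (dint q.1.1 q.2))%E.
  by rewrite /lebesgue2 /= product_measure1E//; exact: measurable_dint.
rewrite !lebesgue_dint -EFinM; congr (_%:E).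
by rewrite -invfM -exprMn (_ : 2 * 2 = 4 :> R)//; lra.
Qed.

Lemma dint_nest n m j k x y : (n <= m)%N ->
  dint m j x -> dint m j y -> dint n k x -> dint n k y.
Proof.
move=> nm; rewrite /dint /=; have -> : 2 ^+ m = 2 ^+ n * (2 ^ (m - n))%N%:R :> R.
  by rewrite natrX -exprD subnKC.
set p := (2 ^ (m - n))%N; have p0 : 0 < p%:R :> R by rewrite ltr0n expn_gt0.
rewrite !mulrA; move: (x * _) (y * _) => {}x {}y /andP[jx xj] /andP[jy yj] /andP[kx xk].
(* Between integers, these strict inequalities say [k p <= j] and [j + 1 <= (k + 1) p], which is the
   inclusion. *)
have h1 : (k * p%:Z < j + 1)%R.
  rewrite -(ltr_int R); apply: le_lt_trans xj.
  by rewrite intrM ler_pM2r.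
have h2 : (j < (k + 1) * p%:Z)%R.
  rewrite -(ltr_int R); apply: le_lt_trans jx _.
  by rewrite intrM ltr_pM2r.
apply/andP; split.
  rewrite -(ler_pM2r p0); apply: le_trans jy.
  rewrite -[p%:R]/(p%:Z%:~R) -intrM ler_int; lia.
rewrite -(ltr_pM2r p0); apply: lt_le_trans yj _.
rewrite -[p%:R]/(p%:Z%:~R) -intrM ler_int; lia.
Qed.

Lemma dsq_nest q r x : (q.1.1 <= r.1.1)%N -> dsq q x -> dsq r x -> dsq r `<=` dsq q.
Proof.
move=> qr [q1 q2] [r1 r2] y [y1 y2]; split; first exact: (dint_nest qr r1).
exact: (dint_nest qr r2).
Qed.

(** Two dyadic squares that meet are nested; together with the empty set they form a pi-system. *)
Lemma dsq_cap q r : [\/ dsq q `&` dsq r = set0, dsq q `&` dsq r = dsq q |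
  dsq q `&` dsq r = dsq r].
Proof.
have [e|/set0P[x [qx rx]]] := eqVneq (dsq q `&` dsq r) set0; first by apply: Or31.
have [h|/ltnW h] := leqP q.1.1 r.1.1.
  by apply: Or33; rewrite setIidr//; exact: (dsq_nest h qx rx).
by apply: Or32; rewrite setIidl//; exact: (dsq_nest h rx qx).
Qed.

Lemma dint_cover n x : dint n (Num.floor (x * 2 ^+ n)) x.
Proof. exact/dintP. Qed.

Lemma dint_inj n k k' x : dint n k x -> dint n k' x -> k = k'.
Proof. by move=> /dintP/eqP <- /dintP/eqP <-. Qed.

Lemma dint_shift n k (j : int) x :
  dint n (k + j) (x + j%:~R / 2 ^+ n) <-> dint n k x.
Proof.
have p0 : 2 ^+ n != 0 :> R by rewrite expf_neq0.
rewrite /dint /= mulrDl divfK// addrAC !intrD.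
by rewrite lerD2r ltrD2r.
Qed.

Lemma dint_half n k x : dint n k x <-> dint n.+1 (2 * k) x \/ dint n.+1 (2 * k + 1) x.
Proof.
rewrite /dint /= exprS mulrCA; move: (x * _) => {}x.
rewrite !(intrD, intrM) /=; split=> [/andP[h1 h2]|[/andP[h1 h2]|/andP[h1 h2]]].
- have [h|h] := ltP (2 * x) (2%:~R * k%:~R + 1%:~R); [left|right]; apply/andP; split => //; lra.
- apply/andP; split; lra.
- apply/andP; split; lra.
Qed.

Definition dyadic : set (set T2) := [set A | A = set0 \/ exists q, A = dsq q].

Lemma dyadic_setI : setI_closed dyadic.
Proof.
move=> _ _ [->|[q ->]] [->|[r ->]]; rewrite ?set0I ?setI0; try by left.
by have [->|->|->] := dsq_cap q r; [left|right; exists q|right; exists r].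
Qed.

Lemma exists_dint (x y : R) : x < y -> exists n k, dint n k y /\ dint n k `<=` `]x, +oo[.
Proof.
move=> xy; have d0 : 0 < y - x by rewrite subr_gt0.
have [n _ hn] := near_infty_natSinv_expn_lt (PosNum d0).
exists n, (Num.floor (y * 2 ^+ n)); split; first exact: dint_cover.
have /= {}hn := hn n (leqnn n).
move=> z /andP[z1 z2] /=; rewrite in_itv /= andbT.
have p0 : 0 < 2 ^+ n :> R by rewrite exprn_gt0.
have := floorD1_gt (y * 2 ^+ n); rewrite intrD => h.
have : (y - x) * 2 ^+ n > 1.
  by move: hn; rewrite ltr_pdivrMr.
rewrite mulrBl => h2; rewrite -(ltr_pM2r p0); move: h; rewrite -[1%:~R]/(1 : R); lra.
Qed.

(** The preimage of an open ray under a projection is a union of squares, of which there are only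
    countably many; open rays generate the Borel sets of the line. *)
Lemma measurable_dyadic : @measurable _ T2 = <<s dyadic >>.
Proof.
have sD : sigma_algebra setT <<s dyadic >> by exact: smallest_sigma_algebra.
have cup (I : countType) (F : I -> set T2) : (forall i, <<s dyadic >> (F i)) ->
    <<s dyadic >> (\bigcup_i F i).
  move=> FD; exact: (@countable_bigcupT_measurable _ (g_sigma_algebraType dyadic)).
have dD q : <<s dyadic >> (dsq q) by apply: sub_sigma_algebra; right; exists q.
have cupP (P : nat * int * int -> Prop) :
    <<s dyadic >> (\bigcup_(q in P) dsq q).
  rewrite bigcup_mkcond; apply: cup => q; case: ifP => // _.
  by case: sD.
have open1 (p : T2 -> T1) x : p = fst \/ p = snd -> <<s dyadic >> (p @^-1` `]x, +oo[).
  move=> [->|->].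
    rewrite (_ : _ @^-1` _ = \bigcup_(q in [set q | dint q.1.1 q.1.2 `<=` `]x, +oo[]) dsq q).
      exact: cupP.
    apply/seteqP; split=> [y|y [q /= h [y1 y2]]]; last exact: h.
    rewrite /= in_itv /= andbT => /exists_dint[n [k [h1 h2]]].
    by exists (n, k, Num.floor (y.2 * 2 ^+ n)) => //; split => //=; exact: dint_cover.
  rewrite (_ : _ @^-1` _ = \bigcup_(q in [set q | dint q.1.1 q.2 `<=` `]x, +oo[]) dsq q).
    exact: cupP.
  apply/seteqP; split=> [y|y [q /= h [y1 y2]]]; last exact: h.
  rewrite /= in_itv /= andbT => /exists_dint[n [k [h1 h2]]].
  by exists (n, Num.floor (y.1 * 2 ^+ n), k) => //; split => //=; exact: dint_cover.
have pre (p : T2 -> T1) A : p = fst \/ p = snd -> measurable A -> <<s dyadic >> (p @^-1` A).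
  move=> hp mA.
  have : (@RGenOInfty.G R).-sigma.-measurable A by rewrite -RGenOInfty.measurableE.
  have sub : <<s @RGenOInfty.G R >> `<=` [set A : set T1 | <<s dyadic >> (p @^-1` A)].
    apply: smallest_sub; last by move=> _ [x ->]; exact: open1.
    split => [|B|F] /=; first by rewrite preimage_set0; case: sD.
      by move=> h; rewrite setTD preimage_setC -setTD; case: sD => _ + _; exact.
    by move=> h; rewrite preimage_bigcup; case: sD => _ _; exact.
  exact: sub.
apply/seteqP; split.
  apply: smallest_sub => //; rewrite subUset; split => _ [A mA <-]; rewrite setTI.
    by apply: pre => //; left.
  by apply: pre => //; right.
apply: smallest_sub; first exact: sigma_algebra_measurable.
by move=> _ [->|[q ->]]; [exact: measurable0|exact: measurable_dsq].
Qed.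

End Squares.

Definition cindic {R : realType} {T : Type} (A : set T) : T -> R[i] :=
  fun x => (\1_A x : R)%:C.

Import HBNNSimple.

(** * An induction principle for L^2 of the plane *)

Section L2Induction.
Context {R : realType}.
Local Notation T1 := (measurableTypeR R).
Local Notation T2 := (T1 * T1)%type.
Local Notation lam := (@lebesgue2 R).
Variable P : (T2 -> R[i]) -> Prop.
Hypothesis PD : forall f g, L2 lam f -> L2 lam g -> P f -> P g -> P (fun x => f x + g x).
Hypothesis PZ : forall c f, L2 lam f -> P f -> P (fun x => c * f x).
Hypothesis Plim : forall f, L2 lam f ->
  (forall e : R, 0 < e -> exists g, [/\ L2 lam g, P g & norm2 lam (fun x => f x - g x) < e]) ->
  P f.
Hypothesis Pdsq : forall q, P (cindic (dsq q)).

Let L2_dsq q : L2 lam (cindic (dsq q) : T2 -> R[i]).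
Proof.
apply: L2_indic; first exact: measurable_dsq.
by rewrite lebesgue2_dsq ltry.
Qed.

Let P0 : P (fun=> 0).
Proof.
have := PZ 0 (L2_dsq (0%N, 0, 0)) (Pdsq _).
by rewrite (_ : (fun x => _) = fun=> 0)//; apply/funext => x; rewrite mul0r.
Qed.

Let PB f g : L2 lam f -> L2 lam g -> P f -> P g -> P (fun x => f x - g x).
Proof.
move=> lf lg Pf Pg.
rewrite (_ : (fun x => _) = (fun x => f x + (-1) * g x)).
  by apply: PD => //; [exact: L2Z|exact: PZ].
by apply/funext => x; rewrite mulN1r.
Qed.

Let Pcvg (g : nat -> T2 -> R[i]) f (h : T2 -> R) :
  (forall n, L2 lam (g n)) -> (forall n, P (g n)) -> L2 lam f ->
  (forall x, (fun n => absq (g n x - f x)) @ \oo --> 0) ->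
  (forall n x, absq (g n x - f x) <= h x) ->
  lam.-integrable setT (fun x => (h x)%:E) -> P f.
Proof.
move=> lg Pg lf gf gh ih; apply: Plim => // e e0.
have := norm2_dominated lg lf gf gh ih.
move=> /cvgr0Pnorm_lt/(_ e e0)[N _ hN].
exists (g N); split => //.
have := hN N (leqnn N); rewrite /= ger0_norm ?norm2_ge0//; apply: le_lt_trans.
rewrite le_eqVlt; apply/orP; left; apply/eqP; congr Rintegral.
by apply/funext => x; rewrite absqB.
Qed.

Let fin (A : set T2) := measurable A /\ (lam A < +oo)%E.

Let L2_fin A : fin A -> L2 lam (cindic A).
Proof. by move=> [mA fA]; exact: L2_indic. Qed.

Let finS A B : measurable A -> fin B -> A `<=` B -> fin A.
Proof.
move=> mA [mB fB] AB; split => //; apply: le_lt_trans fB.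
by apply: le_measure => //; rewrite inE.
Qed.

Let fin_dsq q : fin (dsq q).
Proof. by split; [exact: measurable_dsq|rewrite lebesgue2_dsq ltry]. Qed.

Let absq_indic (A : set T2) x : absq (cindic A x : R[i]) = \1_A x.
Proof.
by rewrite absq_real indicE; case: (x \in A); rewrite ?expr1n ?expr0n.
Qed.

(** By disjointness every partial sum takes at each point either the value 0 or that of the
    indicator of [A], so the error is dominated by that indicator. *)
Let Pbigcup (F : (set T2)^nat) (A : set T2) : fin A ->
  (forall n, measurable (F n)) -> trivIset setT F ->
  A = \bigcup_n F n -> (forall n, P (cindic (F n))) -> P (cindic A).
Proof.
move=> fA mF tF AF PF.
have fF n : fin (F n) by apply: (finS _ fA) => //; rewrite AF; exact: bigcup_sup.
pose g n x : R[i] := \sum_(i < n) cindic (F i) x.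
have lg n : L2 lam (g n).
  elim: n => [|n IH].
    by rewrite (_ : g 0%N = fun=> 0); [exact: L2_0|apply/funext => x; rewrite /g big_ord0].
  rewrite (_ : g n.+1 = fun x => g n x + cindic (F n) x).
    by apply: L2D => //; exact: L2_fin.
  by apply/funext => x; rewrite /g big_ord_recr.
have Pg n : P (g n).
  elim: n => [|n IH].
    by rewrite (_ : g 0%N = fun=> 0)//; apply/funext => x; rewrite /g big_ord0.
  rewrite (_ : g n.+1 = fun x => g n x + cindic (F n) x).
    by apply: PD => //; exact: L2_fin.
  by apply/funext => x; rewrite /g big_ord_recr.
have gE n x : g n x = 0 \/ g n x = cindic A x.
  rewrite /g.
  have [[k kn Fk]|nF] := pselect (exists2 k, (k < n)%N & F k x).
    right; rewrite (bigD1 (Ordinal kn))//= big1 => [|i ik].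
      by rewrite addr0 /cindic !indicE !mem_set// AF; exists k.
    rewrite /cindic indicE memNset// => Fi; move/eqP: ik; apply.
    apply/val_inj => /=; apply: (tF) => //.
    by exists x.
  left; rewrite big1// => i _; rewrite /cindic indicE memNset// => Fi.
  by apply: nF; exists i.
apply: (@Pcvg g (cindic A) (fun x => \1_A x)) => //.
- exact: L2_fin.
- move=> x; have [Ax|nAx] := pselect (A x).
    have [k _ Fk] : (\bigcup_n F n) x by rewrite -AF.
    apply: cvg_near_cst; exists k.+1 => // n /= kn.
    rewrite (_ : g n x = cindic A x) ?subrr ?absq0//.
    rewrite /g (bigD1 (Ordinal kn))//= big1 => [|i ik].
      by rewrite addr0 /cindic !indicE !mem_set.
    rewrite /cindic indicE memNset// => Fi; move/eqP: ik; apply.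
    by apply/val_inj => /=; apply: (tF) => //; exists x.
  apply: cvg_near_cst; apply: nearW => n.
  suff -> : cindic A x = 0 :> R[i].
    by have [->|->] := gE n x; rewrite ?subr0 ?absq0// /cindic indicE memNset ?subrr ?absq0.
  by rewrite /cindic indicE memNset.
- move=> n x; have [->|->] := gE n x; first by rewrite sub0r absqN absq_indic.
  by rewrite subrr absq0 indicE.
- have [_] := L2_fin fA; apply: eq_integrable => // x _.
  by rewrite absq_indic.
Qed.

(** Dynkin's theorem is run inside one unit square [Q]: the complement step subtracts from the
    indicator of [Q], which has to be in L^2. *)
Let P_sub_dsq (q : int * int) (A : set T2) : measurable A -> P (cindic (A `&` dsq (0%N, q.1, q.2))).
Proof.
pose Q : set T2 := dsq (0%N, q.1, q.2); rewrite -/Q => mA.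
have fQ (B : set T2) : measurable B -> fin (B `&` Q).
  move=> mB; apply: (finS _ (fin_dsq (0%N, q.1, q.2))); last exact: subIsetr.
  by apply: measurableI => //; exact: measurable_dsq.
move: mA; rewrite {1}measurable_dyadic.
apply: (@dynkin_induction _ T2 dyadic (fun A => P (cindic (A `&` Q)))).
- exact: measurable_dyadic.
- exact: dyadic_setI.
- by rewrite setTI; exact: Pdsq.
- move=> _ [->|[r ->]]; rewrite /= /Q.
    rewrite set0I (_ : cindic set0 = fun=> 0)//.
    by apply/funext => x; rewrite /cindic indic0.
  have [->|->|->] := @dsq_cap R r (0%N, q.1, q.2); [|exact: Pdsq|exact: Pdsq].
  by rewrite (_ : cindic set0 = fun=> 0)//; apply/funext => x; rewrite /cindic indic0.
- move=> S mS PS.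
  rewrite (_ : cindic _ = fun x => cindic Q x - cindic (S `&` Q) x).
    apply: PB => //; [exact: L2_dsq|exact: L2_fin (fQ _ mS)|exact: Pdsq].
  apply/funext => x; rewrite /cindic !indicE !in_setI in_setC.
  by case: (x \in S) => /=; case: (x \in Q); rewrite ?subrr ?subr0.
- move=> F mF tF PF.
  apply: (@Pbigcup (fun n => F n `&` Q)) => //.
  + by apply: fQ; exact: bigcup_measurable.
  + by move=> n; apply: measurableI => //; exact: measurable_dsq.
  + exact: trivIset_setIr.
  + by rewrite setI_bigcupl.
Qed.

(** The set is cut along the countably many unit squares, enumerated through [pickle]; a number that
    encodes no square contributes the empty set. *)
Let P_fin (A : set T2) : fin A -> P (cindic A).
Proof.
move=> fA; have [mA _] := fA.
have Pset0 : P (cindic set0).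
  by rewrite (_ : cindic set0 = fun=> 0)//; apply/funext => x; rewrite /cindic indic0.
pose F n : set T2 :=
  if @pickle_inv (int * int)%type n is Some q then A `&` dsq (0%N, q.1, q.2) else set0.
apply: (@Pbigcup F A fA).
- move=> n; rewrite /F; case: pickle_inv => [q|]; last exact: measurable0.
  by apply: measurableI; [exact: mA|exact: measurable_dsq].
- move=> i j _ _ [x []]; rewrite /F.
  have := @pickle_invK (int * int)%type i; have := @pickle_invK (int * int)%type j.
  case: (pickle_inv i) => [q|//]; case: (pickle_inv j) => [r|//] /= <- <-.
  move=> [_ [/= q1 q2]] [_ [/= r1 r2]]; congr pickle.
  by move: q r q1 q2 r1 r2 => [q q'] [r r'] /= q1 q2 r1 r2; rewrite (dint_inj q1 r1) (dint_inj q2 r2).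
- have cell (q : int * int) x : A x -> dsq (0%N, q.1, q.2) x -> (\bigcup_n F n) x.
    by move=> Ax qx; exists (pickle q); [exact: I|rewrite /F pickleK_inv; split].
  apply/seteqP; split=> [x Ax|x [n _]].
    apply: (cell (Num.floor (x.1 * 2 ^+ 0), Num.floor (x.2 * 2 ^+ 0))); first exact: Ax.
    by split; exact: dint_cover.
  by rewrite /F; case: pickle_inv => [q []|].
- move=> n; rewrite /F; case: pickle_inv => [q|]; last exact: Pset0.
  exact: P_sub_dsq.
Qed.

Let P_ge0 (f : T2 -> R) : (forall x, 0 <= f x) -> L2 lam (fun x => (f x)%:C) ->
  P (fun x => (f x)%:C).
Proof.
move=> f0 lf; have [[mf _] fi] := lf.
have {}fi : lam.-integrable setT (fun x => (f x ^+ 2)%:E).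
  by move: fi; under eq_fun do rewrite absq_real.
have mfE : measurable_fun setT (EFin \o f) by exact/measurable_EFinP.
have [|g [ndg gcvgE]] := approximation measurableT mfE.
  by move=> x _; rewrite lee_fin.
have gcvg x : (fun n => g n x) @ \oo --> f x.
  exact: (fine_cvg (gcvgE x I)).
have gf n x : g n x <= f x.
  rewrite -(cvg_lim _ (gcvg x))//; apply: (@nondecreasing_cvgn_le _ (fun n => g n x)).
    by move=> i j ij; exact/lefP/ndg.
  by apply/cvg_ex; exists (f x); exact: gcvg.
have mg n : measurable_fun setT (g n) by exact: measurable_funP.
have gx n x : 0 <= g n x by exact: fun_ge0.
have lg n : L2 lam (fun x => (g n x)%:C).
  apply: (L2_bound _ _ fi); first exact: cmeasurable_real.
  by move=> x; rewrite absq_real ler_sqr ?nnegrE.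
(* Chebyshev's inequality: where [g n] equals [r] one has [r^2 <= f^2], and [f^2] is integrable. *)
have fing n r : r != 0 -> fin (g n @^-1` [set r]).
  move=> r0; have mA : measurable (g n @^-1` [set r]) by exact: measurable_sfunP.
  split => //; have := fi => /integrableP[_].
  have -> : lam (g n @^-1` [set r]) = (\int[lam]_x (\1_(g n @^-1` [set r]) x)%:E)%E.
    by rewrite integral_indic// setIT.
  move=> h; apply: le_lt_trans (_ : (r ^- 2)%:E * \int[lam]_x `|(f x ^+ 2)%:E| < _)%E.
    rewrite -ge0_integralZl//; first last.
    - by rewrite lee_fin invr_ge0 sqr_ge0.
    - by apply: measurableT_comp => //; apply/measurable_EFinP; exact: measurable_funX.
    apply: ge0_le_integral => //.
    - exact/measurable_EFinP/measurable_indic.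
    - apply: measurable_funeM; apply: measurableT_comp => //.
      by apply/measurable_EFinP; exact: measurable_funX.
    - move=> x _; rewrite abse_EFin -EFinM lee_fin ger0_norm ?sqr_ge0// indicE.
      have r2 : 0 < r ^+ 2 by rewrite exprn_even_gt0.
      case: (boolP (x \in _)) => [/set_mem /= gr|_].
        rewrite mulrC ler_pdivlMr// mul1r -gr ler_sqr ?nnegrE//.
      by rewrite mulr_ge0 ?invr_ge0 ?sqr_ge0.
  by rewrite lte_mul_pinfty// ?lee_fin ?invr_ge0 ?sqr_ge0.
have Pg n : P (fun x => (g n x)%:C).
  (* The level set of 0 may have infinite measure; the factor [r] removes it from the sum. *)
  pose t r x : R[i] := r%:C * cindic (g n @^-1` [set r]) x.
  have lt r : L2 lam (t r) /\ P (t r).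
    have [->|r0] := eqVneq r 0.
      rewrite (_ : t 0 = fun=> 0); first by split; [exact: L2_0|exact: P0].
      by apply/funext => x; rewrite /t mul0r.
    by split; [apply: L2Z; exact: L2_fin (fing n r r0)|apply: PZ; [exact: L2_fin (fing n r r0)|exact: P_fin (fing n r r0)]].
  have sum (s : seq R) : L2 lam (fun x => \sum_(r <- s) t r x) /\ P (fun x => \sum_(r <- s) t r x).
    elim: s => [|r s [IH1 IH2]].
      rewrite (_ : (fun x => _) = fun=> 0); first by split; [exact: L2_0|exact: P0].
      by apply/funext => x; rewrite big_nil.
    rewrite (_ : (fun x => _) = fun x => t r x + \sum_(r <- s) t r x).
      by have [l1 p1] := lt r; split; [exact: L2D|exact: PD].
    by apply/funext => x; rewrite big_cons.
  have [_] := sum (finmap.enum_fset (fset_set (range (g n)))).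
  rewrite (_ : (fun x => \sum_(r <- _) _) = fun x => (g n x)%:C)//.
  apply/funext => x; rewrite [in RHS]fimfunE fsbig_finite//= rmorph_sum.
  by apply: eq_bigr => r _; rewrite rmorphM.
apply: (@Pcvg (fun n x => (g n x)%:C) _ (fun x => f x ^+ 2)) => // [x|n x].
- have h : (fun n => g n x - f x) @ \oo --> 0.
    by rewrite -(subrr (f x)); apply: cvgB; [exact: gcvg|exact: cvg_cst].
  rewrite (_ : (fun n => _) = fun n => (g n x - f x) * (g n x - f x)).
    by rewrite -(mulr0 0); exact: cvgM.
  by apply/funext => n; rewrite -rmorphB absq_real expr2.
- by rewrite -rmorphB absq_real -sqrrN opprB ler_sqr ?nnegrE ?subr_ge0 ?gerBl.
Qed.

Let P_real (f : T2 -> R) : L2 lam (fun x => (f x)%:C) -> P (fun x => (f x)%:C).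
Proof.
move=> lf; have [[mf _] fi] := lf.
have h (g : T2 -> R) : measurable_fun setT g -> (forall x, `|g x| <= `|f x|) ->
    L2 lam (fun x => (g x)%:C).
  move=> mg gf; apply: (L2_bound _ _ fi); first exact: cmeasurable_real.
  by move=> x; rewrite !absq_real -(real_normK (num_real (g x))) -(real_normK (num_real (f x))) ler_sqr ?nnegrE.
have l1 : L2 lam (fun x => (Num.max (f x) 0)%:C).
  apply: h; first exact: measurable_maxr.
  by move=> x; case: (leP (f x) 0) => fx; rewrite ?normr0.
have l2 : L2 lam (fun x => (Num.max (- f x) 0)%:C).
  apply: h; first by apply: measurable_maxr => //; exact: measurable_funN.
  by move=> x; case: (leP (- f x) 0) => fx; rewrite ?normr0 ?normrN.
rewrite (_ : (fun x => _) = fun x => (Num.max (f x) 0)%:C - (Num.max (- f x) 0)%:C).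
  by apply: PB => //; apply: P_ge0 => // x; rewrite le_max lexx orbT.
apply/funext => x; rewrite -rmorphB; congr (_%:C).
by case: (leP (f x) 0) => h1; case: (leP (- f x) 0) => h2; lra.
Qed.

Theorem L2_ind f : L2 lam f -> P f.
Proof.
move=> [[mr mi] fi].
have lr : L2 lam (fun x => (Re (f x))%:C).
  apply: (L2_bound _ _ fi); first exact: cmeasurable_real.
  by move=> x; rewrite absq_real lerDl sqr_ge0.
have li : L2 lam (fun x => (Im (f x))%:C).
  apply: (L2_bound _ _ fi); first exact: cmeasurable_real.
  by move=> x; rewrite absq_real lerDr sqr_ge0.
rewrite (_ : f = fun x => (Re (f x))%:C + 'i%C * (Im (f x))%:C).
  by apply: PD; [| apply: L2Z|exact: P_real|apply: PZ => //; exact: P_real].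
by apply/funext => x; exact: complexE.
Qed.

End L2Induction.

(** * The glued space *)

Section Fields.
Context {R : realType}.
Local Notation T1 := (measurableTypeR R).
Local Notation T2 := (T1 * T1)%type.
Local Notation lam := (@lebesgue2 R).

(** [true] stands for the first coordinate, and also for the component that lives on the half plane
    where this coordinate is nonnegative. *)
Definition crd (i : bool) (x : R * R) : R := if i then x.1 else x.2.

Definition reg (i : bool) : set (R * R) := [set x | 0 <= crd i x].

Lemma measurable_reg i : measurable (reg i : set T2).
Proof.
have mi : measurable (`[0, +oo[%classic : set T1) by exact: measurable_itv.
have -> : (reg i : set T2) = (fun x : T2 => crd i x : T1) @^-1` `[0, +oo[.
  by apply/seteqP; split=> x /=; rewrite /reg /= in_itv /= andbT.
rewrite -[X in measurable X]setTI; case: i.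
  exact: ((@measurable_fst _ _ T1 T1) measurableT _ mi).
exact: ((@measurable_snd _ _ T1 T1) measurableT _ mi).
Qed.

(** The support condition holds at every point, not almost everywhere: identities between fields can
    then be proved pointwise, null sets being left to the Hausdorff quotient. *)
Definition fld_pred : {pred bool -> R * R -> R[i]^o} := fun h =>
  `[< forall i, L2 lam (h i) /\ forall x, ~ reg i x -> h i x = 0 >].

Lemma fldP (h : bool -> R * R -> R[i]^o) :
  h \in fld_pred <-> forall i, L2 lam (h i) /\ forall x, ~ reg i x -> h i x = 0.
Proof. by split => /asboolP. Qed.

Lemma fld_submod : submod_closed fld_pred.
Proof.
split=> [|c f g /fldP hf /fldP hg].
  by apply/fldP => i; split=> //; exact: L2_0.
apply/fldP => i; have [lf f0] := hf i; have [lg g0] := hg i; split.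
  by apply: L2D => //; exact: L2Z.
by move=> x nx; rewrite /= !fctE f0// g0// scaler0 addr0.
Qed.

HB.instance Definition _ := GRing.isSubmodClosed.Build _ _ fld_pred fld_submod.

Definition fld := {h : bool -> R * R -> R[i]^o | h \in fld_pred}.

HB.instance Definition _ := [isSub of fld for @sval _ _].
HB.instance Definition _ := [Choice of fld by <:].
HB.instance Definition _ := [SubChoice_isSubLmodule of fld by <:].

Implicit Types h k : fld.

Lemma fld_L2 h i : L2 lam (val h i).
Proof. by have /fldP/(_ i)[] := valP h. Qed.

Lemma fld_out h i x : ~ reg i x -> val h i x = 0.
Proof. by have /fldP/(_ i)[_] := valP h; exact. Qed.

Lemma fldDE h k i x : val (h + k) i x = val h i x + val k i x.
Proof. by []. Qed.

Lemma fldZE c h i x : val (c *: h) i x = c * val h i x.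
Proof. by []. Qed.

Lemma fldBE h k i x : val (h - k) i x = val h i x - val k i x.
Proof. by []. Qed.

Lemma fld_ext h k : (forall i x, val h i x = val k i x) -> h = k.
Proof. by move=> e; apply/val_inj/funext => i; apply/funext => x. Qed.

(** The value is 0 on a family that is not a field; the side conditions are deferred to [mkfldE]. *)
Definition mkfld (f : bool -> R * R -> R[i]^o) : fld := insubd (0 : fld) f.

Lemma mkfldE (f : bool -> R * R -> R[i]^o) i x :
  (forall i, L2 lam (f i)) -> (forall i x, ~ reg i x -> f i x = 0) ->
  val (mkfld f) i x = f i x.
Proof.
move=> lf f0; rewrite val_insubd ifT//; apply/fldP => j; split => //.
exact: f0.
Qed.

(* The Gram form of two unit vectors of C^2 with inner product c *)
Definition form (c : R) (u v : bool -> R[i]) : R[i] :=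
  u true * Num.conj (v true) + u false * Num.conj (v false) +
  c%:C * (u true * Num.conj (v false) + u false * Num.conj (v true)).

Definition fip c h k : R[i] :=
  cint lam (fun x => form c (fun i => val h i x) (fun i => val k i x)).

Lemma conj_real (r : R) : Num.conj r%:C = r%:C.
Proof. by apply: complex_ext; rewrite !ReImE ?oppr0. Qed.

Lemma form_conj c u v : form c v u = Num.conj (form c u v).
Proof.
rewrite /form !(rmorphD, rmorphM) /= conj_real !conjCK; ring.
Qed.

Lemma formDl c u v w : form c (fun i => u i + v i) w = form c u w + form c v w.
Proof. rewrite /form; ring. Qed.

Lemma formZl c a u w : form c (fun i => a * u i) w = a * form c u w.
Proof. rewrite /form; ring. Qed.

Definition qform c (u : bool -> R[i]) : R :=
  absq (u true) + absq (u false) +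
  2 * c * (Re (u true) * Re (u false) + Im (u true) * Im (u false)).

Lemma form_qform c u : form c u u = (qform c u)%:C.
Proof. by apply: complex_ext; rewrite /form /qform /absq !ReImE; ring. Qed.

(** [1 - c] and [1 + c] are the eigenvalues of the Gram matrix. For [c < 1] the glued norm is thus
    equivalent to that of the direct sum, which gives completeness. *)
Lemma qform_ge c u : 0 <= c -> (1 - c) * (absq (u true) + absq (u false)) <= qform c u.
Proof.
move=> c0; rewrite /qform /absq.
have := sqr_ge0 (Re (u true) + Re (u false)).
have := sqr_ge0 (Im (u true) + Im (u false)); nra.
Qed.

Lemma qform_le c u : 0 <= c -> qform c u <= (1 + c) * (absq (u true) + absq (u false)).
Proof.
move=> c0; rewrite /qform /absq.
have := sqr_ge0 (Re (u true) - Re (u false)).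
have := sqr_ge0 (Im (u true) - Im (u false)); nra.
Qed.

Lemma fip_integrable c h k :
  cintegrable lam (fun x => form c (fun i => val h i x) (fun i => val k i x)).
Proof.
have pr i j : cintegrable lam (fun x => val h i x * Num.conj (val k j x)).
  by apply: L2_prod; exact: fld_L2.
apply: cintegrableD; first exact: cintegrableD.
by apply: cintegrableZ; exact: cintegrableD.
Qed.

Section Pre.
Variables (c : R) (c01 : 0 <= c < 1).

Let c0 : 0 <= c. Proof. by have /andP[] := c01. Qed.
Let c1 : 0 < 1 - c. Proof. by rewrite subr_gt0; have /andP[] := c01. Qed.

Lemma fipDl h k l : fip c (h + k) l = fip c h l + fip c k l.
Proof.
rewrite /fip -cintD; try exact: fip_integrable.
by apply: eq_cint => x; rewrite -formDl.
Qed.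

Lemma fipZl a h l : fip c (a *: h) l = a * fip c h l.
Proof.
rewrite /fip -cintZ; last exact: fip_integrable.
by apply: eq_cint => x; rewrite -formZl.
Qed.

Lemma fipC h k : fip c k h = Num.conj (fip c h k).
Proof.
rewrite /fip -cint_conj; last exact: fip_integrable.
by apply: eq_cint => x; rewrite -form_conj.
Qed.

Definition fsq h : R := \int[lam]_(x in setT) qform c (fun i => val h i x).

Lemma fip_fsq h : fip c h h = (fsq h)%:C.
Proof. by rewrite /fip -cint_real; apply: eq_cint => x; exact: form_qform. Qed.

Lemma qform_ge0 u : 0 <= qform c u.
Proof.
by apply: le_trans (qform_ge u c0); rewrite mulr_ge0 ?(ltW c1)// addr_ge0 ?absq_ge0.
Qed.

Lemma fip_ge0 h : 0 <= fip c h h.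
Proof. by rewrite fip_fsq ler0c; apply: Rintegral_ge0 => x _; exact: qform_ge0. Qed.

Lemma qform_integrable h :
  lam.-integrable setT (fun x => (qform c (fun i => val h i x))%:E).
Proof.
have [+ _] := fip_integrable c h h; apply: eq_integrable => // x _.
by rewrite form_qform.
Qed.

Lemma absq_integrable h i : lam.-integrable setT (fun x => (absq (val h i x))%:E).
Proof. by have [] := fld_L2 h i. Qed.

Lemma fsq_ge h i : (1 - c) * norm2 lam (val h i) <= fsq h.
Proof.
rewrite /norm2 /fsq -RintegralZl//; last exact: absq_integrable.
apply: le_Rintegral => //.
- exact: (integrableZr _ (absq_integrable h i)).
- exact: qform_integrable.
- move=> x _; apply: le_trans (qform_ge _ c0); apply: ler_wpM2l; first exact: ltW.
  by case: i; rewrite ?lerDl ?lerDr absq_ge0.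
Qed.

Lemma fsq_le h : fsq h <= (1 + c) * (norm2 lam (val h true) + norm2 lam (val h false)).
Proof.
have it := absq_integrable h true; have jf := absq_integrable h false.
rewrite /norm2 /fsq -RintegralD// -RintegralZl//; last exact: integrableDr.
apply: le_Rintegral => //.
- exact: qform_integrable.
- by apply: integrableZr; exact: integrableDr.
- by move=> x _; exact: qform_le.
Qed.

Lemma fip_complete (u : nat -> fld) :
  (forall e : R, 0 < e -> exists N, forall m n, (N <= m)%N -> (N <= n)%N ->
    Re (fip c (u m - u n) (u m - u n)) <= e) ->
  exists l, forall e : R, 0 < e -> exists N, forall n, (N <= n)%N ->
    Re (fip c (u n - l) (u n - l)) <= e.
Proof.
move=> Cu.
have Cui i e : 0 < e -> exists N, forall m n, (N <= m)%N -> (N <= n)%N ->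
    norm2 lam (fun x => val (u m) i x - val (u n) i x) <= e.
  move=> e0; have [N hN] := Cu _ (mulr_gt0 c1 e0).
  exists N => m n Nm Nn; have := hN m n Nm Nn; rewrite fip_fsq /= => h.
  by rewrite -(ler_pM2l c1); apply: le_trans h; exact: (fsq_ge (u m - u n) i).
pose l i := projT1 (cid2 (Riesz_Fischer (fun n => fld_L2 (u n) i) (Cui i))).
have lL i : L2 lam (l i) by rewrite /l; case: cid2.
have lP i e : 0 < e -> exists N, forall n, (N <= n)%N ->
    norm2 lam (fun x => val (u n) i x - l i x) <= e.
  by rewrite /l; case: cid2 => /= f _; exact.
(* The limits are known to vanish off the half planes only almost everywhere. Cutting them restores
   the pointwise condition and does not increase the distance to [u n]. *)
pose L := mkfld (fun i x => cindic (reg i) x * l i x).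
have b1 i x : absq (cindic (reg i) x) <= 1 :> R.
  by rewrite absq_real indicE; case: (_ \in _); rewrite ?expr1n ?expr0n.
have lL1 i : L2 lam (fun x => cindic (reg i) x * l i x).
  apply: (@L2Mb _ _ _ _ _ 1) => //; apply: cmeasurable_indic; exact: measurable_reg.
have LE i x : val L i x = cindic (reg i) x * l i x.
  by apply: mkfldE => // j y ny; rewrite /cindic indicE memNset// mul0r.
exists L => e e0.
have e' : 0 < e / (2 * (1 + c)) by rewrite divr_gt0// mulr_gt0// ltr_wpDr.
have [Nt ht] := lP true _ e'; have [Nf hf] := lP false _ e'.
exists (maxn Nt Nf) => n; rewrite geq_max => /andP[nt nf].
rewrite fip_fsq /=; apply: le_trans (fsq_le _) _.
have le i : norm2 lam (val (u n - L) i) <= norm2 lam (fun x => val (u n) i x - l i x).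
  have l1 := L2B (fld_L2 (u n) i) (lL i).
  apply: le_Rintegral => //; [exact: absq_integrable|by case: l1|].
  move=> x _; rewrite fldBE LE.
  have [rx|nrx] := pselect (reg i x).
    by rewrite /cindic indicE mem_set// mul1r.
  by rewrite (fld_out _ nrx) /cindic indicE memNset// mul0r subr0 absq0 absq_ge0.
have lt := le_trans (le true) (ht n nt); have lf := le_trans (le false) (hf n nf).
apply: le_trans (_ : (1 + c) * (e / (2 * (1 + c)) + e / (2 * (1 + c))) <= _).
  by rewrite ler_wpM2l ?addr_ge0// lerD.
rewrite le_eqVlt; apply/orP; left; apply/eqP; field.
by rewrite gt_eqF// ltr_wpDr.
Qed.

Definition emb (i : bool) (f : R * R -> R[i]) : fld :=
  mkfld (fun j x => if j == i then cindic (reg i) x * f x else 0).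

Lemma absq_cindic (A : set (R * R)) x : absq (cindic A x : R[i]) = \1_A x.
Proof. by rewrite absq_real indicE; case: (x \in A); rewrite ?expr1n ?expr0n. Qed.

Lemma L2_cut (A : set (R * R)) (f : T2 -> R[i]) :
  measurable (A : set T2) -> L2 lam f -> L2 lam (fun x => cindic A x * f x).
Proof.
move=> mA; apply: (@L2Mb _ _ _ _ _ 1); first exact: cmeasurable_indic.
by move=> x; rewrite absq_cindic indicE; case: (_ \in _).
Qed.

Lemma embE i (f : T2 -> R[i]) j x : L2 lam f ->
  val (emb i f) j x = if j == i then cindic (reg i) x * f x else 0.
Proof.
move=> lf; rewrite /emb mkfldE => [//|k|k y ny].
  case: (k == i); last exact: L2_0.
  by apply: L2_cut => //; exact: measurable_reg.
by case: eqVneq => [ki|//]; rewrite /cindic indicE memNset ?mul0r// -ki.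
Qed.

Lemma emb_split h : h = emb true (val h true) + emb false (val h false).
Proof.
apply: fld_ext => i x; rewrite fldDE !embE; try exact: fld_L2.
have cut j : cindic (reg j) x * val h j x = val h j x.
  have [rx|nrx] := pselect (reg j x); first by rewrite /cindic indicE mem_set// mul1r.
  by rewrite (fld_out _ nrx) mulr0.
by case: i => /=; rewrite ?addr0 ?add0r cut.
Qed.

Lemma L2_cdsq q : L2 lam (cindic (dsq q)).
Proof.
by apply: L2_indic; [exact: measurable_dsq|rewrite lebesgue2_dsq ltry].
Qed.

Definition sqv i q : fld := emb i (cindic (dsq q)).

(** A field is the sum of its two components, and [L2_ind] applies to each. *)
Lemma fld_ind (P : fld -> Prop) :
  (forall h k, P h -> P k -> P (h + k)) ->
  (forall a h, P h -> P (a *: h)) ->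
  (forall h, (forall e, 0 < e -> exists2 k, P k & fsq (h - k) < e) -> P h) ->
  (forall i q, P (sqv i q)) -> forall h, P h.
Proof.
move=> PD PZ Plim Psq.
have Pemb i f : L2 lam f -> P (emb i f).
  move=> lf; apply: (L2_ind (P := fun f => P (emb i f))) lf.
  - move=> {}f g lf lg Pf Pg.
    rewrite (_ : emb i _ = emb i f + emb i g); first exact: PD.
    apply: fld_ext => j x; rewrite fldDE !embE//; last exact: L2D.
    by case: eqVneq => _; rewrite ?mulrDr ?addr0.
  - move=> a {}f lf Pf.
    rewrite (_ : emb i _ = a *: emb i f); first exact: PZ.
    apply: fld_ext => j x; rewrite fldZE !embE//; last exact: L2Z.
    by case: eqVneq => _; rewrite ?mulr0// mulrCA.
  - move=> {}f lf hf; apply: Plim => e e0.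
    have e' : 0 < e / (1 + c) by rewrite divr_gt0// ltr_wpDr.
    have [g [lg Pg fg]] := hf _ e'; exists (emb i g) => //.
    apply: le_lt_trans (fsq_le _) _; rewrite mulrC -ltr_pdivlMr; last by rewrite ltr_wpDr.
    apply: le_lt_trans fg.
    have lfg := L2B lf lg.
    have E j x : val (emb i f - emb i g) j x = if j == i then cindic (reg i) x * (f x - g x) else 0.
      by rewrite fldBE !embE//; case: eqVneq => _; rewrite ?subr0// mulrBr.
    have n1 : norm2 lam (fun x => cindic (reg i) x * (f x - g x)) <= norm2 lam (fun x => f x - g x).
      apply: le_Rintegral => //; last first.
      + move=> x _; rewrite absqM absq_cindic indicE.
        by case: (_ \in _); rewrite ?mul1r// mul0r absq_ge0.
      + by case: lfg.
      + by have [] := L2_cut (measurable_reg i) lfg.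
    have n0 : norm2 lam (fun=> 0) = 0.
      by rewrite /norm2; under eq_Rintegral do rewrite absq0; rewrite Rintegral_cst// mul0r.
    apply: le_trans n1; rewrite /norm2.
    under [X in X + _]eq_Rintegral do rewrite E.
    under [X in _ + X]eq_Rintegral do rewrite E.
    rewrite -!/(norm2 _ _).
    by case: (i) => /=; rewrite n0 ?addr0 ?add0r.
  - by move=> q; exact: Psq.
by move=> h; rewrite (emb_split h); apply: PD; apply: Pemb; exact: fld_L2.
Qed.

End Pre.
End Fields.

(** * The glued Hilbert space and its separability *)

Section Space.
Context {R : realType}.
Local Notation T1 := (measurableTypeR R).
Local Notation T2 := (T1 * T1)%type.
Local Notation lam := (@lebesgue2 R).
Variables (c : R) (c01 : 0 <= c < 1).
Implicit Types h k : @fld R.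

Let c0 : 0 <= c. Proof. by have /andP[] := c01. Qed.

Lemma fsqZ a h : fsq c (a *: h) = absq a * fsq c h.
Proof.
apply: complexI; rewrite -fip_fsq fipZl fipC fipZl rmorphM /= -fipC mulrA mulconjE.
by rewrite fip_fsq rmorphM.
Qed.

(** The parallelogram law, whose remaining term [fsq c (h - k)] is nonnegative. *)
Lemma fsqD_le h k : fsq c (h + k) <= 2 * fsq c h + 2 * fsq c k.
Proof.
have id : fip c (h + k) (h + k) + fip c (h - k) (h - k) = 2 * fip c h h + 2 * fip c k k.
  have sw x y : fip c x y = Num.conj (fip c y x) by exact: fipC.
  have Dr x y z : fip c x (y + z) = fip c x y + fip c x z.
    by rewrite sw fipDl rmorphD /= -!sw.
  have N1 x y : fip c (- x) y = - fip c x y by rewrite -scaleN1r fipZl mulN1r.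
  have N2 x y : fip c x (- y) = - fip c x y by rewrite sw N1 rmorphN /= -sw.
  rewrite !(fipDl, Dr, N1, N2); ring.
have -> : 2 * fsq c h + 2 * fsq c k = fsq c (h + k) + fsq c (h - k).
  by apply/complexI; rewrite !rmorphD !rmorphM /= -!fip_fsq id !rmorph_nat.
rewrite lerDl -ler0c -fip_fsq; exact: fip_ge0.
Qed.

Lemma fsq_ge0 h : 0 <= fsq c h.
Proof. by rewrite -ler0c -fip_fsq; exact: fip_ge0. Qed.

Definition rat_complex (z : rat * rat) : R[i] := ratr z.1 +i* ratr z.2.

Definition rat_comb (s : seq ((rat * rat) * (bool * (nat * int * int)))) : fld :=
  \sum_(t <- s) rat_complex t.1 *: sqv t.2.1 t.2.2.

Lemma rat_combZ z s : exists s', rat_comb s' = rat_complex z *: rat_comb s.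
Proof.
exists [seq ((z.1 * t.1.1 - z.2 * t.1.2, z.1 * t.1.2 + z.2 * t.1.1), t.2) | t <- s].
rewrite /rat_comb big_map scaler_sumr; apply: eq_bigr => t _ /=.
rewrite scalerA; congr (_ *: _).
apply: complex_ext; rewrite ?(ReM, ImM) /=.
  by rewrite rmorphB !rmorphM.
by rewrite rmorphD !rmorphM.
Qed.

Lemma rat_complex_dense (z : R[i]) (e : R) : 0 < e -> exists q, absq (z - rat_complex q) < e.
Proof.
move=> e0; have ap (x d : R) : 0 < d -> exists q : rat, (x - ratr q) ^+ 2 < d.
  move=> d0; have sd : 0 < Num.sqrt d by rewrite sqrtr_gt0.
  have lt : x - Num.sqrt d < x + Num.sqrt d by lra.
  have [q] := rat_in_itvoo lt.
  rewrite in_itv /= => /andP[h1 h2]; exists q.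
  rewrite -[ltRHS]sqr_sqrtr ?ltW// -real_normK ?num_real//.
  by rewrite ltr_sqr ?nnegrE ?sqrtr_ge0// ltr_norml; apply/andP; split; lra.
have e2 : 0 < e / 2 by rewrite divr_gt0.
have [q hq] := ap (Re z) _ e2; have [r hr] := ap (Im z) _ e2.
by exists (q, r); rewrite [ltRHS]splitr /absq !ReImE ltrD.
Qed.

Lemma fip_separable : exists2 D : set fld, countable D &
  forall h (e : R), 0 < e -> exists2 d, D d & Re (fip c (h - d) (h - d)) < e.
Proof.
exists (range rat_comb).
  apply: sub_countable (card_image_le _ _) _; exact: countableP.
suff dens h : forall e : R, 0 < e -> exists s, fsq c (h - rat_comb s) < e.
  move=> h e e0; have [s hs] := dens h e e0.
  by exists (rat_comb s); [exists s|rewrite fip_fsq].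
apply: (fld_ind c01 (P := fun h => forall e : R, 0 < e -> exists s, fsq c (h - rat_comb s) < e)).
- move=> {}h k hh hk e e0; have e4 : 0 < e / 4 by rewrite divr_gt0.
  have [s hs] := hh _ e4; have [t ht] := hk _ e4; exists (s ++ t).
  rewrite /rat_comb big_cat opprD addrACA.
  apply: le_lt_trans (fsqD_le _ _) _; move: hs ht; rewrite /rat_comb; lra.
- move=> a {}h hh e e0.
  (* The error splits into a multiple by [a] of the error of [rat_comb s], and [a - rat_complex q]
     times [rat_comb s]. The precision asked of [q] depends on the combination already chosen. *)
  have a1 : 0 < 4 * (absq a + 1) by rewrite mulr_gt0// ltr_wpDl ?absq_ge0.
  have [s hs] := hh _ (divr_gt0 e0 a1).
  have b1 : 0 < 4 * (fsq c (rat_comb s) + 1) by rewrite mulr_gt0// ltr_wpDl ?fsq_ge0.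
  have [q hq] := rat_complex_dense a (divr_gt0 e0 b1).
  have [s' es'] := rat_combZ q s; exists s'; rewrite es'.
  have -> : a *: h - rat_complex q *: rat_comb s =
      a *: (h - rat_comb s) + (a - rat_complex q) *: rat_comb s.
    by rewrite scalerBr scalerBl addrA subrK.
  apply: le_lt_trans (fsqD_le _ _) _; rewrite !fsqZ.
  move: hs hq; rewrite !ltr_pdivlMr// => hs hq.
  have := fsq_ge0 (h - rat_comb s); have := absq_ge0 (a - rat_complex q).
  have := absq_ge0 a; have := fsq_ge0 (rat_comb s); nra.
- move=> {}h hh e e0; have e4 : 0 < e / 4 by rewrite divr_gt0.
  have [k hk kh] := hh _ e4; have [s ks] := hk _ e4; exists s.
  rewrite -(subrK k h) -addrA; apply: le_lt_trans (fsqD_le _ _) _; lra.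
- move=> i q e e0; exists [:: ((1, 0), (i, q))].
  rewrite /rat_comb big_seq1 /= (_ : rat_complex _ = 1) ?scale1r ?subrr.
    by rewrite -[0](scale0r (0 : fld)) fsqZ absq0 mul0r.
  by apply: complex_ext; rewrite /= ?rmorph1 ?rmorph0.
Qed.

Definition pre : preHilbert R :=
  PreHilbert (@fipDl R c) (@fipZl R c) (@fipC R c) (fip_ge0 c01) (fip_complete c01) fip_separable.

Lemma pipE h k : @pip _ pre h k = fip c h k. Proof. by []. Qed.

Lemma nsqE h : @nsq _ pre h = fsq c h.
Proof. by rewrite /nsq pipE fip_fsq. Qed.

Definition Hc : hilbertType R := hilbert_of pre.

Definition cl (h : fld) : Hc := @cls R pre h.

Lemma cl_ind (P : Hc -> Prop) : (forall h, P (cl h)) -> forall F, P F.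
Proof. exact: (@cls_ind R pre). Qed.

Lemma clD h k : cl (h + k) = cl h + cl k. Proof. exact: (raddfD (@cls R pre)). Qed.
Lemma clB h k : cl (h - k) = cl h - cl k. Proof. exact: (raddfB (@cls R pre)). Qed.
Lemma clZ a h : cl (a *: h) = a *: cl h. Proof. exact: (linearZZ (@cls R pre)). Qed.

Lemma inner_cl h k : inner Hc (cl h) (cl k) = fip c h k.
Proof. exact: (@innerE R pre). Qed.

Lemma norm_cl h : `|cl h| = (Num.sqrt (fsq c h))%:C.
Proof. by rewrite -nsqE; exact: (@hilbert_norm_cls R pre). Qed.

Lemma norm_cl_lt h (e : R) : 0 < e -> fsq c h < e ^+ 2 -> `|cl h| < e%:C.
Proof.
move=> e0 he; rewrite norm_cl ltcR -[ltRHS](ger0_norm (ltW e0)) -sqrtr_sqr.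
by rewrite ltr_sqrt// exprn_gt0.
Qed.

(** Reduces identities and continuity statements on the whole space to vectors of squares. *)
Lemma Hc_total (P : Hc -> Prop) : closed_subspace P ->
  (forall i q, P (cl (sqv i q))) -> forall F, P F.
Proof.
move=> [PD PZ Plim] Psq; apply: cl_ind.
apply: (fld_ind c01 (P := fun h => P (cl h))) => //.
- by move=> h k Ph Pk; rewrite clD; exact: PD.
- by move=> a h Ph; rewrite clZ; exact: PZ.
- move=> h hh; apply: Plim => e e0.
  have [k Pk hk] := hh _ (exprn_gt0 2 e0).
  by exists (cl k) => //; rewrite -clB; exact: norm_cl_lt.
Qed.

End Space.

(** * Multiplication operators *)

Section Operators.
Context {R : realType}.
Local Notation T1 := (measurableTypeR R).
Local Notation T2 := (T1 * T1)%type.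
Local Notation lam := (@lebesgue2 R).
Implicit Types (h k : @fld R) (m : R * R -> R[i]).

Definition bmeas m : Prop :=
  cmeasurable (m : T2 -> R[i]) /\ exists C : R, forall x, absq (m x) <= C.

(** Zero for an inadmissible multiplier, so that [M m] is a bounded operator for every [m]. *)
Definition mulop m h : fld := if `[< bmeas m >] then mkfld (fun i x => m x * val h i x) else 0.

Lemma mulopE m h i x : bmeas m -> val (mulop m h) i x = m x * val h i x.
Proof.
move=> bm; rewrite /mulop asboolT// mkfldE// => [j|j y ny].
  by have [mm [C mC]] := bm; exact: L2Mb (fld_L2 h j).
by rewrite fld_out// mulr0.
Qed.

Lemma bmeasM m m' : bmeas m -> bmeas m' -> bmeas (fun x => m x * m' x).
Proof.
move=> [mm [C mC]] [mm' [C' mC']]; split; first exact: cmeasurableM.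
by exists (C * C') => x; rewrite absqM ler_pM ?absq_ge0.
Qed.

Lemma bmeasD m m' : bmeas m -> bmeas m' -> bmeas (fun x => m x + m' x).
Proof.
move=> [mm [C mC]] [mm' [C' mC']]; split; first exact: cmeasurableD.
exists (2 * C + 2 * C') => x; apply: le_trans (absqD_le _ _) _.
by have := mC x; have := mC' x; lra.
Qed.

Lemma bmeas_cst z : bmeas (fun=> z).
Proof. by split; [exact: cmeasurable_cst|exists (absq z)]. Qed.

Lemma bmeasZ a m : bmeas m -> bmeas (fun x => a * m x).
Proof. by move=> bm; apply: bmeasM => //; exact: bmeas_cst. Qed.

Lemma bmeas_conj m : bmeas m -> bmeas (fun x => Num.conj (m x)).
Proof.
move=> [mm [C mC]]; split; first exact: cmeasurable_conj.
by exists C => x; rewrite absq_conj.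
Qed.

Lemma bmeas_indic (A : set T2) : measurable A -> bmeas (cindic A).
Proof.
move=> mA; split; first exact: cmeasurable_indic.
by exists 1 => x; rewrite absq_cindic indicE; case: (_ \in _).
Qed.

Section Mul.
Variables (c : R) (c01 : 0 <= c < 1).
Let c0 : 0 <= c. Proof. by have /andP[] := c01. Qed.

Lemma mulop_linear m : linear (mulop m).
Proof.
move=> a h k; rewrite /mulop; have [bm|nbm] := asboolP (bmeas m); last first.
  by rewrite scaler0 addr0.
apply: fld_ext => i x; have E (l : fld) : val (mkfld (fun i x => m x * val l i x)) i x = m x * val l i x.
  by have := mulopE l i x bm; rewrite /mulop asboolT.
by rewrite fldDE fldZE !E fldDE fldZE mulrDr mulrCA.
Qed.

Lemma qformM (a : R[i]) u : qform c (fun i => a * u i) = absq a * qform c u.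
Proof. by rewrite /qform /absq !ReImE; ring. Qed.

(** A multiplier acts alike on both components, so it scales the Gram form pointwise, whatever [c]
    is. *)
Lemma fsq_mulop m C h : bmeas m -> (forall x, absq (m x) <= C) ->
  fsq c (mulop m h) <= C * fsq c h.
Proof.
move=> bm mC; rewrite /fsq -RintegralZl//; last exact: qform_integrable.
apply: le_Rintegral => //; first exact: qform_integrable.
  by apply: integrableZr; exact: qform_integrable.
move=> x _; rewrite (_ : (fun i => _) = fun i => m x * val h i x).
  by rewrite qformM ler_wpM2r// qform_ge0.
by apply/funext => i; rewrite mulopE.
Qed.

Lemma mulop_adjoint m h k : bmeas m ->
  fip c (mulop m h) k = fip c h (mulop (fun x => Num.conj (m x)) k).
Proof.
move=> bm; apply: eq_cint => x; rewrite /form !mulopE; try exact: bmeas_conj; try exact: bm.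
rewrite !rmorphM /= conjCK; ring.
Qed.

Lemma mulop_bounded m : exists C, bounded_with (p := pre c01) (q := pre c01) C (mulop m).
Proof.
have [bm|nbm] := pselect (bmeas m); last first.
  exists 0; split => // [|h]; first exact: mulop_linear.
  rewrite mul0r /mulop asboolF// nsqE.
  by rewrite -[X in fsq _ X](scale0r (0 : fld)) fsqZ absq0 mul0r.
have [_ [C mC]] := bm; exists C; split; first exact: mulop_linear.
  exact: le_trans (absq_ge0 _) (mC 0).
by move=> h; rewrite !nsqE; exact: fsq_mulop.
Qed.

Definition M m : Hc c01 -> Hc c01 := lift (mulop m : pre c01 -> pre c01).

Lemma M_cl m h : M m (cl c01 h) = cl c01 (mulop m h).
Proof. by have [C bC] := mulop_bounded m; exact: lift_cls bC. Qed.

Lemma M_bounded m : bounded_operator (M m).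
Proof. by have [C bC] := mulop_bounded m; exact: lift_bounded bC. Qed.

Lemma M_norm m (F : Hc c01) : bmeas m -> (forall x, absq (m x) <= 1) -> `|M m F| <= `|F|.
Proof.
move=> bm m1; elim/(@cl_ind R c c01): F => h; rewrite M_cl !norm_cl lecR ler_wsqrtr//.
by rewrite -[leRHS]mul1r; exact: fsq_mulop.
Qed.

Lemma M_adjoint m : bmeas m -> adjoint_operator (M m) (M (fun x => Num.conj (m x))).
Proof.
move=> bm; elim/(@cl_ind R c c01) => h; elim/(@cl_ind R c c01) => k.
by rewrite !M_cl !inner_cl mulop_adjoint.
Qed.

Lemma M_mul m m' F : bmeas m -> bmeas m' -> M (fun x => m x * m' x) F = M m (M m' F).
Proof.
move=> bm bm'; elim/(@cl_ind R c c01): F => h; rewrite !M_cl; congr cl.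
by apply: fld_ext => i x; rewrite !mulopE//; [rewrite mulrA|exact: bmeasM].
Qed.

Lemma M_add m m' F : bmeas m -> bmeas m' -> M (fun x => m x + m' x) F = M m F + M m' F.
Proof.
move=> bm bm'; elim/(@cl_ind R c c01): F => h; rewrite !M_cl -clD; congr cl.
by apply: fld_ext => i x; rewrite fldDE !mulopE//; [rewrite mulrDl|exact: bmeasD].
Qed.

Lemma M_scale a m F : bmeas m -> M (fun x => a * m x) F = a *: M m F.
Proof.
move=> bm; elim/(@cl_ind R c c01): F => h; rewrite !M_cl -clZ; congr cl.
by apply: fld_ext => i x; rewrite fldZE !mulopE//; [rewrite mulrA|exact: bmeasZ].
Qed.

Lemma M_one F : M (fun=> 1) F = F.
Proof.
elim/(@cl_ind R c c01): F => h; rewrite M_cl; congr cl.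
by apply: fld_ext => i x; rewrite mulopE; [rewrite mul1r|exact: bmeas_cst].
Qed.

End Mul.
End Operators.

(** * The Weyl pair *)

Section Characters.
Context {R : realType}.
Local Notation T1 := (measurableTypeR R).
Local Notation T2 := (T1 * T1)%type.
Local Notation lam := (@lebesgue2 R).
Implicit Types (chi psi a x : R * R).

Definition dotp chi x : R := chi.1 * x.1 + chi.2 * x.2.

Lemma characterE chi x : character chi x = cos (dotp chi x) +i* sin (dotp chi x).
Proof. by []. Qed.

Lemma cisD (s t : R) :
  cos (s + t) +i* sin (s + t) = (cos s +i* sin s) * (cos t +i* sin t) :> R[i].
Proof. by apply: complex_ext; rewrite ?(ReM, ImM) /= ?cosD ?sinD//; ring. Qed.

Lemma character_absq chi x : absq (character chi x) = 1.
Proof. by rewrite /absq /= cos2Dsin2. Qed.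

Lemma characterD chi psi x : character (chi + psi) x = character chi x * character psi x.
Proof.
rewrite !characterE (_ : dotp (chi + psi) x = dotp chi x + dotp psi x); last first.
  by rewrite /dotp /=; ring.
exact: cisD.
Qed.

Lemma character_arg chi x a : character chi (x + a) = character chi x * character chi a.
Proof.
rewrite !characterE (_ : dotp chi (x + a) = dotp chi x + dotp chi a); last first.
  by rewrite /dotp /=; ring.
exact: cisD.
Qed.

Lemma character0 x : character 0 x = 1.
Proof. by rewrite characterE /dotp /= !mul0r addr0 cos0 sin0. Qed.

Lemma character_opp chi x : character (- chi) x = Num.conj (character chi x).
Proof.
rewrite !characterE (_ : dotp (- chi) x = - dotp chi x); last by rewrite /dotp /=; ring.
by apply: complex_ext; rewrite ?Reconj ?Imconj /= ?cosN ?sinN.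
Qed.

Lemma measurable_dotp chi : measurable_fun setT (dotp chi : T2 -> T1).
Proof.
apply: measurable_funD; apply: measurable_funM; try exact: measurable_cst.
  exact: measurable_fst.
exact: measurable_snd.
Qed.

Lemma bmeas_character chi : bmeas (character chi).
Proof.
split; last by exists 1 => x; rewrite character_absq.
split.
  exact: (measurableT_comp (continuous_measurable_fun (@continuous_cos R)) (measurable_dotp chi)).
exact: (measurableT_comp (continuous_measurable_fun (@continuous_sin R)) (measurable_dotp chi)).
Qed.

Lemma absq_characterB chi psi x :
  absq (character chi x - character psi x) = 2 - 2 * cos (dotp (chi - psi) x).
Proof.
rewrite (_ : dotp (chi - psi) x = dotp chi x - dotp psi x); last by rewrite /dotp /=; ring.
rewrite cosB !characterE /absq /=.
have := cos2Dsin2 (dotp chi x); have := cos2Dsin2 (dotp psi x); nra.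
Qed.

Lemma dint_norm n k (t : R) : dint n k t -> `|t| <= (`|k| + 1)%:~R.
Proof.
move=> /andP[h1 h2]; have p1 : 1 <= 2 ^+ n :> R by rewrite exprn_ege1// ler1n.
apply: (@le_trans _ _ (`|t| * 2 ^+ n)); first by rewrite ler_peMr.
rewrite -[2 ^+ n]ger0_norm ?(le_trans _ p1)// -normrM ler_norml; apply/andP; split.
  by apply: le_trans h1; rewrite -intrN ler_int; lia.
by apply: le_trans (ltW h2) _; rewrite ler_int; lia.
Qed.

End Characters.

Section Weyl.
Context {R : realType}.
Local Notation T1 := (measurableTypeR R).
Local Notation T2 := (T1 * T1)%type.
Local Notation lam := (@lebesgue2 R).
Implicit Types (chi psi a b x : R * R) (h k : @fld R).

Lemma norm2_zero (f : T2 -> R[i]) : (forall x, f x = 0) -> norm2 lam f = 0.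
Proof.
move=> f0; rewrite /norm2; under eq_Rintegral do rewrite f0 absq0.
by rewrite Rintegral_cst// mul0r.
Qed.

Lemma crdB i x a : crd i (x - a) = crd i x - crd i a.
Proof. by case: i. Qed.

Lemma quadrant_crd a : quadrant a <-> forall i, 0 <= crd i a.
Proof. by split=> [[a1 a2] []//|h]; split; [exact: (h true)|exact: (h false)]. Qed.

Lemma shift2E a x : shift2 a x = x + a. Proof. by []. Qed.

(** For [a] in the quadrant the half planes are stable under adding [a], so the translate is again a
    field. *)
Definition shop a h : fld := mkfld (fun i x => val h i (shift2 (- a) x)).

Lemma shopE a h i x : quadrant a -> val (shop a h) i x = val h i (x - a).
Proof.
move=> /quadrant_crd qa; rewrite /shop mkfldE// => [j|j y ny].
  exact: (L2_shift _ (fld_L2 h j)).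
apply: fld_out; rewrite shift2E /reg /= crdB => h1; apply: ny.
by rewrite /reg /=; have := qa j; lra.
Qed.

Lemma shop_linear a : quadrant a -> linear (shop a).
Proof.
move=> qa z h k; apply: fld_ext => i x.
by rewrite fldDE fldZE !shopE// fldDE fldZE.
Qed.

Section Angle.
Variables (c : R) (c01 : 0 <= c < 1).
Let c0 : 0 <= c. Proof. by have /andP[] := c01. Qed.

Lemma form_cmeasurable (f g : bool -> T2 -> R[i]) :
  (forall i, cmeasurable (f i)) -> (forall i, cmeasurable (g i)) ->
  cmeasurable (fun x => form c (fun i => f i x) (fun i => g i x)).
Proof.
move=> mf mg.
have mm i j : cmeasurable (fun x => f i x * Num.conj (g j x)).
  by apply: cmeasurableM; [exact: mf|exact: (cmeasurable_conj (mg j))].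
apply: cmeasurableD; first exact: cmeasurableD.
by apply: cmeasurableM; [exact: cmeasurable_cst|exact: cmeasurableD].
Qed.

Lemma fld_cmeasurable h i : cmeasurable (val h i : T2 -> R[i]).
Proof. by have [] := fld_L2 h i. Qed.

Lemma fip_shop a h k : quadrant a -> fip c (shop a h) (shop a k) = fip c h k.
Proof.
move=> qa; rewrite /fip.
have mf : cmeasurable (fun x : T2 => form c (fun i => val h i x) (fun i => val k i x)).
  by apply: form_cmeasurable => i; exact: fld_cmeasurable.
rewrite -(cint_shift (- a) mf); apply: eq_cint => x.
by rewrite /form !shopE.
Qed.

Lemma fsq_shop a h : quadrant a -> fsq c (shop a h) = fsq c h.
Proof. by move=> qa; apply/complexI; rewrite -!fip_fsq fip_shop. Qed.

Local Notation H := (Hc c01).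
Local Notation cl := (cl c01).

Definition U chi : H -> H := M (character chi).

Definition V a : H -> H := lift (shop a : pre c01 -> pre c01).

Lemma shop_bounded a : quadrant a ->
  bounded_with (p := pre c01) (q := pre c01) 1 (shop a).
Proof.
by move=> qa; split => //; [exact: shop_linear|move=> h; rewrite mul1r !nsqE fsq_shop].
Qed.

Lemma V_cl a h : quadrant a -> V a (cl h) = cl (shop a h).
Proof. by move=> qa; exact: (lift_cls _ (shop_bounded qa)). Qed.

Lemma V_bounded a : quadrant a -> bounded_operator (V a).
Proof. by move=> qa; exact: (lift_bounded (shop_bounded qa)). Qed.

Lemma V_isometric a (F : H) : quadrant a -> `|V a F| = `|F|.
Proof. by move=> qa; elim/(@cl_ind R c c01): F => h; rewrite (V_cl _ qa) !norm_cl (fsq_shop _ qa). Qed.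

Lemma V_inner a (F G : H) : quadrant a -> inner H (V a F) (V a G) = inner H F G.
Proof.
move=> qa; elim/(@cl_ind R c c01): F => h; elim/(@cl_ind R c c01): G => k.
by rewrite !(V_cl _ qa) !inner_cl (fip_shop _ _ qa).
Qed.

Lemma quadrant0 : quadrant (0 : R * R). Proof. by split. Qed.

Lemma quadrantD a b : quadrant a -> quadrant b -> quadrant (a + b).
Proof. by move=> [a1 a2] [b1 b2]; split; exact: addr_ge0. Qed.

Lemma V_zero : V 0 = id.
Proof.
apply/funext; elim/(@cl_ind R c c01) => h; rewrite (V_cl _ quadrant0).
congr (cl _); apply: fld_ext => i x; rewrite shopE ?subr0//; exact: quadrant0.
Qed.

Lemma V_add a b : quadrant a -> quadrant b -> V (a + b) = V a \o V b.
Proof.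
move=> qa qb; apply/funext; elim/(@cl_ind R c c01) => h.
rewrite [RHS]/comp (V_cl _ qb) (V_cl _ qa) (V_cl _ (quadrantD qa qb)).
congr (cl _); apply: fld_ext => i x; rewrite !shopE//; last exact: quadrantD.
by rewrite opprD addrA.
Qed.

(* The range of V_a V_a^* at x + a is projected back on the fibre at x *)
Definition coshop a h : fld := mkfld (fun i x => cindic (reg i) x *
  (val h i (shift2 a x) + c%:C * (cindic (~` reg (~~ i)) x * val h (~~ i) (shift2 a x)))).

Lemma coshopE a h i x : val (coshop a h) i x = cindic (reg i) x *
  (val h i (x + a) + c%:C * (cindic (~` reg (~~ i)) x * val h (~~ i) (x + a))).
Proof.
rewrite /coshop mkfldE// => [j|j y ny]; last by rewrite /cindic indicE memNset// mul0r.
apply: L2_cut; first exact: measurable_reg.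
apply: L2D; first exact: (L2_shift _ (fld_L2 h j)).
apply: L2Z; apply: L2_cut; last exact: (L2_shift _ (fld_L2 h _)).
by apply: measurableC; exact: measurable_reg.
Qed.

Lemma coshop_linear a : linear (coshop a).
Proof.
move=> z h k; apply: fld_ext => i x.
rewrite fldDE fldZE !coshopE !fldDE !fldZE; ring.
Qed.

Lemma shop_coshop a h k : quadrant a -> fip c (shop a h) k = fip c h (coshop a k).
Proof.
move=> qa; rewrite /fip.
have mf : cmeasurable (fun x : T2 => form c (fun i => val (shop a h) i x) (fun i => val k i x)).
  by apply: form_cmeasurable => i; exact: fld_cmeasurable.
rewrite -(cint_shift a mf); apply: eq_cint => x.
rewrite /form !shopE// !shift2E addrK !coshopE /cindic !indicE !in_setC /=.
(* Over both half planes the adjoint is backward translation. Over exactly one, [h] has a single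
   component while the translate of [k] may have two, and the Gram form weights the second by
   [c]. *)
have [rt|nt] := pselect (reg true x); have [rf|nf] := pselect (reg false x).
- rewrite !mem_set//= !mul0r !mulr0 !addr0 !mul1r; ring.
- rewrite (mem_set rt) (memNset nf) /= !(fld_out _ nf) !(mul0r, mulr0, addr0, add0r, mul1r, rmorphD, rmorphM, rmorph0) /= !conj_real !mul1r; ring.
- rewrite (mem_set rf) (memNset nt) /= !(fld_out _ nt) !(mul0r, mulr0, addr0, add0r, mul1r, rmorphD, rmorphM, rmorph0) /= !conj_real !mul1r; ring.
- by rewrite (memNset nt) (memNset nf) !(fld_out _ nt) !(fld_out _ nf) !mul0r !addr0 mulr0.
Qed.

Definition Vadj a : H -> H := lift (coshop a : pre c01 -> pre c01).

Lemma coshop_bounded a : quadrant a ->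
  bounded_with (p := pre c01) (q := pre c01) 1 (coshop a).
Proof.
move=> qa; apply: (isometry_adjoint_bounded (T := shop a : pre c01 -> pre c01)).
- by move=> h; rewrite !nsqE fsq_shop.
- exact: coshop_linear.
- by move=> h k; exact: shop_coshop.
Qed.

Lemma Vadj_cl a h : quadrant a -> Vadj a (cl h) = cl (coshop a h).
Proof. by move=> qa; exact: (lift_cls _ (coshop_bounded qa)). Qed.

Lemma Vadj_adjoint a : quadrant a -> adjoint_operator (V a) (Vadj a).
Proof.
move=> qa; elim/(@cl_ind R c c01) => h; elim/(@cl_ind R c c01) => k.
by rewrite (V_cl _ qa) (Vadj_cl _ qa) !inner_cl (shop_coshop _ _ qa).
Qed.

Lemma U_add chi psi : U (chi + psi) = U chi \o U psi.
Proof.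
apply/funext => F /=; rewrite /U -M_mul; try exact: bmeas_character.
by congr M; apply/funext => x; exact: characterD.
Qed.

Lemma U_zero : U 0 = id.
Proof.
apply/funext => F; rewrite /U -[RHS](M_one F).
by congr M; apply/funext => x; exact: character0.
Qed.

Lemma U_adjoint chi : adjoint_operator (U chi) (U (- chi)).
Proof.
rewrite /U (_ : character (- chi) = fun x => Num.conj (character chi x)).
  exact: (M_adjoint (bmeas_character chi)).
by apply/funext => x; exact: character_opp.
Qed.

Lemma U_unitary chi : unitary (U chi).
Proof.
exists (U (- chi)); split; [exact: M_bounded|exact: M_bounded|exact: U_adjoint| |].
  by rewrite -U_add addNr U_zero.
by rewrite -U_add subrr U_zero.
Qed.

Lemma weyl_relation chi a (F : H) : quadrant a ->
  U chi (V a F) = character chi a *: V a (U chi F).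
Proof.
move=> qa; elim/(@cl_ind R c c01): F => h.
rewrite /U !(M_cl, V_cl _ qa) -clZ; congr (cl _); apply: fld_ext => i x.
have bc := bmeas_character chi.
rewrite fldZE mulopE// !shopE// mulopE// mulrA; congr (_ * _).
by rewrite mulrC -character_arg subrK.
Qed.

Lemma fsq_single i h : (forall x, val h (~~ i) x = 0) ->
  fsq c h <= (1 + c) * norm2 lam (val h i).
Proof.
move=> h0; apply: le_trans (fsq_le c01 h) _.
have n0 := norm2_zero h0.
by case: i h0 n0 => /= h0 ->; rewrite ?addr0 ?add0r.
Qed.

Lemma val_sqv i q j x : val (sqv i q) j x =
  if j == i then cindic (reg i) x * cindic (dsq q) x else 0.
Proof. by rewrite embE//; exact: L2_cdsq. Qed.

End Angle.
End Weyl.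

(** * Strong continuity *)

Section Continuity.
Context {R : realType}.
Local Notation T1 := (measurableTypeR R).
Local Notation T2 := (T1 * T1)%type.
Local Notation lam := (@lebesgue2 R).
Implicit Types (chi psi a b x : R * R) (h k : @fld R).

Lemma cos_near0 (e : R) : 0 < e ->
  exists2 d : R, 0 < d & forall t : R, `|t| < d -> 2 - 2 * cos t < e.
Proof.
move=> e0; have e2 : 0 < e / 2 by rewrite divr_gt0.
have /cvgrPdist_lt/(_ _ e2) := @continuous_cos R 0.
rewrite cos0 => /nbhs_ballP[d /= d0 hd]; exists d => // t td.
have := hd t; rewrite /ball /= sub0r normrN => /(_ td).
by rewrite ltr_norml => /andP[_]; lra.
Qed.

Lemma norm2_le_on (f : T2 -> R[i]) (A : set T2) (e : R) :
  L2 lam f -> measurable A -> (lam A < +oo)%E ->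
  (forall x, absq (f x) <= e * \1_A x) ->
  norm2 lam f <= e * fine (lam A).
Proof.
move=> lf mA fA fe; have iA : lam.-integrable setT (fun x => (\1_A x)%:E).
  have [_] := L2_indic mA fA; apply: eq_integrable => // x _.
  by rewrite -/(cindic A x) absq_cindic.
have -> : fine (lam A) = \int[lam]_(x in setT) \1_A x.
  by rewrite /Rintegral integral_indic// setIT.
rewrite -RintegralZl//; apply: le_Rintegral => //.
- by case: lf.
- exact: integrableZr.
Qed.

Lemma dsq_fin q : (lam (dsq q) < +oo)%E. Proof. by rewrite lebesgue2_dsq ltry. Qed.

Lemma lam_dsq_le1 q : fine (lam (dsq q)) <= 1.
Proof. by rewrite lebesgue2_dsq /= invf_le1 ?exprn_gt0// exprn_ege1// ler1n. Qed.

(** The axes lie on the dyadic grid of every level, so no square is cut by the boundary of a half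
    plane. *)
Lemma dsq_reg i q : (dsq q : set (R * R)) `<=` reg i \/ dsq q `&` reg i = (set0 : set (R * R)).
Proof.
have dint0 n (k : int) : dint n k `<=` [set t : R | 0 <= t] \/ dint n k `&` [set t : R | 0 <= t] = set0.
  have p0 : 0 < 2 ^+ n :> R by rewrite exprn_gt0.
  have [k0|k0] := leP 0%R k; [left|right].
    move=> t /= /andP[h1 _]; rewrite -(pmulr_lge0 _ p0); apply: le_trans h1.
    by rewrite ler0z.
  apply/seteqP; split=> // t [/andP[_ h2]] /=; rewrite -(pmulr_lge0 _ p0) => h3.
  have := le_lt_trans h3 h2; rewrite ltr0z; lia.
case: q => [[n k] l]; case: i.
  have [h|h] := dint0 n k; [left|right]; first by move=> x [/h].
  apply/seteqP; split=> // x [[x1 x2] rx].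
  by have : (dint n k `&` [set t | 0 <= t]) x.1 by []; rewrite h.
have [h|h] := dint0 n l; [left|right]; first by move=> x [_ /h].
apply/seteqP; split=> // x [[x1 x2] rx].
by have : (dint n l `&` [set t | 0 <= t]) x.2 by []; rewrite h.
Qed.

Lemma sqv_in i q : dsq q `<=` (reg i : set (R * R)) ->
  forall j x, val (@sqv R i q) j x = if j == i then cindic (dsq q) x else 0.
Proof.
move=> qi j x; rewrite val_sqv; case: eqVneq => // _.
have [qx|nqx] := pselect (dsq q x); last by rewrite {2 3}/cindic indicE memNset// mulr0.
by rewrite {1}/cindic indicE mem_set ?mul1r//; exact: qi.
Qed.

Lemma sqv_out i q : dsq q `&` reg i = (set0 : set (R * R)) -> @sqv R i q = 0.
Proof.
move=> qi; apply: fld_ext => j x; rewrite val_sqv; case: eqVneq => // _.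
have [qx|nqx] := pselect (dsq q x); last by rewrite {2}/cindic indicE memNset// mulr0.
rewrite {1}/cindic indicE memNset ?mul0r// => rx.
by have : (dsq q `&` reg i) x by []; rewrite qi.
Qed.

(** The overlap has length [2^-n - |s - t|] when this is positive, and is empty otherwise. *)
Lemma lebesgue_dint_cap n (k : int) (s t : R) :
  2 ^- n - `|s - t| <=
    fine (lebesgue_measure ([set u : T1 | dint n k (u - s)] `&` [set u : T1 | dint n k (u - t)]))
    <= 2 ^- n.
Proof.
have p0 : 0 < 2 ^+ n :> R by rewrite exprn_gt0.
pose u0 : R := k%:~R / 2 ^+ n; pose v0 : R := (k + 1)%:~R / 2 ^+ n.
have -> : [set u : T1 | dint n k (u - s)] `&` [set u : T1 | dint n k (u - t)] =
    `[Num.max (u0 + s) (u0 + t), Num.min (v0 + s) (v0 + t)[%classic.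
  apply/seteqP; rewrite dint_itv -/u0 -/v0.
  split=> x /=; rewrite !in_itv /= ge_max lt_min.
    by move=> [/andP[h1 h2] /andP[h3 h4]]; rewrite -!lerBrDr -!ltrBlDr h1 h2 h3 h4.
  by rewrite -!lerBrDr -!ltrBlDr => /andP[/andP[-> ->] /andP[-> ->]].
have uv : v0 - u0 = 2 ^- n by rewrite /v0 /u0 -mulrBl intrD addrAC subrr add0r mul1r.
have w0 : 0 < 2 ^- n :> R by rewrite invr_gt0.
rewrite lebesgue_measure_itv /= lte_fin.
have dE : Num.min (v0 + s) (v0 + t) - Num.max (u0 + s) (u0 + t) = 2 ^- n - `|s - t|.
  have [st|st] := leP s t.
    rewrite min_l ?max_r ?lerD2l// ler0_norm ?subr_le0// -uv; ring.
  rewrite min_r ?max_l ?lerD2l ?ltW// gtr0_norm ?subr_gt0// -uv; ring.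
case: ltP => [h|h] /=.
  by rewrite dE lexx gerBl normr_ge0.
by rewrite (ltW w0) andbT -dE subr_le0.
Qed.

Lemma absq_indicB (A B : set T2) x :
  absq (cindic A x - cindic B x : R[i]) = \1_A x + \1_B x - 2 * \1_(A `&` B) x.
Proof.
rewrite /cindic -rmorphB absq_real !indicE in_setI.
by case: (x \in A); case: (x \in B) => /=; ring.
Qed.

Lemma norm2_shift_dsq q a b :
  norm2 lam (fun x => cindic (dsq q) (x - a) - cindic (dsq q) (x - b)) <=
    2 * (`|a.1 - b.1| + `|a.2 - b.2|).
Proof.
case: q => [[n k] l].
pose I (j : int) (s : R) : set T1 := [set u | dint n j (u - s)].
pose S z : set T2 := I k z.1 `*` I l z.2.
have SE z x : cindic (dsq (n, k, l)) (x - z) = cindic (S z) x :> R[i].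
  by rewrite /cindic !indicE.
have mI j s : measurable (I j s).
  have ms : measurable_fun setT ((fun u => u - s) : T1 -> T1).
    by apply: measurable_funB => //; exact: measurable_cst.
  by have := ms measurableT _ (@measurable_dint R n j); rewrite setTI.
have mS z : measurable (S z) by exact: measurableX.
have II j s : lebesgue_measure (I j s) = (2 ^- n)%:E.
  by rewrite -(lebesgue_dint n j) -(lebesgue_measure_shift (- s) (@measurable_dint R n j)).
have lS z : lam (S z) = (2 ^- n * 2 ^- n)%:E.
  transitivity (lebesgue_measure (I k z.1) * lebesgue_measure (I l z.2))%E.
    by rewrite /lebesgue2 /= product_measure1E.
  by rewrite !II EFinM.
pose J (j : int) (s t : R) := I j s `&` I j t.
have SS : S a `&` S b = J k a.1 b.1 `*` J l a.2 b.2.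
  by apply/seteqP; split=> x /=; [move=> [[h1 h2] [h3 h4]]|move=> [[h1 h2] [h3 h4]]].
have mJ j s t : measurable (J j s t) by exact: measurableI.
have Jfin j s t : (lebesgue_measure (J j s t) = (fine (lebesgue_measure (J j s t)))%:E)%E.
  rewrite fineK// ge0_fin_numE//; apply: (@le_lt_trans _ _ (lebesgue_measure (I j s))).
    by apply: le_measure; rewrite ?inE//; exact: subIsetl.
  by rewrite II ltry.
have lSS : lam (S a `&` S b) =
    (fine (lebesgue_measure (J k a.1 b.1)) * fine (lebesgue_measure (J l a.2 b.2)))%:E.
  rewrite SS; transitivity (lebesgue_measure (J k a.1 b.1) * lebesgue_measure (J l a.2 b.2))%E.
    by rewrite /lebesgue2 /= product_measure1E.
  by rewrite Jfin (Jfin l) EFinM.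
have iI (A : set T2) : measurable A -> (lam A < +oo)%E ->
    lam.-integrable setT (fun x => (\1_A x)%:E).
  move=> mA fA; have [_] := L2_indic mA fA; apply: eq_integrable => // x _.
  by rewrite -/(cindic A x) absq_cindic.
have rI (A : set T2) : measurable A -> \int[lam]_(x in setT) \1_A x = fine (lam A).
  by move=> mA; rewrite /Rintegral integral_indic// setIT.
have mSS : measurable (S a `&` S b) by exact: measurableI.
have iSa : lam.-integrable setT (fun x => (\1_(S a) x)%:E) by apply: iI => //; rewrite lS ltry.
have iSb : lam.-integrable setT (fun x => (\1_(S b) x)%:E) by apply: iI => //; rewrite lS ltry.
have iSS : lam.-integrable setT (fun x => (\1_(S a `&` S b) x)%:E).
  by apply: iI => //; rewrite lSS ltry.
(* The integrand is the indicator of the symmetric difference of two translates of equal area. *)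
have -> : norm2 lam (fun x => cindic (dsq (n, k, l)) (x - a) - cindic (dsq (n, k, l)) (x - b)) =
    2 * (2 ^- n * 2 ^- n - fine (lam (S a `&` S b))).
  rewrite /norm2; under eq_Rintegral do rewrite !SE absq_indicB.
  rewrite RintegralB//; [|exact: integrableDr|exact: integrableZr].
  rewrite RintegralD// RintegralZl// !rI// !lS /=; ring.
rewrite lSS /= ler_pM2l//.
have /andP[] := lebesgue_dint_cap n k a.1 b.1; have /andP[] := lebesgue_dint_cap n l a.2 b.2.
rewrite -![fine _]/(fine (lebesgue_measure (J _ _ _))).
set p := fine _; set r := fine _; set w := 2 ^- n => h1 h2 h3 h4.
have w0 : 0 < w by rewrite invr_gt0 exprn_gt0.
have w1 : w <= 1 by rewrite invf_le1 ?exprn_gt0// exprn_ege1// ler1n.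
have := normr_ge0 (a.1 - b.1); have := normr_ge0 (a.2 - b.2).
have p0 : 0 <= p by rewrite fine_ge0.
have r0 : 0 <= r by rewrite fine_ge0.
(* [w^2 - p r = w (w - r) + r (w - p)], where [r <= w <= 1] and each difference is at most a
   displacement. *)
nra.
Qed.

Section Angle.
Variables (c : R) (c01 : 0 <= c < 1).
Let c0 : 0 <= c. Proof. by have /andP[] := c01. Qed.
Local Notation H := (Hc c01).
Local Notation cl := (cl c01).
Local Notation U := (@U R c c01).
Local Notation V := (@V R c c01).

Lemma normB_cl_lt h k (e : R) : 0 < e -> fsq c (h - k) < e ^+ 2 -> `|cl h - cl k| < e%:C.
Proof. by move=> e0; rewrite -clB; exact: norm_cl_lt. Qed.

Lemma U_continuous_sqv i q : continuous (fun chi => U chi (cl (sqv i q))).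
Proof.
move=> chi; apply/cvgrPdist_lt => _ /gt0_complexE[e e0 ->].
have c1 : 0 < 1 + c by rewrite ltr_wpDr.
have e' : 0 < e ^+ 2 / (2 * (1 + c)) by rewrite divr_gt0 ?exprn_gt0// mulr_gt0.
have [d d0 hd] := cos_near0 e'.
(* The two summands bound [|x.1|] and [|x.2|] on the square, so characters whose parameters differ
   by less than [d / B] are uniformly close there. *)
pose B : R := (`|q.1.2| + 1)%:~R + (`|q.2| + 1)%:~R.
have B0 : 0 < B by rewrite /B -intrD ltr0z; lia.
have dB : 0 < d / B by rewrite divr_gt0.
exists (ball chi.1 (d / B), ball chi.2 (d / B)).
  by split; exact: nbhsx_ballx.
move=> psi [/= b1 b2]; rewrite /U !M_cl; apply: normB_cl_lt => //.
set f := mulop _ _ - _.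
have fE j x : val f j x = (character chi x - character psi x) * val (sqv i q) j x.
  by rewrite /f fldBE !mulopE ?mulrBl//; exact: bmeas_character.
apply: le_lt_trans (fsq_single c01 (i := i) _) _.
  move=> x; rewrite fE val_sqv; case: eqVneq => [|_]; last by rewrite mulr0.
  by case: (i).
apply: le_lt_trans (_ : (1 + c) * (e ^+ 2 / (2 * (1 + c))) < _).
  rewrite (ler_pM2l c1); apply: le_trans (@norm2_le_on _ (dsq q) (e ^+ 2 / (2 * (1 + c))) _ _ _ _) _.
  - exact: fld_L2.
  - exact: measurable_dsq.
  - exact: dsq_fin.
  - move=> x; rewrite fE absqM val_sqv eqxx absqM !absq_cindic absq_characterB.
    have [qx|nqx] := pselect (dsq q x); last by rewrite !indicE (memNset nqx) !mulr0.
    rewrite !indicE (mem_set qx) !mulr1.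
    have cle : 2 - 2 * cos (dotp (chi - psi) x) <= e ^+ 2 / (2 * (1 + c)).
      apply/ltW/hd; rewrite /dotp.
      have [/dint_norm x1 /dint_norm x2] := qx.
      apply: le_lt_trans (ler_normD _ _) _; rewrite !normrM.
      have small (s t : R) (k : int) : `|s| < d / B -> `|t| <= (`|k| + 1)%:~R ->
          `|s| * `|t| < d / B * (`|k| + 1)%:~R.
        move=> hs ht; apply: le_lt_trans (ler_wpM2l (normr_ge0 _) ht) _.
        by rewrite ltr_pM2r// ltr0z; lia.
      have dE : d = d / B * (`|q.1.2| + 1)%:~R + d / B * (`|q.2| + 1)%:~R.
        by rewrite -mulrDr divfK// lt0r_neq0.
      by rewrite [ltRHS]dE; apply: ltrD; apply: small.
    have := absq_ge0 (character chi x - character psi x); rewrite absq_characterB => h.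
    by case: (_ \in _); rewrite ?mulr1 ?mulr0// ltW.
  by rewrite ger_pMr// lam_dsq_le1.
rewrite (_ : (1 + c) * _ = e ^+ 2 / 2); last by field; rewrite gt_eqF.
by rewrite ltr_pdivrMr// ltr_pMr ?exprn_gt0// ltr1n.
Qed.


Lemma U_continuous F : continuous (fun chi => U chi F).
Proof.
apply/continuous_subspace_setT; move: F; apply: Hc_total; last first.
  by move=> i q; apply: continuous_subspaceT; exact: U_continuous_sqv.
apply: closed_subspace_cvg => chi _; first exact: M_bounded.
move=> x; apply: M_norm; first exact: bmeas_character.
by move=> y; rewrite character_absq.
Qed.

Lemma V_continuous_sqv i q :
  {within quadrant, continuous (fun a => V a (cl (sqv i q)))}.
Proof.
apply/subspace_continuousP => a qa; apply/cvgrPdist_lt => _ /gt0_complexE[e e0 ->].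
have [qi|qo] := dsq_reg i q; last first.
  rewrite /from_subspace (sqv_out qo); near=> b.
  have qb : quadrant b by near: b; exact: withinT.
  have cl0 : cl 0 = 0 by rewrite -(scale0r (0 : fld)) clZ scale0r.
  rewrite cl0 (bounded_op0 (V_bounded c01 qa)) (bounded_op0 (V_bounded c01 qb)).
  by rewrite subrr normr0 ltcR.
have c1 : 0 < 1 + c by rewrite ltr_wpDr.
(* Chosen so that [(1 + c) * (2 * (d + d)) = e^2 / 2]. *)
pose d := e ^+ 2 / (8 * (1 + c)).
have d0 : 0 < d by rewrite divr_gt0 ?exprn_gt0// mulr_gt0.
near=> b.
have qb : quadrant b by near: b; exact: withinT.
have [b1 b2] : ball a.1 d b.1 /\ ball a.2 d b.2.
  near: b; apply: cvg_within; exists (ball a.1 d, ball a.2 d).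
    by split; exact: nbhsx_ballx.
  by move=> y [].
rewrite /from_subspace !V_cl//; apply: normB_cl_lt => //.
set f := shop _ _ - _.
have fE j x : val f j x = if j == i then cindic (dsq q) (x - a) - cindic (dsq q) (x - b) else 0.
  by rewrite /f fldBE !shopE// !sqv_in//; case: eqVneq => _; rewrite ?subrr.
apply: le_lt_trans (fsq_single c01 (i := i) _) _.
  by move=> x; rewrite fE; case: (i).
apply: le_lt_trans (_ : (1 + c) * (2 * (d + d)) < _); last first.
  rewrite /d (_ : (1 + c) * _ = e ^+ 2 / 2); last by field; rewrite gt_eqF.
  by rewrite ltr_pdivrMr// ltr_pMr ?exprn_gt0// ltr1n.
rewrite (ler_pM2l c1); apply: le_trans (_ : 2 * (`|a.1 - b.1| + `|a.2 - b.2|) <= _).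
  rewrite (_ : norm2 _ _ = norm2 lam (fun x => cindic (dsq q) (x - a) - cindic (dsq q) (x - b))).
    exact: norm2_shift_dsq.
  by congr norm2; apply/funext => x; rewrite fE eqxx.
by rewrite ler_pM2l// lerD// ltW.
Unshelve. all: by end_near. Qed.

Lemma V_continuous F : {within quadrant, continuous (fun a => V a F)}.
Proof.
move: F; apply: Hc_total; last exact: V_continuous_sqv.
apply: closed_subspace_cvg => a qa; first exact: V_bounded.
by move=> x; rewrite V_isometric.
Qed.

Lemma weyl_pair : weak_weyl_pair U V.
Proof.
split.
- split; [exact: U_unitary|exact: U_zero|exact: U_add|exact: U_continuous].
- split; [|exact: V_zero|exact: V_add|exact: V_continuous].
  by move=> a qa; split; [exact: V_bounded|move=> x; exact: V_isometric].
- by move=> chi a x qa; exact: weyl_relation.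
Qed.

End Angle.
End Continuity.

(** * Intertwiners *)

Section SmoothStep.
Context {R : realType}.
Implicit Types (s t y u : R) (n k : nat).

Lemma bernoulli_ge u n : 0 <= u -> 1 + n%:R * u <= (1 + u) ^+ n.
Proof.
move=> u0; elim: n => [|n IH]; first by rewrite mul0r addr0 expr0.
have n0 : 0 <= n%:R :> R by [].
rewrite exprS; apply: le_trans (_ : (1 + u) * (1 + n%:R * u) <= _).
  by rewrite -natr1; nra.
by rewrite ler_wpM2l ?addr_ge0.
Qed.

(** Bernoulli's inequality together with [(1 - u)^n (1 + u)^n = (1 - u^2)^n <= 1]. *)
Lemma one_sub_pow u n : 0 <= u <= 1 -> (1 - u) ^+ n * (1 + n%:R * u) <= 1.
Proof.
move=> /andP[u0 u1]; apply: le_trans (_ : (1 - u) ^+ n * (1 + u) ^+ n <= _).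
  by rewrite ler_wpM2l ?bernoulli_ge// exprn_ge0// subr_ge0.
by rewrite -exprMn exprn_ile1//; nra.
Qed.

Lemma one_sub_pow_ge u n : 0 <= u <= 1 -> 1 - n%:R * u <= (1 - u) ^+ n.
Proof.
move=> /andP[u0 u1]; elim: n => [|n IH]; first by rewrite mul0r subr0 expr0.
rewrite exprS; have n0 : 0 <= n%:R :> R by [].
apply: le_trans (_ : (1 - u) * (1 - n%:R * u) <= _); first by rewrite -natr1; nra.
by rewrite ler_wpM2l// subr_ge0.
Qed.

(* Brosowski-Deutsch: with s > 0 this tends to 1, with s < 0 to 0, at a rate
   governed by n |s| *)
Definition bump n (s : R) : R := (1 - ((1 - s) / 2) ^+ n) ^+ (2 ^ n)%N.

Lemma half_itv s : -1 <= s <= 1 -> 0 <= (1 - s) / 2 <= 1.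
Proof. by move=> /andP[h1 h2]; apply/andP; split; lra. Qed.

Lemma bump01 n s : -1 <= s <= 1 -> 0 <= bump n s <= 1.
Proof.
move=> /half_itv/andP[h1 h2]; have h3 : 0 <= ((1 - s) / 2) ^+ n <= 1.
  by rewrite exprn_ge0// exprn_ile1.
move: h3 => /andP[h3 h4].
by rewrite exprn_ge0 ?subr_ge0//= exprn_ile1 ?subr_ge0// gerBl.
Qed.

(** With [u = ((1 - s) / 2)^n], Bernoulli's inequality for the outer power gives
    [1 - bump n s <= 2^n u = (1 - s)^n], to which [one_sub_pow] applies. *)
Lemma bump_pos n s : 0 <= s <= 1 -> (1 - bump n s) * (1 + n%:R * s) <= 1.
Proof.
move=> s01; have /andP[s0 s1] := s01.
have s11 : -1 <= s <= 1 by apply/andP; split; lra.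
have /half_itv/andP[h1 h2] := s11.
have h3 : 0 <= ((1 - s) / 2) ^+ n <= 1 by rewrite exprn_ge0// exprn_ile1.
have := one_sub_pow_ge (2 ^ n)%N h3; rewrite -/(bump n s) natrX -exprMn.
rewrite (_ : 2 * ((1 - s) / 2) = 1 - s); last by field.
move=> h4; apply: le_trans (one_sub_pow n s01).
rewrite ler_wpM2r ?addr_ge0 ?mulr_ge0//; lra.
Qed.

(** With the same [u], now [2^n u = (1 - s)^n >= 1 + n |s|], while
    [(1 - u)^(2^n) (1 + 2^n u) <= 1]. *)
Lemma bump_neg n s : -1 <= s <= 0 -> bump n s * (1 + n%:R * - s) <= 1.
Proof.
move=> /andP[s1 s0]; have s11 : -1 <= s <= 1 by apply/andP; split; lra.
have /half_itv/andP[h1 h2] := s11.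
have h3 : 0 <= ((1 - s) / 2) ^+ n <= 1 by rewrite exprn_ge0// exprn_ile1.
apply: le_trans (one_sub_pow (2 ^ n)%N h3); rewrite -/(bump n s).
apply: ler_wpM2l; first by have /andP[] := bump01 n s11.
rewrite natrX -exprMn (_ : 2 * ((1 - s) / 2) = 1 - s); last by field.
rewrite lerD2l; apply: le_trans (_ : 1 + n%:R * - s <= _); first by rewrite lerDr.
by apply: bernoulli_ge; lra.
Qed.

(** Mean value theorem, on an interval where [cos] exceeds 1/2. *)
Lemma sin_near0 : exists2 d : R, 0 < d & forall t, 0 <= t <= d -> t / 2 <= sin t.
Proof.
have [d d0 hd] := @cos_near0 R 1 ltr01; exists (d / 2); first by rewrite divr_gt0.
move=> t /andP[t0 td]; have [->|tn0] := eqVneq t 0; first by rewrite mul0r sin0.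
have {tn0}t0' : 0 < t by rewrite lt_def tn0.
have [x] := @MVT_segment R sin cos 0 t t0 (fun x _ => is_derive_sin x)
   (continuous_subspaceT (@continuous_sin R)).
rewrite in_itv /= sin0 !subr0 => /andP[x0 xt] ->.
have : 2 - 2 * cos x < 1 by apply: hd; rewrite ger0_norm//; lra.
by move=> h; rewrite mulrC ler_pM2r//; lra.
Qed.

(* the phase 1 / K^2 makes the limit at y = 0 equal to 1 *)
Definition stepf k y : R :=
  let K : R := k.+1%:R in bump (k.+1 ^ 3)%N (sin (y / K + (K ^+ 2)^-1)).

Lemma cvg_bound (d : nat -> R) C : (forall k, 0 <= d k) ->
  (\forall k \near \oo, d k * k.+1%:R <= C) -> d @ \oo --> 0.
Proof.
move=> d0 dC.
have h : (fun k => C * k.+1%:R^-1) @ \oo --> (0 : R).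
  by rewrite -(mulr0 C); apply: cvgMr; exact: cvg_harmonic.
apply: (squeeze_cvgr (f := fun=> 0) _ (cvg_cst _) h).
near=> k; rewrite d0 /= ler_pdivlMr//.
by near: k.
Unshelve. all: by end_near. Qed.

Lemma nearK (b : R) : \forall k \near \oo, b <= k.+1%:R.
Proof.
near=> k; apply: le_trans (_ : k%:R <= _); last by rewrite ler_nat.
by near: k; exact: nbhs_infty_ger.
Unshelve. all: by end_near. Qed.

(** For fixed [y] the angle tends to 0, so periodicity is invisible in the limit and the sine is
    comparable to its argument. The angle is at least [K^-2], so [K^3] times the sine is at least
    [K / 2]. *)
Lemma stepf_ge0 y : 0 <= y -> (fun k => 1 - stepf k y) @ \oo --> 0.
Proof.
move=> y0; apply: (@cvg_bound _ 2) => [k|].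
  rewrite subr_ge0; have : -1 <= sin (y / k.+1%:R + (k.+1%:R ^+ 2)^-1) <= 1.
    by rewrite sin_geN1 sin_le1.
  by move=> /(bump01 (k.+1 ^ 3)%N)/andP[].
have [d d0 hd] := sin_near0.
near=> k; have Kd : (y + 1) / d <= k.+1%:R by near: k; exact: nearK.
rewrite /stepf; set K : R := k.+1%:R.
have K1 : 1 <= K by rewrite ler1n.
have K0 : 0 < K by apply: lt_le_trans K1.
set th := y / K + _.
have thd : th <= d.
  move: Kd; rewrite -/K ler_pdivrMr// => Kd.
  rewrite -(ler_pM2r K0); apply: le_trans (_ : y + 1 <= _); last by rewrite mulrC.
  rewrite /th mulrDl divfK ?gt_eqF// lerD2l expr2 invfM -mulrA mulVf ?gt_eqF// mulr1.
  by rewrite invf_le1.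
have th0 : (K ^+ 2)^-1 <= th by rewrite lerDr divr_ge0// ltW.
have k20 : 0 < (K ^+ 2)^-1 by rewrite invr_gt0 exprn_gt0.
have th00 : 0 <= th by apply: le_trans th0; exact: ltW.
have sl := hd th; rewrite th00 thd in sl; have {}sl := sl isT.
have s01 : 0 <= sin th <= 1 by rewrite sin_le1 andbT; apply: le_trans sl; rewrite divr_ge0.
have := bump_pos (k.+1 ^ 3)%N s01; rewrite natrX -/K => h.
have [b0 b1] : 0 <= bump (k.+1 ^ 3)%N (sin th) /\ bump (k.+1 ^ 3)%N (sin th) <= 1.
  by have /andP[] : 0 <= bump (k.+1 ^ 3)%N (sin th) <= 1 by apply: bump01; rewrite sin_geN1 sin_le1.
have K3 : K / 2 <= K ^+ 3 * sin th.
  apply: le_trans (_ : K ^+ 3 * (th / 2) <= _); last by rewrite ler_wpM2l// exprn_ge0// ltW.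
  apply: le_trans (_ : K ^+ 3 * ((K ^+ 2)^-1 / 2) <= _); last first.
    by rewrite ler_wpM2l ?exprn_ge0 ?(ltW K0)// ler_pM2r.
  by rewrite (_ : K ^+ 3 * _ = K / 2)//; field; rewrite gt_eqF.
nra.
Unshelve. all: by end_near. Qed.

(** Once [K >= 2 / (- y)], the phase offsets at most half of [y / K], and [K^3] times the sine has
    modulus at least [K (- y) / 4]. *)
Lemma stepf_lt0 y : y < 0 -> (fun k => stepf k y) @ \oo --> 0.
Proof.
move=> y0; apply: (@cvg_bound _ (4 / - y)) => [k|].
  have : -1 <= sin (y / k.+1%:R + (k.+1%:R ^+ 2)^-1) <= 1.
    by rewrite sin_geN1 sin_le1.
  by move=> /(bump01 (k.+1 ^ 3)%N)/andP[].
have [d d0 hd] := sin_near0.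
near=> k; have Kd : (- y) / d <= k.+1%:R by near: k; exact: nearK.
have yK : 2 / - y <= k.+1%:R by near: k; exact: nearK.
rewrite /stepf; set K : R := k.+1%:R.
have K1 : 1 <= K by rewrite ler1n.
have K0 : 0 < K by apply: lt_le_trans K1.
set th := y / K + _.
have ny : 0 < - y by rewrite oppr_gt0.
move: yK; rewrite -/K ler_pdivrMr// => yK.
have thE : - th * K = - y - K^-1.
  by rewrite /th; field; rewrite gt_eqF.
have Ki : K^-1 <= - y / 2.
  rewrite -(ler_pM2r K0) mulVf ?gt_eqF//; lra.
have thl : - y / 2 / K <= - th by rewrite ler_pdivrMr// thE lerBrDr -lerBrDl (le_trans Ki)//; lra.
have thd : - th <= d.
  move: Kd; rewrite -/K ler_pdivrMr// => Kd; rewrite -(ler_pM2r K0) thE mulrC.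
  by apply: le_trans Kd; rewrite gerBl invr_ge0 ltW.
have th00 : 0 <= - th by apply: le_trans thl; rewrite !divr_ge0// ltW.
have sl := hd (- th); rewrite th00 thd sinN in sl; have {}sl := sl isT.
have s01 : -1 <= sin th <= 0.
  rewrite sin_geN1 /= -oppr_ge0; apply: le_trans sl; by rewrite divr_ge0.
have := bump_neg (k.+1 ^ 3)%N s01; rewrite natrX -/K => h.
have b0 : 0 <= bump (k.+1 ^ 3)%N (sin th).
  by have /andP[] : 0 <= bump (k.+1 ^ 3)%N (sin th) <= 1 by apply: bump01; rewrite sin_geN1 sin_le1.
have K3 : K * (- y / 4) <= K ^+ 3 * - sin th.
  apply: le_trans (_ : K ^+ 2 * (- y / 4) <= _).
    by rewrite ler_wpM2r ?divr_ge0 ?(ltW ny)// expr2 ler_peMl ?(ltW K0).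
  apply: le_trans (_ : K ^+ 3 * (- th / 2) <= _); last by rewrite ler_wpM2l// exprn_ge0// ltW.
  have -> : K ^+ 2 * (- y / 4) = K ^+ 3 * (- y / 2 / K / 2).
    by field; rewrite gt_eqF.
  by rewrite ler_wpM2l ?exprn_ge0 ?(ltW K0)// ler_pM2r.
rewrite ler_pdivlMr//.
have y4 : 0 < - y / 4 by rewrite divr_gt0.
nra.
Unshelve. all: by end_near. Qed.

Lemma stepf01 k y : 0 <= stepf k y <= 1.
Proof. by apply: bump01; rewrite sin_geN1 sin_le1. Qed.

End SmoothStep.

(** * Strong limits of multiplication operators *)

Section MultiplierLimits.
Context {R : realType}.
Local Notation T1 := (measurableTypeR R).
Local Notation T2 := (T1 * T1)%type.
Local Notation lam := (@lebesgue2 R).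
Variables (c : R) (c01 : 0 <= c < 1).
Let c0 : 0 <= c. Proof. by have /andP[] := c01. Qed.

(** Dominated convergence in each component, the dominating function being the squared modulus of
    that component of [h]. *)
Lemma M_cvg (m : nat -> R * R -> R[i]) (m0 : R * R -> R[i]) (F : Hc c01) :
  (forall n, bmeas (m n)) -> bmeas m0 ->
  (forall n x, absq (m n x - m0 x) <= 1) ->
  (forall x, (fun n => absq (m n x - m0 x)) @ \oo --> 0) ->
  forall e : R, 0 < e -> exists N, forall n, (N <= n)%N -> `|M (m n) F - M m0 F| < e%:C.
Proof.
move=> bm bm0 m1 mm e e0; elim/(@cl_ind R c c01): F => h.
have cp : 0 < 1 + c by rewrite ltr_wpDr.
have lM (u : R * R -> R[i]) i : bmeas u -> L2 lam (fun x => u x * val h i x).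
  by move=> [mu [C uC]]; exact: L2Mb mu uC (fld_L2 h i).
have n2 i : (fun n => norm2 lam (fun x => m n x * val h i x - m0 x * val h i x)) @ \oo --> 0.
  apply: (@norm2_dominated R _ _ lam (fun n x => m n x * val h i x) (fun x => m0 x * val h i x) (fun x => absq (val h i x))).
  - by move=> n; exact: lM.
  - exact: lM.
  - move=> x; rewrite (_ : (fun n => _) = fun n => absq (m n x - m0 x) * absq (val h i x)).
      by rewrite -(mul0r (absq (val h i x))); apply: cvgMl; exact: mm.
    by apply/funext => n; rewrite -absqM mulrBl.
  - by move=> n x; rewrite -mulrBl absqM ler_piMl ?absq_ge0.
  - exact: absq_integrable.
have e' : 0 < e ^+ 2 / (4 * (1 + c)) by rewrite divr_gt0 ?exprn_gt0// mulr_gt0.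
have /cvgr0Pnorm_lt/(_ _ e')[N1 _ h1] := n2 true.
have /cvgr0Pnorm_lt/(_ _ e')[N2 _ h2] := n2 false.
exists (maxn N1 N2) => n; rewrite geq_max => /andP[n1 n2'].
rewrite !M_cl; apply: normB_cl_lt => //.
apply: le_lt_trans (fsq_le c01 _) _.
have E i : norm2 lam (val (mulop (m n) h - mulop m0 h) i) =
    norm2 lam (fun x => m n x * val h i x - m0 x * val h i x).
  by congr norm2; apply/funext => x; rewrite fldBE !mulopE.
have := h1 n n1; have := h2 n n2'; rewrite /= !ger0_norm ?norm2_ge0// !E => g2 g1.
apply: le_lt_trans (_ : (1 + c) * (e ^+ 2 / (4 * (1 + c)) + e ^+ 2 / (4 * (1 + c))) < _).
  by rewrite (ler_pM2l cp) lerD// ltW.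
rewrite (_ : (1 + c) * _ = e ^+ 2 / 2); last by field; rewrite gt_eqF.
by rewrite ltr_pdivrMr// ltr_pMr ?exprn_gt0// ltr1n.
Qed.

End MultiplierLimits.

(** * Multipliers that commute with an intertwiner *)

Section Intertwiner.
Context {R : realType}.
Local Notation T1 := (measurableTypeR R).
Local Notation T2 := (T1 * T1)%type.
Local Notation lam := (@lebesgue2 R).
Variables (c d : R) (c01 : 0 <= c < 1) (d01 : 0 <= d < 1).
Variable X : Hc c01 -> Hc d01.
Hypothesis bX : bounded_operator X.
Hypothesis XU : forall chi F, X (@U R c c01 chi F) = @U R d d01 chi (X F).
Hypothesis XV : forall a, quadrant a -> forall F, X (@V R c c01 a F) = @V R d d01 a (X F).

(** These multipliers form an algebra that contains the characters and is stable under bounded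
    pointwise limits, which is enough to reach indicators of squares. *)
Definition intertwined (m : R * R -> R[i]) : Prop :=
  bmeas m /\ forall F, X (M m F) = M m (X F).

Lemma intertwined_char chi : intertwined (character chi).
Proof. by split; [exact: bmeas_character|exact: XU]. Qed.

Lemma intertwinedM m m' : intertwined m -> intertwined m' -> intertwined (fun x => m x * m' x).
Proof.
move=> [bm Xm] [bm' Xm']; split; first exact: bmeasM.
by move=> F; rewrite (M_mul F bm bm') Xm Xm' (M_mul (X F) bm bm').
Qed.

Lemma intertwinedD m m' : intertwined m -> intertwined m' -> intertwined (fun x => m x + m' x).
Proof.
move=> [bm Xm] [bm' Xm']; split; first exact: bmeasD.
by move=> F; rewrite (M_add F bm bm') (bounded_opD _ _ bX) Xm Xm' (M_add (X F) bm bm').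
Qed.

Lemma intertwinedZ a m : intertwined m -> intertwined (fun x => a * m x).
Proof.
move=> [bm Xm]; split; first exact: bmeasZ.
by move=> F; rewrite (M_scale a F bm) (bounded_opZ _ _ bX) Xm (M_scale a (X F) bm).
Qed.

Lemma intertwined1 : intertwined (fun=> 1).
Proof. by split; [exact: bmeas_cst|move=> F; rewrite !M_one]. Qed.

Lemma intertwinedX m n : intertwined m -> intertwined (fun x => m x ^+ n).
Proof.
move=> hm; elim: n => [|n IH].
  by under eq_fun do rewrite expr0; exact: intertwined1.
by under eq_fun do rewrite exprS; exact: intertwinedM.
Qed.

Lemma intertwined_ext m m' : (forall x, m x = m' x) -> intertwined m -> intertwined m'.
Proof. by move=> /funext ->. Qed.

Lemma intertwined_lim (m : nat -> R * R -> R[i]) m0 :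
  (forall n, intertwined (m n)) -> bmeas m0 ->
  (forall n x, absq (m n x - m0 x) <= 1) ->
  (forall x, (fun n => absq (m n x - m0 x)) @ \oo --> 0) -> intertwined m0.
Proof.
move=> im bm0 m1 mm; split => // F; apply/eqP; rewrite -subr_eq0; apply/eqP/approx0 => e e0.
have bm n : bmeas (m n) by case: (im n).
have [_ [K K0 XK]] := (bounded_operatorP _).1 bX.
have e1 : 0 < e / (2 * (K + 1)) by rewrite divr_gt0// mulr_gt0// ltr_wpDl.
have e2 : 0 < e / 2 by rewrite divr_gt0.
have [N1 h1] := M_cvg F bm bm0 m1 mm e1.
have [N2 h2] := M_cvg (X F) bm bm0 m1 mm e2.
pose n := maxn N1 N2.
(* The terms in [m n] cancel because [X] intertwines [m n]. *)
have -> : X (M m0 F) - M m0 (X F) =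
    (M (m n) (X F) - M m0 (X F)) - X (M (m n) F - M m0 F).
  rewrite (bounded_opB _ _ bX); have [_ ->] := im n.
  by rewrite opprB [RHS]addrC addrA subrK.
apply: le_trans (ler_normB _ _) _; rewrite [e]splitr rmorphD /=; apply: lerD.
  by apply/ltW/h2; exact: leq_maxr.
apply: le_trans (XK _) _.
apply: le_trans (_ : (K + 1)%:C * (e / (2 * (K + 1)))%:C <= _).
  apply: ler_pM => //; first by rewrite ler0c.
    by rewrite lecR lerDl.
  by apply/ltW/h1; exact: leq_maxl.
rewrite -rmorphM lecR le_eqVlt; apply/orP; left; apply/eqP; field.
by rewrite gt_eqF// ltr_wpDl.
Qed.

(** Euler's formula: [- iu / 2] is [1 / (2 i)], and the phase [be] is absorbed in the constant [w]
    of modulus one. *)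
Lemma intertwined_sin i (al be : R) : intertwined (fun x => (sin (al * crd i x + be))%:C).
Proof.
pose chi : R * R := if i then (al, 0) else (0, al).
have dE x : dotp chi x = al * crd i x.
  by rewrite /chi /dotp; case: (i) => /=; rewrite mul0r ?addr0 ?add0r.
pose iu : R[i] := (0 : R) +i* (1 : R).
pose w : R[i] := cos be +i* sin be.
apply: (@intertwined_ext (fun x => (- iu / 2) * (w * character chi x) +
    (iu / 2) * (Num.conj w * character (- chi) x))).
  move=> x; rewrite character_opp characterE dE.
  move: (al * crd i x) => t.
  have -> : w * (cos t +i* sin t) = cos (t + be) +i* sin (t + be) by rewrite cisD mulrC.
  have -> : Num.conj w * Num.conj (cos t +i* sin t) = Num.conj (cos (t + be) +i* sin (t + be)).
    by rewrite cisD rmorphM mulrC.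
  have two : (2 : R[i]) != 0 by [].
  apply: (mulfI two); rewrite mulrDr !mulrA !(mulrAC 2 _ 2^-1) !mulfV// !mul1r.
  rewrite mulr_natl mulr2n; move: (t + be) => r.
  have Rc (u v : R) : Re (u +i* v) = u by [].
  have Ic (u v : R) : Im (u +i* v) = v by [].
  by rewrite /iu; apply: complex_ext; rewrite !(ReImE, Rc, Ic); ring.
by apply: intertwinedD; apply: intertwinedZ; apply: intertwinedZ; exact: intertwined_char.
Qed.

(** [bump n] is a polynomial, and intertwined multipliers form an algebra. *)
Lemma intertwined_bump n (s : R * R -> R) : intertwined (fun x => (s x)%:C) ->
  intertwined (fun x => (bump n (s x))%:C).
Proof.
move=> hs.
apply: (@intertwined_ext (fun x => (1 + (-1) * (2^-1 * (1 + (-1) * (s x)%:C)) ^+ n) ^+ (2 ^ n)%N)).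
  move=> x; rewrite /bump !(rmorphXn, rmorphB, rmorphM, fmorphV, rmorph1, rmorph_nat) /=.
  by congr (_ ^+ _); rewrite !mulN1r; congr (_ - _); congr (_ ^+ _); rewrite mulrC.
apply: intertwinedX; apply: intertwinedD; first exact: intertwined1.
apply: intertwinedZ; apply: intertwinedX; apply: intertwinedZ.
by apply: intertwinedD; [exact: intertwined1|exact: intertwinedZ].
Qed.

Definition hplane i (t : R) : set T2 := [set x | t <= crd i x].

Lemma measurable_hplane i t : measurable (hplane i t).
Proof.
have mi : measurable (`[t, +oo[%classic : set T1) by exact: measurable_itv.
have -> : hplane i t = (fun x : T2 => crd i x : T1) @^-1` `[t, +oo[.
  by apply/seteqP; split=> x /=; rewrite /hplane /= in_itv /= andbT.
rewrite -[X in measurable X]setTI; case: i.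
  exact: ((@measurable_fst _ _ T1 T1) measurableT _ mi).
exact: ((@measurable_snd _ _ T1 T1) measurableT _ mi).
Qed.

Lemma intertwined_hplane i t : intertwined (cindic (hplane i t)).
Proof.
apply: (@intertwined_lim (fun k x => (stepf k (crd i x - t))%:C)).
- move=> k; apply: intertwined_bump.
  apply: (intertwined_ext _ (intertwined_sin i (k.+1%:R^-1) (- t / k.+1%:R + (k.+1%:R ^+ 2)^-1))).
  by move=> x; congr (sin _)%:C; rewrite addrA; congr (_ + _); rewrite mulrBl mulrC mulNr.
- exact: bmeas_indic (measurable_hplane i t).
- move=> n x; rewrite /cindic -rmorphB absq_real.
  have /andP[s0 s1] := stepf01 n (crd i x - t).
  by rewrite indicE; case: (_ \in _) => /=; nra.
- move=> x; rewrite (_ : (fun n => _) = fun n =>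
      (stepf n (crd i x - t) - \1_(hplane i t) x) * (stepf n (crd i x - t) - \1_(hplane i t) x)).
    have [tx|xt] := leP t (crd i x).
      have hx : x \in hplane i t by apply/mem_set.
      have := stepf_ge0 (y := crd i x - t); rewrite subr_ge0 => /(_ tx) h.
      rewrite (_ : (fun n => _) = (fun n => (1 - stepf n (crd i x - t)) * (1 - stepf n (crd i x - t)))).
        by rewrite -(mulr0 0); exact: cvgM.
      by apply/funext => n; rewrite indicE hx /=; ring.
    have hx : x \notin hplane i t.
      by apply/negP => /set_mem; rewrite /hplane /= leNgt xt.
    have := stepf_lt0 (y := crd i x - t); rewrite subr_lt0 => /(_ xt) h.
    rewrite (_ : (fun n => _) = (fun n => stepf n (crd i x - t) * stepf n (crd i x - t))).
      by rewrite -(mulr0 0); exact: cvgM.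
    by apply/funext => n; rewrite indicE (negbTE hx) /=; ring.
  by apply/funext => n; rewrite /cindic -rmorphB absq_real expr2.
Qed.

Lemma cindic_dsq n k l (x : R * R) : cindic (dsq (n, k, l)) x =
  (\1_(dint n k) x.1 : R)%:C * (\1_(dint n l) x.2 : R)%:C.
Proof.
by rewrite /cindic -rmorphM !indicE in_setX -natrM mulnb.
Qed.

Lemma intertwined_dsq q : intertwined (cindic (dsq q)).
Proof.
case: q => [[n k] l]; pose w (j : int) : R := j%:~R / 2 ^+ n.
(* Each factor is the indicator of a strip, as a difference of two nested half planes. *)
apply: (@intertwined_ext (fun x =>
  (cindic (hplane true (w k)) x + (-1) * cindic (hplane true (w (k + 1))) x) *
  (cindic (hplane false (w l)) x + (-1) * cindic (hplane false (w (l + 1))) x))).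
  have p0 : 0 < 2 ^+ n :> R by rewrite exprn_gt0.
  have E i j x : cindic (hplane i (w j)) x + (-1) * cindic (hplane i (w (j + 1))) x =
      (\1_(dint n j) (crd i x) : R)%:C.
    rewrite mulN1r /cindic -rmorphB !indicE; congr (_%:C).
    have hpE t : (x \in hplane i t) = (t <= crd i x) by apply/idP/idP; rewrite inE.
    have diE : (crd i x \in dint n j) = (w j <= crd i x) && (crd i x < w (j + 1)).
      by rewrite /w ler_pdivrMr// ltr_pdivlMr//; apply/idP/idP; rewrite inE.
    have wj : w j <= w (j + 1).
      by rewrite /w ler_pM2r ?invr_gt0// ler_int; lia.
    rewrite !hpE diE; case: (leP (w (j + 1)) (crd i x)) => h; last by rewrite andbT subr0.
    by rewrite (le_trans wj h) subrr.
  by move=> x; rewrite !E cindic_dsq.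
by apply: intertwinedM; apply: intertwinedD; try apply: intertwinedZ; exact: intertwined_hplane.
Qed.

End Intertwiner.

(** * Vectors of dyadic squares *)

Section SquareVectors.
Context {R : realType}.
Local Notation T1 := (measurableTypeR R).
Local Notation T2 := (T1 * T1)%type.
Local Notation lam := (@lebesgue2 R).
Local Notation dsq := (@dsq R).
Local Notation reg := (@reg R).

Lemma cindicI (A B : set (R * R)) x : cindic (A `&` B) x = cindic A x * cindic B x :> R[i].
Proof. by rewrite /cindic !indicE in_setI -rmorphM -natrM mulnb. Qed.

Lemma conj_cindic (A : set (R * R)) x : Num.conj (cindic A x : R[i]) = cindic A x.
Proof. exact: conj_real. Qed.

Lemma bmeas_dsq q : bmeas (cindic (dsq q)).
Proof. by apply: bmeas_indic; exact: measurable_dsq. Qed.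

Lemma mulop_sqv q r s i : dsq q `&` dsq r = dsq s ->
  mulop (cindic (dsq q)) (sqv i r) = sqv i s.
Proof.
move=> e; apply: fld_ext => j x; rewrite mulopE ?val_sqv; last exact: bmeas_dsq.
by case: eqVneq => _; rewrite ?mulr0// mulrCA -(cindicI (dsq q)) e.
Qed.

Lemma mulop_sqv0 q r i : dsq q `&` dsq r = set0 ->
  mulop (cindic (dsq q)) (sqv i r) = 0.
Proof.
move=> e; apply: fld_ext => j x; rewrite mulopE ?val_sqv; last exact: bmeas_dsq.
case: eqVneq => _; rewrite ?mulr0// mulrCA -(cindicI (dsq q)) e.
by rewrite {2}/cindic indic0 mulr0.
Qed.

(* Squares indexed by the coordinate [crd i] first *)
Definition sq (i : bool) n (k l : int) : nat * int * int :=
  if i then (n, k, l) else (n, l, k).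

Definition sqshift (i : bool) n (a b : int) : R * R :=
  if i then (a%:~R / 2 ^+ n, b%:~R / 2 ^+ n) else (b%:~R / 2 ^+ n, a%:~R / 2 ^+ n).

Lemma sq_surj i q : exists n k l, q = sq i n k l.
Proof.
by case: q => [[n k] l]; case: i; [exists n, k, l|exists n, l, k].
Qed.

Lemma sqP i n k l x : dsq (sq i n k l) x <-> dint n k (crd i x) /\ dint n l (crd (~~ i) x).
Proof. by case: i; split=> [[]|[]]. Qed.

Lemma dint_shiftN n k (j : int) (t : R) :
  dint n (k + j) t <-> dint n k (t - j%:~R / 2 ^+ n).
Proof. by rewrite -(dint_shift n k j (t - _)) subrK. Qed.

Lemma sq_shift i n k l a b x :
  dsq (sq i n (k + a) (l + b)) x <-> dsq (sq i n k l) (x - sqshift i n a b).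
Proof.
rewrite !sqP !dint_shiftN !crdB.
by case: i.
Qed.

Lemma sq_reg i n k l : 0 <= k -> dsq (sq i n k l) `<=` reg i.
Proof.
move=> k0 x /sqP[/andP[h _] _]; rewrite /reg /=.
have p0 : 0 < 2 ^+ n :> R by rewrite exprn_gt0.
by rewrite -(pmulr_lge0 _ p0); apply: le_trans h; rewrite ler0z.
Qed.

(** The lower left corner belongs to the square. *)
Lemma reg_sq i n k l : dsq (sq i n k l) `<=` reg i -> 0 <= k.
Proof.
have p0 : 0 < 2 ^+ n :> R by rewrite exprn_gt0.
pose u : R := k%:~R / 2 ^+ n; pose v : R := l%:~R / 2 ^+ n.
pose x : R * R := if i then (u, v) else (v, u).
have dd (j : int) : dint n j (j%:~R / 2 ^+ n : R).
  by rewrite /dint /= divfK ?gt_eqF// lexx ltr_int; lia.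
have hx : dsq (sq i n k l) x by apply/sqP; rewrite /x; case: (i); split; exact: dd.
move=> /(_ _ hx); rewrite /reg /= (_ : crd i x = u); last by rewrite /x; case: (i).
by rewrite /u pmulr_lge0 ?invr_gt0// ler0z.
Qed.

Lemma sq_out i n k l : l < 0 -> dsq (sq i n k l) `&` reg (~~ i) = set0.
Proof.
move=> l0; apply/seteqP; split=> // x [/sqP[_ /andP[_ h]]]; rewrite /reg /= => h2.
have p0 : 0 < 2 ^+ n :> R by rewrite exprn_gt0.
have : 0 <= crd (~~ i) x * 2 ^+ n by rewrite mulr_ge0// ltW.
move=> /le_lt_trans/(_ h); rewrite ltr0z; lia.
Qed.

Lemma sq_half i n k l :
  sqv i (sq i n k l) = sqv i (sq i n.+1 (2 * k) (2 * l)) + sqv i (sq i n.+1 (2 * k) (2 * l + 1)) +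
    (sqv i (sq i n.+1 (2 * k + 1) (2 * l)) + sqv i (sq i n.+1 (2 * k + 1) (2 * l + 1))) :> @fld R.
Proof.
apply: fld_ext => j x; rewrite !fldDE !val_sqv; case: eqVneq => _; last by rewrite !addr0.
rewrite -!mulrDr; congr (_ * _).
have half m (t : R) : (\1_(dint n m) t : R)%:C =
    (\1_(dint n.+1 (2 * m)) t : R)%:C + (\1_(dint n.+1 (2 * m + 1)) t : R)%:C :> R[i].
  rewrite -rmorphD; congr (_%:C); rewrite !indicE.
  have [h1|n1] := pselect (dint n.+1 (2 * m) t).
    have n2 : ~ dint n.+1 (2 * m + 1) t by move=> h2; have := dint_inj h1 h2; lia.
    have h : dint n m t by apply/dint_half; left.
    by rewrite (mem_set h) (mem_set h1) (memNset n2) addr0.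
  have [h2|n2] := pselect (dint n.+1 (2 * m + 1) t).
    have h : dint n m t by apply/dint_half; right.
    by rewrite (mem_set h) (mem_set h2) (memNset n1) add0r.
  have nh : ~ dint n m t by move=> /dint_half[].
  by rewrite (memNset nh) (memNset n1) (memNset n2) addr0.
case: (i) => /=; rewrite !cindic_dsq (half k) (half l); ring.
Qed.

Section Angle.
Variables (c : R) (c01 : 0 <= c < 1).

Lemma quadrant_sqshift i n a b : 0 <= a -> 0 <= b -> quadrant (sqshift i n a b).
Proof.
move=> a0 b0; have p0 : 0 < (2 ^+ n)^-1 :> R by rewrite invr_gt0 exprn_gt0.
by case: i; split; rewrite /= pmulr_lge0// ler0z.
Qed.

(** With [0 <= k] the square lies in its half plane and is not cut, so the translate is the vector
    of the whole translated square. The index [l] may be negative, which lets a square start below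
    the other axis. *)
Lemma V_sqv i n k l a b : 0 <= k -> 0 <= a -> 0 <= b ->
  @V R c c01 (sqshift i n a b) (cl c01 (sqv i (sq i n k l))) =
  cl c01 (sqv i (sq i n (k + a) (l + b))).
Proof.
move=> k0 a0 b0; have qa := quadrant_sqshift i n a0 b0.
rewrite (V_cl _ _ qa); congr cl; apply: fld_ext => j x.
rewrite (shopE _ _ _ qa) (sqv_in (@sq_reg i n k l k0)) sqv_in; last by apply: sq_reg; exact: addr_ge0.
case: eqVneq => // _; rewrite /cindic !indicE; congr (_%:R)%:C; congr nat_of_bool.
by apply/idP/idP; rewrite !inE => /sq_shift.
Qed.

Lemma M_dsq_sqv q r s i : dsq q `&` dsq r = dsq s ->
  M (cindic (dsq q)) (cl c01 (sqv i r)) = cl c01 (sqv i s).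
Proof. by move=> e; rewrite M_cl (mulop_sqv _ e). Qed.

Lemma M_dsq_sqv0 q r i : dsq q `&` dsq r = set0 ->
  M (cindic (dsq q)) (cl c01 (sqv i r)) = 0.
Proof.
by move=> e; rewrite M_cl (mulop_sqv0 _ e) -(scale0r (0 : fld)) clZ scale0r.
Qed.

Lemma M_dsq_adj q (F G : Hc c01) :
  inner (Hc c01) (M (cindic (dsq q)) F) G = inner (Hc c01) F (M (cindic (dsq q)) G).
Proof.
rewrite (M_adjoint (bmeas_dsq q)).
by rewrite (_ : (fun x => _) = cindic (dsq q))//; apply/funext => x; exact: conj_cindic.
Qed.

(** The Gram coefficient factors out of one and the same integral, so orthogonality to the squares
    of component [i] passes to those of the other component. *)
Lemma fip_single (g : fld) i j r : (forall x, val g (~~ i) x = 0) -> dsq r `<=` reg j ->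
  fip c g (sqv j r) =
    (if j == i then 1 else c%:C) * cint lam (fun x => val g i x * cindic (dsq r) x).
Proof.
move=> g0 rj; rewrite -cintZ.
  apply: eq_cint => x; rewrite /form !(sqv_in rj).
  by case: i j g0 {rj} => [] [] g0 /=;
    rewrite ?(g0 x) ?rmorph0 ?mulr0 ?mul0r ?mulr0 ?add0r ?addr0 ?mulr0 ?addr0 ?add0r ?mul1r conj_cindic.
have := L2_prod (fld_L2 g i) (L2_cdsq r).
rewrite (_ : (fun x => _ * Num.conj _) = fun x : T2 => val g i x * cindic (dsq r) x)//.
by apply/funext => x; rewrite conj_cindic.
Qed.

End Angle.
End SquareVectors.

Section InnerLinear.
Context {R : realType} (H : hilbertType R).
Implicit Types x y z : H.

Lemma innerDr x y z : inner H x (y + z) = inner H x y + inner H x z.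
Proof. by rewrite linearDr. Qed.

Lemma innerBl x y z : inner H (x - y) z = inner H x z - inner H y z.
Proof. by rewrite linearBl. Qed.

Lemma innerZl a x y : inner H (a *: x) y = a * inner H x y.
Proof. by rewrite linearZl_LR. Qed.

Lemma innerZr a x y : inner H x (a *: y) = Num.conj a * inner H x y.
Proof. by rewrite linearZr_LR. Qed.

Lemma inner0r x : inner H x 0 = 0.
Proof. by rewrite linear0r. Qed.

End InnerLinear.

(** * Translation invariant additive functions of squares *)

Section Additive.
Variables (A : fieldType) (w : nat -> int -> int -> A).
Hypothesis w_shift : forall n (k l a b : int), 0 <= k -> 0 <= a -> 0 <= b ->
  w n (k + a) (l + b) = w n k l.
Hypothesis w_half : forall n,
  w n 0 0 = w n.+1 0 0 + w n.+1 0 1 + (w n.+1 1 0 + w n.+1 1 1).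

Lemma additive_const n (k l : int) : 0 <= k -> w n k l = w n 0 0.
Proof.
move=> k0.
(* The square [(k, l + j)] is a shift of both [(k, l)] and [(0, l + j)]; this brings [k] down to 0
   although only nonnegative shifts are available. *)
have E (j : int) : 0 <= j -> w n k l = w n 0 (l + j).
  by move=> j0; rewrite -(w_shift n l k0 (lexx 0) j0) addr0 -{1}[k]add0r -{1}[l + j]addr0 w_shift.
have [l0|l0] := leP 0 l.
  by rewrite (E 0)// addr0 -(w_shift n 0 (lexx 0) (lexx 0) l0) addr0 add0r.
by rewrite (E (- l)) ?oppr_ge0 ?ltW// subrr.
Qed.

(** The four children of a square have equal weight, so each level divides by 4. *)
Lemma additive_scale n (k l : int) : 4 != 0 :> A -> 0 <= k -> w n k l = 4 ^- n * w 0 0 0.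
Proof.
move=> four k0; rewrite additive_const// => {k0}; elim: n => [|n IH].
  by rewrite expr0 invr1 mul1r.
apply: (mulfI four); rewrite exprS invfM !mulrA mulfV// mul1r -IH (w_half n).
rewrite (additive_const n.+1 1 (lexx 0)) !(additive_const n.+1 _ (ler01 : 0 <= 1 :> int)).
by ring.
Qed.

End Additive.

Section Area.
Context {R : realType}.
Local Notation lam := (@lebesgue2 R).
Local Notation dsq := (@dsq R).

Lemma area q : ((fine (lam (dsq q)))%:C : R[i]) = 4 ^- q.1.1.
Proof.
by case: q => [[n k] l]; rewrite lebesgue2_dsq /= fmorphV rmorphXn rmorph_nat.
Qed.

End Area.

(** * The matrix of an intertwiner on vectors of squares *)

Section Gram.
Context {R : realType}.
Local Notation T1 := (measurableTypeR R).
Local Notation T2 := (T1 * T1)%type.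
Local Notation lam := (@lebesgue2 R).
Local Notation dsq := (@dsq R).
Local Notation reg := (@reg R).
Variables (c d : R) (c01 : 0 <= c < 1) (d01 : 0 <= d < 1).
Variable X : Hc c01 -> Hc d01.
Hypothesis bX : bounded_operator X.
Hypothesis XU : forall chi F, X (@U R c c01 chi F) = @U R d d01 chi (X F).
Hypothesis XV : forall a, quadrant a -> forall F, X (@V R c c01 a F) = @V R d d01 a (X F).

Local Notation e i q := (cl c01 (sqv i q)).
Local Notation e' i q := (cl d01 (sqv i q)).
Local Notation ip := (inner (Hc d01)).

Lemma X_dsq q F : X (M (cindic (dsq q)) F) = M (cindic (dsq q)) (X F).
Proof. by have [_] := intertwined_dsq bX XU q; exact. Qed.

Lemma sqv_restrict i q : e i q = M (cindic (dsq q)) (e i q).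
Proof. by rewrite (M_dsq_sqv _ _ (setIid _)). Qed.

(** Multiplication by the indicator of [q] fixes the vector of [q], commutes with [X], is
    self-adjoint, and kills the vector of [r]. *)
Lemma gram_disjoint i j q r : dsq q `&` dsq r = set0 -> ip (X (e i q)) (e' j r) = 0.
Proof.
by move=> qr; rewrite (sqv_restrict i q) X_dsq M_dsq_adj (M_dsq_sqv0 _ _ qr) inner0r.
Qed.

(** Moving indicators across [X] and the inner product compresses both vectors to the common
    square. *)
Lemma gram_cap i q r s : dsq q `&` dsq r = dsq s ->
  ip (X (e i q)) (e' i r) = ip (X (e i s)) (e' i s).
Proof.
move=> qr; rewrite (sqv_restrict i q) X_dsq M_dsq_adj (M_dsq_sqv _ _ qr).
have ss : dsq s `&` dsq s = dsq s by exact: setIid.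
have sq : dsq s `&` dsq q = dsq s by rewrite -qr; apply/setIidl => x [].
rewrite -{1}(M_dsq_sqv d01 i ss) -M_dsq_adj -X_dsq.
by rewrite (M_dsq_sqv c01 i sq).
Qed.

(** On the squares of the half plane this is translation invariant, because [V] is isometric, and
    additive under subdivision; like an area, it is determined by its value at the unit square. *)
Definition weight i n (k l : int) : R[i] := ip (X (e i (sq i n k l))) (e' i (sq i n k l)).

Lemma weight_shift i n (k l a b : int) : 0 <= k -> 0 <= a -> 0 <= b ->
  weight i n (k + a) (l + b) = weight i n k l.
Proof.
move=> k0 a0 b0; have qa := @quadrant_sqshift R i n a b a0 b0.
rewrite /weight -(V_sqv c01 i n l k0 a0 b0) -(V_sqv d01 i n l k0 a0 b0) (XV qa).
exact: (V_inner _ _ qa).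
Qed.

Lemma weight_half i n : weight i n 0 0 =
  weight i n.+1 0 0 + weight i n.+1 0 1 + (weight i n.+1 1 0 + weight i n.+1 1 1).
Proof.
have sub k l : dsq (sq i n.+1 k l) `<=` dsq (sq i n 0 0) ->
    ip (X (e i (sq i n 0 0))) (e' i (sq i n.+1 k l)) = weight i n.+1 k l.
  by move=> h; apply: gram_cap; exact: setIidr.
have inc (k l : int) : 0 <= k <= 1 -> 0 <= l <= 1 -> dsq (sq i n.+1 k l) `<=` dsq (sq i n 0 0).
  move=> hk hl x /sqP[h1 h2]; apply/sqP; split; apply/dint_half.
    have [E|E] : k = 0 \/ k = 1 by lia.
      by left; rewrite mulr0 -E.
    by right; rewrite mulr0 add0r -E.
  have [E|E] : l = 0 \/ l = 1 by lia.
    by left; rewrite mulr0 -E.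
  by right; rewrite mulr0 add0r -E.
have u0 : 0 <= (0 : int) <= 1 by [].
have u1 : 0 <= (1 : int) <= 1 by [].
rewrite -(sub _ _ (inc _ _ u0 u0)) -(sub _ _ (inc _ _ u0 u1)).
rewrite -(sub _ _ (inc _ _ u1 u0)) -(sub _ _ (inc _ _ u1 u1)).
have half := sq_half i n 0 0; rewrite mulr0 !add0r in half.
rewrite /weight; move: (X (e i (sq i n 0 0))) => Y; rewrite half !clD.
by rewrite !innerDr.
Qed.

Lemma weightE i n (k l : int) : 0 <= k -> weight i n k l = 4 ^- n * weight i 0 0 0.
Proof.
apply: (additive_scale (w := weight i)); [exact: weight_shift|exact: weight_half|].
by rewrite pnatr_eq0.
Qed.

(** Two squares are disjoint or nested, so only diagonal coefficients remain, and these are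
    proportional to the area. *)
Lemma gram_eq i q r : dsq q `<=` reg i -> dsq r `<=` reg i ->
  ip (X (e i q)) (e' i r) = weight i 0 0 0 * (fine (lam (dsq q `&` dsq r)))%:C.
Proof.
move=> qi ri.
have diag s : dsq s `<=` reg i -> ip (X (e i s)) (e' i s) =
    weight i 0 0 0 * (fine (lam (dsq s)))%:C.
  have [n [k [l ->]]] := sq_surj i s => /reg_sq k0.
  rewrite -/(weight i n k l) (weightE _ _ _ k0) mulrC; congr (_ * _).
  by rewrite area; case: (i).
have [h|h|h] := @dsq_cap R q r.
- by rewrite gram_disjoint// h measure0 mulr0.
- by rewrite (gram_cap _ h) h diag.
- by rewrite (gram_cap _ h) h diag.
Qed.

(* A square shifted below the axis of the other coordinate meets only one
   of the two regions, so that its vector stays in one component *)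
Lemma image_single i q : dsq q `<=` reg i -> exists f : fld,
  X (e i q) = cl d01 f /\ forall x, val f (~~ i) x = 0.
Proof.
have base n k l : 0 <= k -> l < 0 -> exists f : fld,
  X (e i (sq i n k l)) = cl d01 f /\ forall x, val f (~~ i) x = 0.
  move=> k0 l0; set q0 := sq i n k l.
  have [f0 Xf] : exists f0 : fld, X (e i q0) = cl d01 f0.
    by elim/(@cl_ind R d d01) : (X (e i q0)) => h; exists h.
  exists (mulop (cindic (dsq q0)) f0); split.
  - have E := sqv_restrict i q0.
    by rewrite [in LHS]E X_dsq Xf M_cl; reflexivity.
  - move=> x; rewrite mulopE; last exact: bmeas_dsq.
    have [rx|nrx] := pselect (reg (~~ i) x); last by rewrite (fld_out _ nrx) mulr0.
    have nq : ~ dsq q0 x.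
      by move=> qx; have : (dsq q0 `&` reg (~~ i)) x by []; rewrite sq_out.
    by rewrite /cindic indicE memNset// mul0r.
have [n [k [l ->]]] := sq_surj i q => /reg_sq k0.
have [l0|l0] := ltP l 0; first exact: base.
(* Position [-1] is just below the axis; [l + 1] steps upwards lead to [l], by a translation that
   commutes with [X] and preserves components. *)
have [f [Xf f1]] := base n k (-1) k0 isT.
pose a := sqshift i n 0 (l + 1) : R * R.
have l1 : 0 <= l + 1 by lia.
have qa : quadrant a by exact: quadrant_sqshift.
exists (shop a f); split.
- rewrite -(V_cl d01 f qa) -Xf -(XV qa).
  rewrite (V_sqv c01 i n (-1) k0 (lexx 0) l1) addr0.
  by have -> : -1 + (l + 1) = l by lia.
- by move=> x; rewrite (shopE _ _ _ qa) f1.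
Qed.

End Gram.

(** * Intertwiners are scalar on each component *)

Section Eigen.
Context {R : realType}.
Local Notation lam := (@lebesgue2 R).
Local Notation dsq := (@dsq R).
Local Notation reg := (@reg R).
Variables (c d : R) (c01 : 0 <= c < 1) (d01 : 0 <= d < 1).

Lemma fip_sqv (k : R) i j q : dsq q `<=` reg i -> dsq q `<=` reg j ->
  fip k (sqv i q) (sqv j q) = (if j == i then 1 else k%:C) * (fine (lam (dsq q)))%:C.
Proof.
move=> qi qj; rewrite (fip_single (i := i) _ _ qj) => [|x]; last first.
  by rewrite (sqv_in qi); case: (i).
congr (_ * _); rewrite (_ : fine (lam (dsq q)) = \int[lam]_(x in setT) \1_(dsq q) x).
  rewrite -cint_real; apply: eq_cint => x; rewrite (sqv_in qi) eqxx.
  by rewrite -cindicI setIid.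
by rewrite /Rintegral integral_indic ?setIT//; exact: measurable_dsq.
Qed.

Variable X : Hc c01 -> Hc d01.
Hypothesis bX : bounded_operator X.
Hypothesis XU : forall chi F, X (@U R c c01 chi F) = @U R d d01 chi (X F).
Hypothesis XV : forall a, quadrant a -> forall F, X (@V R c c01 a F) = @V R d d01 a (X F).

(** [gram_eq] for the identity, an intertwiner of the angle [d] with itself, whose weight at the
    unit square is 1. *)
Lemma gram_id i q r : dsq q `<=` reg i -> dsq r `<=` reg i ->
  inner (Hc d01) (cl d01 (sqv i q)) (cl d01 (sqv i r)) = (fine (lam (dsq q `&` dsq r)))%:C.
Proof.
move=> qi ri.
have bid : bounded_operator (id : Hc d01 -> Hc d01).
  by apply: (vN_one (vN_all_bounded (Hc d01))).
rewrite (gram_eq bid (fun _ _ => erefl) (fun _ _ _ => erefl) qi ri).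
suff -> : weight (id : Hc d01 -> Hc d01) i 0 0 0 = 1 by rewrite mul1r.
have s0 : dsq (sq i 0 0 0) `<=` reg i by exact: sq_reg.
rewrite /weight inner_cl (fip_sqv d s0 s0) eqxx mul1r area.
by case: (i); rewrite /= expr0 invr1.
Qed.

(** The residual [g] stays in component [i], and [gram_eq] and [gram_id] make it orthogonal to the
    squares of that component. A square of the other component sees [g] through the same integral
    times [d], so [g] is orthogonal to a total set. *)
Theorem intertwiner_eigen i : exists al : R[i], forall q, dsq q `<=` reg i ->
  X (cl c01 (sqv i q)) = al *: cl d01 (sqv i q).
Proof.
exists (weight X i 0 0 0) => q qi; set al := weight _ _ _ _ _.
have [f [Xf f1]] := image_single bX XU XV qi.
pose g : @fld R := f - al *: sqv i q.
suff g0 : cl d01 g = 0.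
  by apply/eqP; rewrite -subr_eq0 Xf -clZ -clB g0.
have gi x : val g (~~ i) x = 0.
  by rewrite /g fldBE fldZE f1 (sqv_in qi) sub0r; case: (i) => /=; rewrite mulr0 oppr0.
have orth_i r : dsq r `<=` reg i -> inner (Hc d01) (cl d01 g) (cl d01 (sqv i r)) = 0.
  move=> ri; rewrite /g clB clZ -Xf innerBl innerZl.
  by rewrite (gram_eq bX XU XV qi ri) (gram_id qi ri) subrr.
have cint0 r : cint lam (fun x => val g i x * cindic (dsq r) x) = 0.
  have [ri|ro] := @dsq_reg R i r.
    have := orth_i r ri; rewrite inner_cl (fip_single (i := i) _ gi ri).
    by rewrite eqxx mul1r.
  rewrite (@eq_cint _ _ _ _ _ (fun=> 0%:C)).
    by rewrite cint_real Rintegral_cst// mul0r.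
  move=> x; have [rx|nx] := pselect (reg i x); last by rewrite (fld_out _ nx) mul0r.
  have nr : ~ dsq r x by move=> h; have : (dsq r `&` reg i) x by []; rewrite ro.
  by rewrite /cindic indicE memNset// mulr0.
have orth F : inner (Hc d01) (cl d01 g) F = 0.
  apply: (@Hc_total R d d01 (fun F => inner (Hc d01) (cl d01 g) F = 0)
    (closed_subspace_orth _)) => j r.
  have [rj|ro] := @dsq_reg R j r.
    by rewrite inner_cl (fip_single (i := i) _ gi rj) cint0 mulr0.
  by rewrite (sqv_out ro) -(scale0r (0 : fld)) clZ scale0r inner0r.
exact: (inner_eq0 (orth _)).
Qed.

End Eigen.

(** * Irreducibility and the invariance of the angle *)

Section Irreducible.
Context {R : realType}.
Local Notation dsq := (@dsq R).
Local Notation reg := (@reg R).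

Definition q0 : nat * int * int := (0%N, 0 : int, 0 : int).

Lemma q0_reg i : dsq q0 `<=` reg i.
Proof. by case: i; [exact: (@sq_reg R true 0 0 0)|exact: (@sq_reg R false 0 0 0)]. Qed.

Section OneAngle.
Variables (c : R) (c01 : 0 <= c < 1).
Local Notation H := (Hc c01).
Local Notation e i q := (cl c01 (sqv i q)).

Lemma inner_q0 i j : inner H (e i q0) (e j q0) = if j == i then 1 else c%:C.
Proof.
rewrite inner_cl (fip_sqv c (@q0_reg i) (@q0_reg j)) area /=.
by rewrite expr0 invr1 mulr1.
Qed.

Lemma sqv_neq0 i q : dsq q `<=` reg i -> e i q != 0.
Proof.
move=> qi; apply/eqP => e0.
have := fip_sqv c qi qi; rewrite -(inner_cl c01) e0 inner0r eqxx mul1r area => /esym/eqP.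
by rewrite invr_eq0 expf_eq0 pnatr_eq0 andbF.
Qed.

(* Pulling the unit square of the second component below the axis makes the
   overlap with the first component visible: this couples the components *)
Lemma Vadj_q0 : Vadj (0, 1) (e false q0) = c%:C *: e true (0%N, 0 : int, -1 : int).
Proof.
have qa : quadrant ((0, 1) : R * R) by split=> /=; rewrite ?ler01.
rewrite (Vadj_cl _ _ qa) -clZ; congr (cl c01 _); apply: fld_ext => j x.
have shq : dsq q0 (x + (0, 1)) <-> dsq (0%N, 0 : int, -1 : int) x.
  have := @sq_shift R true 0 0 0 0 (-1) x; rewrite /sq /sqshift !add0r => ->.
  rewrite expr0 !divr1 /=; suff -> : x + (0, 1) = x - (0%:~R, (-1)%:~R) by [].
  case: x => x1 x2; congr (_, _); rewrite /= ?subr0 ?addr0//.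
  by rewrite opprK.
have ch : cindic (dsq q0) (x + (0, 1)) = cindic (dsq (0%N, 0 : int, -1 : int)) x :> R[i].
  rewrite /cindic !indicE; congr (_%:R)%:C; congr nat_of_bool.
  by apply/idP/idP; rewrite !inE => /shq.
have ri : dsq (0%N, 0 : int, -1 : int) `<=` reg true by exact: (@sq_reg R true 0 0 (-1)).
rewrite coshopE fldZE !(sqv_in (@q0_reg false)) (sqv_in ri) ch.
have [qx|nqx] := pselect (dsq (0%N, 0 : int, -1 : int) x); last first.
  have -> : cindic (dsq (0%N, 0 : int, -1 : int)) x = 0 :> R[i].
    by rewrite /cindic indicE memNset.
  by case: j => /=; rewrite ?addr0 ?mulr0 ?addr0 ?mulr0.
have nf : ~ reg false x.
  move=> fx; have : (dsq (sq true 0 0 (-1)) `&` reg (~~ true)) x by split.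
  by rewrite sq_out.
have c1 (A : set (R * R)) : A x -> cindic A x = 1 :> R[i].
  by move=> Ax; rewrite /cindic indicE mem_set.
case: j => /=.
  by rewrite (c1 _ qx) (c1 _ (ri _ qx)) (c1 (~` reg false) nf) add0r !mul1r !mulr1.
by rewrite /cindic indicE memNset// mul0r mulr0.
Qed.

Lemma generators_bounded : range (@U R c c01) `|` @V R c c01 @` quadrant `<=` @all_bounded R H.
Proof.
move=> _ [[chi _ <-]|[a qa <-]]; first exact: M_bounded.
exact: V_bounded.
Qed.

(** An operator of the commutant has eigenvalues [al] and [be] on the two components. It commutes
    with the adjoint of [V (0, 1)], which sends a square vector of one component to [c] times one of
    the other; hence [c al = c be], and [c] is nonzero. *)
Lemma irreducible_pair : 0 < c -> irreducible (@U R c c01) (@V R c c01).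
Proof.
move=> c0; split; first by exists (e true q0); exact: (sqv_neq0 (@q0_reg true)).
apply/seteqP; split; last exact: (scalar_commutant generators_bounded).
move=> T cT; have bT : bounded_operator T := cT.1.
have [TG TG'] := commutant_generated cT.
have TU chi F : T (@U R c c01 chi F) = @U R c c01 chi (T F).
  by have := congr1 (fun f => f F) (TG _ (or_introl (ex_intro2 _ _ chi I erefl))).
have TV a : quadrant a -> forall F, T (@V R c c01 a F) = @V R c c01 a (T F).
  by move=> qa F; have := congr1 (fun f => f F) (TG _ (or_intror (ex_intro2 _ _ a qa erefl))).
have qa : quadrant ((0, 1) : R * R) by split=> /=; rewrite ?ler01.
have TVadj F : T (@Vadj R c c01 (0, 1) F) = Vadj (0, 1) (T F).
  have := TG' _ _ (or_intror (ex_intro2 _ _ (0, 1) qa erefl)) (@Vadj_adjoint R c c01 _ qa).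
  by move/(congr1 (fun f => f F)).
have [al eal] := intertwiner_eigen bT TU TV true.
have [be ebe] := intertwiner_eigen bT TU TV false.
have ri : dsq (0%N, 0 : int, -1 : int) `<=` reg true by exact: (@sq_reg R true 0 0 (-1)).
have bVadj : bounded_operator (@Vadj R c c01 (0, 1)).
  exact: (adjoint_bounded (V_bounded c01 qa) (@Vadj_adjoint R c c01 _ qa)).
have albe : al = be.
  have := TVadj (e false q0).
  rewrite (ebe _ (@q0_reg false)) (bounded_opZ _ _ bVadj) Vadj_q0.
  rewrite (bounded_opZ _ _ bT) (eal _ ri) !scalerA => /eqP.
  rewrite -subr_eq0 -scalerBl scaler_eq0 (negbTE (sqv_neq0 ri)) orbF.
  rewrite (mulrC be) -mulrBr mulf_eq0 subr_eq0 => /orP[|/eqP//].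
  by move=> /eqP/complexI c00; rewrite c00 ltxx in c0.
exists al; apply/funext.
have bal : bounded_operator (fun F : H => al *: F).
  apply: (vN_scale (vN_all_bounded H)); exact: vN_one (vN_all_bounded H).
apply: (@Hc_total R c c01 (fun F => T F = al *: F) (closed_subspace_eq bT bal)) => i q.
have [qi|qo] := @dsq_reg R i q; last first.
  by rewrite (sqv_out qo) -(scale0r (0 : fld)) clZ scale0r (bounded_op0 bT) scaler0.
by case: i qi => qi; [rewrite (eal _ qi)|rewrite (ebe _ qi) albe].
Qed.

End OneAngle.

Lemma equivalent_angle (c d : R) (c01 : 0 <= c < 1) (d01 : 0 <= d < 1) :
  unitarily_equivalent (@U R c c01) (@V R c c01) (@U R d d01) (@V R d d01) -> c = d.
Proof.
move=> [X [X' [[bX _ XX' X'X _] hU hV]]].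
have K F : X' (X F) = F by exact: (congr1 (fun f => f F) X'X).
have XU chi F : X (@U R c c01 chi F) = @U R d d01 chi (X F).
  by have := congr1 (fun f => f (X F)) (hU chi); rewrite /comp K.
have XV a : quadrant a -> forall F, X (@V R c c01 a F) = @V R d d01 a (X F).
  by move=> qa F; have := congr1 (fun f => f (X F)) (hV a qa); rewrite /comp K.
have iso F G : inner (Hc d01) (X F) (X G) = inner (Hc c01) F G by rewrite XX' K.
have [al eal] := intertwiner_eigen bX XU XV true.
have [be ebe] := intertwiner_eigen bX XU XV false.
have := iso (cl c01 (sqv true q0)) (cl c01 (sqv true q0)).
rewrite (eal _ (@q0_reg true)) !inner_q0 innerZl innerZr !inner_q0 /= mulr1 => nal.
have := iso (cl c01 (sqv false q0)) (cl c01 (sqv false q0)).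
rewrite (ebe _ (@q0_reg false)) !inner_q0 innerZl innerZr !inner_q0 /= mulr1 => nbe.
have := iso (cl c01 (sqv true q0)) (cl c01 (sqv false q0)).
rewrite (eal _ (@q0_reg true)) (ebe _ (@q0_reg false)) inner_q0 innerZl innerZr inner_q0 /=.
(* Squared moduli remove the relative phase of [al] and [be]; [c = d] then follows since both are
   nonnegative. *)
move=> /(congr1 (@absq R)).
rewrite mulrA absqM !absq_real absqM absq_conj.
have a1 z : z * Num.conj z = 1 :> R[i] -> absq z = 1.
  by rewrite mulconjE => /complexI.
rewrite (a1 _ nal) (a1 _ nbe) !mul1r => /eqP.
have /andP[c0 _] := c01; have /andP[d0 _] := d01.
by rewrite eqrXn2// => /eqP.
Qed.

End Irreducible.

(** * The spectrum *)

Section ComplexFubini.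
Context {R : realType} d1 d2 {T1 : measurableType d1} {T2 : measurableType d2}.
Variables (m1 : {sigma_finite_measure set T1 -> \bar R}).
Variables (m2 : {sigma_finite_measure set T2 -> \bar R}).

Lemma measurable_parametric_integral (g : T1 * T2 -> R) : measurable_fun setT g ->
  measurable_fun setT (fun y => \int[m1]_(x in setT) g (x, y)).
Proof.
move=> mg; rewrite /Rintegral.
apply: (measurableT_comp (fine_measurable measurableT)).
have mG : measurable_fun setT (fun z => (g z)%:E) by exact/measurable_EFinP.
rewrite (_ : (fun y => _) = fun y : T2 =>
  (\int[m1]_x ((fun z => (g z)%:E)^\+%E (x, y)) - \int[m1]_x ((fun z => (g z)%:E)^\-%E (x, y)))%E).
  by apply: emeasurable_funB; apply: measurable_fun_fubini_tonelli_G => //;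
    [exact: measurable_funepos|exact: measurable_funeneg].
by apply/funext => y; rewrite [LHS]integralE; congr (_ - _)%E; apply: eq_integral => x _; rewrite ?funeposE ?funenegE.
Qed.

(** The bound by a product of integrable functions gives joint integrability through iterated
    integrals. *)
Lemma Rintegral_Fubini (g : T1 * T2 -> R) (P : T1 -> R) (W : T2 -> R) :
  measurable_fun setT g ->
  m1.-integrable setT (fun x => (P x)%:E) -> m2.-integrable setT (fun y => (W y)%:E) ->
  (forall x y, `|g (x, y)| <= P x * W y) ->
  \int[m1]_(x in setT) \int[m2]_(y in setT) g (x, y) =
  \int[m2]_(y in setT) \int[m1]_(x in setT) g (x, y).
Proof.
move=> mg iP iW gPW.
have mG : measurable_fun setT (fun z => (g z)%:E) by exact/measurable_EFinP.
have mP : measurable_fun setT P by exact/measurable_EFinP/(measurable_int _ iP).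
have mW : measurable_fun setT W by exact/measurable_EFinP/(measurable_int _ iW).
have i2 x : m2.-integrable setT (fun y => (g (x, y))%:E).
  apply: (@le_integrable _ _ _ _ _ _ _ (fun y => (P x * W y)%:E)) => //.
  - exact/measurable_EFinP/(measurableT_comp mg)/measurable_pair1.
  - by move=> y _; rewrite /= lee_fin (le_trans (gPW x y))// ler_norm.
  - exact: integrableZr.
have i1 y : m1.-integrable setT (fun x => (g (x, y))%:E).
  apply: (@le_integrable _ _ _ _ _ _ _ (fun x => (P x * W y)%:E)) => //.
  - exact/measurable_EFinP/(measurableT_comp mg)/measurable_pair2.
  - by move=> x _; rewrite /= lee_fin (le_trans (gPW x y))// ler_norm.
  - by under eq_fun do rewrite mulrC; exact: integrableZr.
have prod : (m1 \x m2)%E.-integrable setT (fun z => (g z)%:E).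
  apply/integrable12ltyP => //.
  have iPW x : (\int[m2]_y `|(P x * W y)%:E| = `|P x|%:E * \int[m2]_y `|W y|%:E)%E.
    rewrite -ge0_integralZl//.
    - by apply: eq_integral => y _; rewrite /= normrM EFinM.
    - exact/measurable_EFinP/measurableT_comp.
  have Wfin : (\int[m2]_y `|W y|%:E < +oo)%E by have /integrableP[] := iW.
  have W0 : (0 <= \int[m2]_y `|W y|%:E)%E by apply: integral_ge0 => y _; rewrite lee_fin.
  apply: (@le_lt_trans _ _ (\int[m1]_x (`|P x|%:E * \int[m2]_y `|W y|%:E))%E).
    apply: ge0_le_integral => //.
    - by move=> x _; exact: integral_ge0.
    - apply: (@measurable_fun_fubini_tonelli_F _ _ _ _ _ m2 (abse \o (fun z => (g z)%:E))) => //=.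
      exact: measurableT_comp.
    - apply: emeasurable_funM; last exact: measurable_cst.
      exact/measurable_EFinP/measurableT_comp.
    - move=> x _; rewrite -iPW; apply: ge0_le_integral => //.
      + apply: measurableT_comp => //.
        exact/measurable_EFinP/(measurableT_comp mg)/measurable_pair1.
      + apply: measurableT_comp => //; apply/measurable_EFinP.
        by apply: measurable_funM => //; exact: measurable_cst.
      + by move=> y _; rewrite /= lee_fin (le_trans (gPW x y))// ler_norm.
  move: Wfin W0; case: (\int[m2]_y `|W y|%:E)%E => // w _; rewrite lee_fin => w0.
  rewrite ge0_integralZr//; last exact/measurable_EFinP/measurableT_comp.
  have /integrableP[_ Pfin] := iP.
  have P0 : (0 <= \int[m1]_x `|P x|%:E)%E by apply: integral_ge0 => x _; rewrite lee_fin.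
  move: Pfin P0; rewrite /=; case: (\int[m1]_x `|P x|%:E)%E => // p _ _.
  by rewrite -EFinM ltry.
rewrite /Rintegral; congr fine.
under eq_integral => x _ do rewrite fineK ?(integrable_fin_num _ (i2 x))//.
under [RHS]eq_integral => y _ do rewrite fineK ?(integrable_fin_num _ (i1 y))//.
exact: (@Fubini _ _ _ _ _ m1 m2 (fun z => (g z)%:E) prod).
Qed.

Lemma Re_le (z : R[i]) (r : R) : 0 <= r -> absq z <= r ^+ 2 -> `|Re z| <= r /\ `|Im z| <= r.
Proof.
move=> r0 h.
have sq (t : R) : t ^+ 2 <= r ^+ 2 -> `|t| <= r.
  by move=> ht; rewrite -(@ler_pXn2r _ 2)// ?nnegrE// real_normK ?num_real.
split; apply: sq; apply: le_trans h; rewrite /absq.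
  by rewrite lerDl sqr_ge0.
by rewrite lerDr sqr_ge0.
Qed.

(** A single bound on the squared modulus controls the real and the imaginary part. *)
Lemma cint_Fubini (G : T1 * T2 -> R[i]) (P : T1 -> R) (W : T2 -> R) :
  cmeasurable G ->
  m1.-integrable setT (fun x => (P x)%:E) -> m2.-integrable setT (fun y => (W y)%:E) ->
  (forall x, 0 <= P x) -> (forall y, 0 <= W y) ->
  (forall x y, absq (G (x, y)) <= (P x * W y) ^+ 2) ->
  cint m1 (fun x => cint m2 (fun y => G (x, y))) = cint m2 (fun y => cint m1 (fun x => G (x, y))).
Proof.
move=> [mR mI] iP iW P0 W0 GPW.
have bd x y := Re_le (mulr_ge0 (P0 x) (W0 y)) (GPW x y).
apply: complex_ext; rewrite /cint /=.
  by apply: (Rintegral_Fubini mR iP iW) => x y; case: (bd x y).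
by apply: (Rintegral_Fubini mI iP iW) => x y; case: (bd x y).
Qed.

Lemma cmeasurable_parametric_cint (G : T1 * T2 -> R[i]) : cmeasurable G ->
  cmeasurable (fun y => cint m1 (fun x => G (x, y))).
Proof.
move=> [mR mI]; split.
  exact: (measurable_parametric_integral mR).
exact: (measurable_parametric_integral mI).
Qed.

End ComplexFubini.

(** * Continuous functions as bounded measurable multipliers *)

Section ContinuousFunctions.
Context {R : realType}.
Local Notation T1 := (measurableTypeR R).
Local Notation T2 := (T1 * T1)%type.
Local Notation lam := (@lebesgue2 R).
Local Notation dsq := (@dsq R).

Lemma open_dsq (O : set (R * R)) x : open O -> O x -> exists q, dsq q x /\ dsq q `<=` O.
Proof.
move=> oO Ox; have /nbhs_ballP[e /= e0 xO] : nbhs x O by exact: open_nbhs_nbhs.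
have [n _ hn] := near_infty_natSinv_expn_lt (PosNum e0).
have /= {}hn := hn n (leqnn n).
pose k (t : R) := Num.floor (t * 2 ^+ n).
exists (n, k x.1, k x.2); split; first by split; exact: dint_cover.
have p0 : 0 < 2 ^+ n :> R by rewrite exprn_gt0.
have near_dint t s : dint n (k t) s -> `|t - s| < e.
  move=> /andP[s1 s2].
  have /andP[t1 t2] : dint n (k t) t by exact: dint_cover.
  have h : 1 < e * 2 ^+ n by move: hn; rewrite ltr_pdivrMr.
  have E : (k t + 1)%:~R = (k t)%:~R + 1 :> R by rewrite intrD.
  rewrite E in s2 t2; rewrite ltr_norml; apply/andP; split; rewrite -(ltr_pM2r p0) mulrBl; lra.
by move=> y [y1 y2]; apply: xO; split; exact: near_dint.
Qed.

(** Bridges the product topology and the product sigma-algebra: an open set is the union of the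
    dyadic squares that it contains, and there are countably many of them. *)
Lemma open_measurable2 (O : set (R * R)) : open O -> measurable (O : set T2).
Proof.
move=> oO; have -> : (O : set T2) = \bigcup_(q in [set q | dsq q `<=` O]) dsq q.
  apply/seteqP; split=> [x Ox|x [q /= qO qx]]; last exact: qO.
  by have [q [qx qO]] := open_dsq oO Ox; exists q.
rewrite bigcup_mkcond; apply: countable_bigcupT_measurable => [|q]; first exact: countableP.
by case: ifP => _ //; exact: measurable_dsq.
Qed.

Lemma continuous_measurable2 (g : R * R -> R) : continuous g -> measurable_fun setT (g : T2 -> R).
Proof.
move=> cg; apply: (measurability (@RGenOInfty.G R)); first exact: RGenOInfty.measurableE.
move=> _ [_ [a ->] <-]; rewrite setTI; apply: open_measurable2.
by move/continuousP : cg; apply; exact: interval_open.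
Qed.

Lemma absq_norm (z : R[i]) : `|z| = (Num.sqrt (absq z))%:C.
Proof. by case: z. Qed.

Lemma continuous_ReIm (f : R * R -> R[i]) : continuous (f : R * R -> R[i]^o) ->
  continuous (fun x => Re (f x)) /\ continuous (fun x => Im (f x)).
Proof.
move=> cf.
have bd x (e : R) : 0 < e -> \forall y \near x, absq (f x - f y) <= e ^+ 2.
  move=> e0; have e0' : 0 < e%:C by rewrite ltcR.
  have /cvgrPdist_lt/(_ _ e0') := cf x; apply: filterS => y.
  rewrite absq_norm ltcR => /ltW h.
  rewrite -(sqr_sqrtr (absq_ge0 (f x - f y))).
  by rewrite ler_sqr ?nnegrE ?sqrtr_ge0// ltW.
split=> x; apply/cvgrPdist_le => e e0; have := bd x e e0; apply: filterS => y.
  by move=> /(Re_le (ltW e0))[+ _]; rewrite !ReImE.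
by move=> /(Re_le (ltW e0))[_]; rewrite !ReImE.
Qed.

Lemma continuous_absq (f : R * R -> R[i]) : continuous (f : R * R -> R[i]^o) ->
  continuous (fun x => absq (f x)).
Proof.
move=> /continuous_ReIm[cr ci] x; rewrite /absq.
by apply: cvgD; rewrite !expr2; apply: cvgM; [exact: cr|exact: cr|exact: ci|exact: ci].
Qed.

Lemma C0_bmeas (f : R * R -> R[i]) : C0 f -> bmeas f.
Proof.
move=> [cf kf]; have [cr ci] := continuous_ReIm cf; split.
  by split; exact: continuous_measurable2.
have ca := continuous_absq cf.
(* Off this set [|f| < 1]; on it [|f|^2] is bounded by continuity and compactness. *)
have cK : compact [set a | 1 <= `|f a|] by exact: kf.
have cK' : compact ((fun x => absq (f x)) @` [set a | 1 <= `|f a|]).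
  by apply: continuous_compact => //; exact: continuous_subspaceT.
have [N [_ hN]] := compact_bounded cK'.
exists (Num.max 1 (N + 1)) => x; rewrite le_max.
have [h|h] := leP (absq (f x)) 1; first by [].
have : (fun x => absq (f x)) x <= N + 1.
  apply: le_trans (ler_norm _) _; apply: hN; first by rewrite ltrDl.
  exists x => //=; rewrite absq_norm -[1]/(1%:C) lecR -[leLHS]sqrtr1.
  by rewrite ler_wsqrtr// ltW.
by move=> ->; rewrite orbT.
Qed.

End ContinuousFunctions.

Section IntegralBounds.
Context {R : realType} d {T : measurableType d} (mu : {measure set T -> \bar R}).

(** A real-valued bound of the modulus, whose integrability follows at once from that of the two
    parts; it serves as dominating function. *)
Definition l1 (z : R[i]) : R := `|Re z| + `|Im z|.

Lemma l1_ge0 z : 0 <= l1 z.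
Proof. by rewrite addr_ge0. Qed.

Lemma absq_l1 z : absq z <= l1 z ^+ 2.
Proof.
rewrite /absq /l1 sqrrD !real_normK ?num_real//.
by rewrite addrAC lerDl mulrn_wge0// mulr_ge0.
Qed.

Lemma integrable_l1 (f : T -> R[i]) : cintegrable mu f ->
  mu.-integrable setT (fun x => (l1 (f x))%:E).
Proof. by move=> [fr fi]; apply: integrableDr; exact: integrable_norm. Qed.

Lemma cintegrable_le (f g : T -> R[i]) : cmeasurable f -> cintegrable mu g ->
  (forall x, absq (f x) <= absq (g x)) -> cintegrable mu f.
Proof.
move=> [mr mi] ig fg.
have bd x := Re_le (l1_ge0 (g x)) (le_trans (fg x) (absq_l1 (g x))).
split; apply: (le_integrabler _ _ (integrable_l1 ig)) => // x; by case: (bd x).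
Qed.

Lemma cint_bound (f g : T -> R[i]) : cmeasurable f -> cintegrable mu g ->
  (forall x, absq (f x) <= absq (g x)) ->
  absq (cint mu f) <= 2 * (\int[mu]_(x in setT) l1 (g x)) ^+ 2.
Proof.
move=> mf ig fg; have [fr fi] := cintegrable_le mf ig fg.
have ig1 := integrable_l1 ig.
have bd x := Re_le (l1_ge0 (g x)) (le_trans (fg x) (absq_l1 (g x))).
have sq (u : T -> R) : mu.-integrable setT (fun x => (u x)%:E) ->
    (forall x, `|u x| <= l1 (g x)) ->
    (\int[mu]_(x in setT) u x) ^+ 2 <= (\int[mu]_(x in setT) l1 (g x)) ^+ 2.
  move=> iu ug; rewrite -(real_normK (num_real (\int[mu]_(x in setT) u x))).
  rewrite ler_sqr ?nnegrE//; last by apply: Rintegral_ge0 => x _; exact: l1_ge0.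
  apply: le_trans (le_normr_Rintegral measurableT iu) _.
  apply: le_Rintegral => //; first exact: integrable_norm.
rewrite /absq mulr_natl mulr2n; apply: lerD; apply: sq => // x; by case: (bd x).
Qed.

End IntegralBounds.

Section Spectrum.
Context {R : realType}.
Local Notation T1 := (measurableTypeR R).
Local Notation T2 := (T1 * T1)%type.
Local Notation lam := (@lebesgue2 R).
Local Notation dsq := (@dsq R).
Local Notation reg := (@reg R).

Lemma sigma_finite_lebesgue2 : sigma_finite setT (lam : set T2 -> \bar R).
Proof.
pose F n : set T2 := if unpickle n is Some q then dsq q else set0.
have FE q : F (pickle q) = dsq q by rewrite /F pickleK.
exists F.
  apply/seteqP; split=> [x _|x _]; last exact: I.
  exists (pickle (0%N, Num.floor (x.1 * 2 ^+ 0), Num.floor (x.2 * 2 ^+ 0))); first exact: I.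
  by rewrite FE; split; exact: dint_cover.
move=> n; rewrite /F; case: (unpickle n) => [q|].
  by split; [exact: measurable_dsq|rewrite lebesgue2_dsq; exact: ltry].
by split; [exact: measurable0|rewrite measure0; exact: ltry].
Qed.

(** [lebesgue2] under a name that carries the sigma-finite structure required by Fubini's
    theorem. *)
Definition plane_measure : set T2 -> \bar R := lam.

HB.instance Definition _ := Measure.on plane_measure.
HB.instance Definition _ := Measure_isSigmaFinite.Build _ _ _ plane_measure sigma_finite_lebesgue2.

Lemma cmeasurable_character2 :
  cmeasurable (fun z : T2 * T2 => character (z.1 : R * R) (z.2 : R * R)).
Proof.
have m11 : measurable_fun setT (fun z : T2 * T2 => z.1.1 : T1).
  exact: (measurableT_comp measurable_fst measurable_fst).
have m12 : measurable_fun setT (fun z : T2 * T2 => z.1.2 : T1).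
  exact: (measurableT_comp measurable_snd measurable_fst).
have m21 : measurable_fun setT (fun z : T2 * T2 => z.2.1 : T1).
  exact: (measurableT_comp measurable_fst measurable_snd).
have m22 : measurable_fun setT (fun z : T2 * T2 => z.2.2 : T1).
  exact: (measurableT_comp measurable_snd measurable_snd).
have md : measurable_fun setT (fun z : T2 * T2 => dotp z.1 z.2).
  by apply: measurable_funD; apply: measurable_funM.
split.
  exact: (measurableT_comp (continuous_measurable_fun (@continuous_cos R)) md).
exact: (measurableT_comp (continuous_measurable_fun (@continuous_sin R)) md).
Qed.

Section Gelfand.
Variable phi : R * R -> R[i].
Hypothesis iphi : complex_integrable phi.

Let kernel (z : T2 * T2) : R[i] := phi z.1 * character (z.1 : R * R) (z.2 : R * R).

Let mphi : cmeasurable (phi : T2 -> R[i]).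
Proof. exact: (@cintegrable_measurable _ _ _ lam). Qed.

Let mkernel : cmeasurable kernel.
Proof.
apply: cmeasurableM; last exact: cmeasurable_character2.
exact: (cmeasurable_comp measurable_fst mphi).
Qed.

Lemma gelfandE a : gelfand_transform phi a = cint plane_measure (fun chi => kernel (chi, a)).
Proof. by []. Qed.

Lemma absq_kernel chi a : absq (kernel (chi, a)) = absq (phi chi).
Proof. by rewrite absqM character_absq mulr1. Qed.

Lemma mkernel1 a : cmeasurable (fun chi : T2 => kernel (chi, a)).
Proof. exact: (cmeasurable_comp (measurable_pair2 a) mkernel). Qed.

Lemma gelfand_bmeas : bmeas (gelfand_transform phi).
Proof.
split; first exact: (cmeasurable_parametric_cint plane_measure mkernel).
exists (2 * (\int[plane_measure]_(x in setT) l1 (phi x)) ^+ 2) => a.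
rewrite gelfandE; apply: cint_bound => //; first exact: mkernel1.
by move=> chi; rewrite absq_kernel.
Qed.

(** Fubini's theorem, the domination coming from characters having modulus one. When [w] is the Gram
    form of two fields, this is the weak integral formula that characterises the integrated form. *)
Lemma gelfand_pairing (w : R * R -> R[i]) : cintegrable lam w ->
  cint lam (fun a => gelfand_transform phi a * w a) =
  cint lam (fun chi => phi chi * cint lam (fun a => character chi a * w a)).
Proof.
move=> iw; have mw := cintegrable_measurable iw.
transitivity (cint plane_measure (fun a => cint plane_measure (fun chi => kernel (chi, a) * w a))).
  apply: eq_cint => a; rewrite mulrC gelfandE -cintZ.
    by apply: eq_cint => chi; rewrite mulrC.
  by apply: cintegrable_le (mkernel1 a) iphi _ => chi; rewrite absq_kernel.
rewrite -(@cint_Fubini _ _ _ _ _ plane_measure plane_measure (fun z => kernel z * w z.2)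
    (fun x => l1 (phi x)) (fun y => l1 (w y))).
- apply: eq_cint => chi; rewrite -cintZ.
    by apply: eq_cint => a; rewrite mulrA.
  apply: cintegrable_le iw _ => [|a]; last by rewrite absqM character_absq mul1r.
  by apply: cmeasurableM mw; have [] := bmeas_character chi.
- by apply: cmeasurableM mkernel _; exact: (cmeasurable_comp measurable_snd mw).
- exact: integrable_l1.
- exact: integrable_l1.
- by move=> x; exact: l1_ge0.
- by move=> y; exact: l1_ge0.
- move=> x y; rewrite absqM absq_kernel exprMn.
  by apply: ler_pM; rewrite ?absq_ge0// absq_l1.
Qed.

End Gelfand.

Section OneAngle.
Variables (c : R) (c01 : 0 <= c < 1).
Local Notation H := (Hc c01).

Lemma M_inner m h k : bmeas m -> inner H (M m (cl c01 h)) (cl c01 k) =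
  cint lam (fun a => m a * form c (fun i => val h i a) (fun i => val k i a)).
Proof.
move=> bm; rewrite M_cl inner_cl; apply: eq_cint => a.
rewrite -formZl; congr form; apply/funext => i; exact: mulopE.
Qed.

Lemma M_C0_representation : C0_representation (H := H) (fun f => M f).
Proof.
split.
- by move=> f _; exact: M_bounded.
- move=> f g /C0_bmeas bf /C0_bmeas bg; apply/funext => F; exact: M_add.
- move=> z f /C0_bmeas bf; apply/funext => F; exact: M_scale.
- move=> f g /C0_bmeas bf /C0_bmeas bg; apply/funext => F; exact: M_mul.
- move=> f /C0_bmeas bf; exact: M_adjoint.
Qed.

Lemma M_integrated_form : integrated_form (@U R c c01) (fun f => M f).
Proof.
split; first exact: M_C0_representation.
move=> phi iphi; elim/(@cl_ind R c c01) => h; elim/(@cl_ind R c c01) => k.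
rewrite (M_inner _ _ (gelfand_bmeas iphi)) (gelfand_pairing iphi (fip_integrable c h k)).
apply: eq_cint => chi; congr (_ * _).
by rewrite /U (M_inner _ _ (bmeas_character chi)).
Qed.

(** The integral is the inner product of the image of the square vector with itself, computed
    through the multiplier [conj f * f]. *)
Lemma M_support f i q : bmeas f -> dsq q `<=` reg i ->
  M f (cl c01 (sqv i q)) = 0 -> cint lam (fun x => (absq (f x))%:C * cindic (dsq q) x) = 0.
Proof.
move=> bf qi Mf0; have bc := bmeas_conj bf.
have bff : bmeas (fun x => Num.conj (f x) * f x) by exact: bmeasM.
have := M_inner (sqv i q) (sqv i q) bff.
rewrite (M_mul _ bc bf) Mf0 (bounded_op0 (M_bounded c01 _)) linear0l => E.
rewrite [RHS]E; apply: eq_cint => x; rewrite [_^* * _]mulrC mulconjE; congr (_ * _).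
rewrite /form !(sqv_in qi).
by case: (i) => /=; rewrite !(rmorph0, mulr0, mul0r, addr0, add0r) conj_cindic -cindicI setIid.
Qed.

Lemma M_spectrum : is_spectrum (@U R c c01) (reg true `|` reg false).
Proof.
have creg i : closed (reg i).
  have ccrd : continuous (crd i : R * R -> R) by case: i => x; [exact: cvg_fst|exact: cvg_snd].
  rewrite (_ : reg i = crd i @^-1` [set t | 0 <= t])//.
  by apply: closed_comp; [move=> x _; exact: ccrd|exact: closed_ge].
split; first exact: closedU.
exists (fun f => M f); first exact: M_integrated_form.
apply/seteqP; split=> f [Cf].
  move=> Mf0; split => // a Fa; apply/absq_eq0/eqP/negPn/negP => fa0.
  have bf := C0_bmeas Cf.
  have [i ia] : exists i, reg i a by case: Fa => ?; [exists true|exists false].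
  (* [|f|^2] exceeds [r] near [a], hence on a dyadic square containing [a]. *)
  set r := absq (f a) / 2.
  have fa : 0 < absq (f a) by rewrite lt_def fa0 absq_ge0.
  have r0 : 0 < r by rewrite divr_gt0.
  have oO : open [set x | r < absq (f x)].
    have /continuousP/(_ _ (interval_open (a := BRight r) (b := +oo%O) isT isT)) := continuous_absq Cf.1.
    by rewrite (_ : _ @^-1` _ = [set x | r < absq (f x)])//; apply/seteqP; split=> x /=;
      rewrite in_itv /= andbT.
  have Oa : [set x | r < absq (f x)] a by rewrite /= /r; lra.
  have [q [qa qO]] := open_dsq oO Oa.
  (* The point [a] may lie on the boundary of the half plane; alignment with the grid still puts the
     whole square inside. *)
  have qi : dsq q `<=` reg i.
    have [//|ro] := @dsq_reg R i q.
    by have : (dsq q `&` reg i) a by []; rewrite ro.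
  have := M_support bf qi (congr1 (fun g => g _) Mf0).
  have i1 : lam.-integrable setT (fun x : T2 => (\1_(dsq q) x : R)%:E).
    have [_] := @L2_cdsq R q; apply: eq_integrable => // x _.
    by rewrite absq_cindic.
  have [mf [C fC]] := bf.
  have i2 : lam.-integrable setT (fun x : T2 => (absq (f x) * (\1_(dsq q) x : R))%:E).
    apply: (le_integrabler _ _ (integrableZr C i1)) => [|x].
      apply: measurable_funM; first exact: measurable_absq mf.
      by apply: measurable_indic; exact: measurable_dsq.
    by rewrite ger0_norm ?mulr_ge0 ?absq_ge0// ler_wpM2r.
  (* The integral that vanishes by [M_support] is at least [r] times the positive area of the
     square. *)
  have lower : r * fine (lam (dsq q)) <= \int[lam]_(x in setT) (absq (f x) * (\1_(dsq q) x : R)).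
    have -> : r * fine (lam (dsq q)) = \int[lam]_(x in setT) (r * (\1_(dsq q) x : R)).
      rewrite RintegralZl//; congr (_ * _).
      by rewrite /Rintegral integral_indic ?setIT//; exact: measurable_dsq.
    apply: le_Rintegral => //; first exact: integrableZr.
    move=> x _; rewrite indicE; case: (boolP (x \in dsq q)) => [|_]; last by rewrite !mulr0.
    by move=> /set_mem/qO/ltW; rewrite !mulr1.
  under eq_cint => x do rewrite /cindic -rmorphM.
  rewrite cint_real => /complexI E; move: lower; rewrite E.
  by rewrite lebesgue2_dsq /= leNgt mulr_gt0// invr_gt0 exprn_gt0.
move=> f0; split => //; apply/funext; elim/(@cl_ind R c c01) => h; rewrite M_cl.
have -> : mulop f h = 0 *: h.
  apply: fld_ext => i x; rewrite fldZE (mulopE _ _ _ (C0_bmeas Cf)) mul0r.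
  have [ix|nix] := pselect (reg i x); last by rewrite (fld_out _ nix) mulr0.
  by rewrite f0 ?mul0r//; case: (i) ix; [left|right].
by rewrite clZ scale0r.
Qed.

End OneAngle.
End Spectrum.

Theorem mainTheorem6 (R : realType) :
  exists (H K : hilbertType R)
         (U V : R * R -> H -> H) (U' V' : R * R -> K -> K),
    [/\ weak_weyl_pair U V /\ irreducible U V,
        weak_weyl_pair U' V' /\ irreducible U' V',
        exists F : set (R * R), is_spectrum U F /\ is_spectrum U' F &
        ~ unitarily_equivalent U V U' V'].
Proof.
have c01 : 0 <= (2^-1 : R) < 1 by apply/andP; split; lra.
have d01 : 0 <= (3^-1 : R) < 1 by apply/andP; split; lra.
exists (Hc c01), (Hc d01), (@U R _ c01), (@V R _ c01), (@U R _ d01), (@V R _ d01); split.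
- split; first exact: weyl_pair.
  by apply: irreducible_pair; rewrite invr_gt0.
- split; first exact: weyl_pair.
  by apply: irreducible_pair; rewrite invr_gt0.
- by exists (reg true `|` reg false); split; exact: M_spectrum.
- by move=> /equivalent_angle/(can_inj (@invrK R))/eqP; rewrite eqr_nat.
Qed.
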